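(* Let $M\in\{2,3,4,5,6,7,8,9,10,12,13,16,18,25\}$ and let $N$ be a positive integer with $\gcd(M,N)=1$. Then the polynomial $\Psi_N^{\Gamma_0(M)}(X,Y)$, regarded as a polynomial in $X$ with coefficients in the field $\mathbb{C}(Y)$, is irreducible.
   Context: $\Gamma_0(M)=\{\gamma\in\mathrm{SL}_2(\mathbb{Z}):\gamma\equiv\begin{pmatrix}*&*\\0&*\end{pmatrix}\bmod M\}$. With $\eta(\tau)=q^{1/24}\prod_{n\ge1}(1-q^n)$, $q=e^{2\pi i\tau}$, the Hauptmodul $t$ of $\Gamma_0(M)$ is: $M=2$: $\eta(\tau)^{24}/\eta(2\tau)^{24}$; $3$: $\eta(\tau)^{12}/\eta(3\tau)^{12}$; $4$: $\eta(\tau)^8/\eta(4\tau)^8$; $5$: $\eta(\tau)^6/\eta(5\tau)^6$; $6$: $\eta(\tau)^5\eta(3\tau)/(\eta(2\tau)\eta(6\tau)^5)$; $7$: $\eta(\tau)^4/\eta(7\tau)^4$; $8$: $\eta(\tau)^4\eta(4\tau)^2/(\eta(2\tau)^2\eta(8\tau)^4)$; $9$: $\eta(\tau)^3/\eta(9\tau)^3$; $10$: $\eta(\tau)^3\eta(5\tau)/(\eta(2\tau)\eta(10\tau)^3)$; $12$: $\eta(\tau)^3\eta(4\tau)\eta(6\tau)^2/(\eta(2\tau)^2\eta(3\tau)\eta(12\tau)^3)$; $13$: $\eta(\tau)^2/\eta(13\tau)^2$; $16$: $\eta(\tau)^2\eta(8\tau)/(\eta(2\tau)\eta(16\tau)^2)$;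 $18$: $\eta(\tau)^2\eta(6\tau)\eta(9\tau)/(\eta(2\tau)\eta(3\tau)\eta(18\tau)^2)$; $25$: $\eta(\tau)/\eta(25\tau)$. $\Psi_N^{\Gamma_0(M)}(X,Y)\in\mathbb{Z}[X,Y]$ is the unique polynomial with $\Psi_N^{\Gamma_0(M)}(X,t(\tau))=\prod_{a,d>0,\ ad=N,\ 0\le b<d,\ \gcd(a,b,d)=1}(X-t(\frac{a\tau+b}{d}))$ for all $\tau$ in the upper half plane. *)

(* Defs.v *)
From HB Require Import structures.
From mathcomp Require Import all_boot all_order all_algebra fraction.
From mathcomp Require Import complex.
From mathcomp Require Import all_classical all_reals all_analysis.

Set Implicit Arguments.
Unset Strict Implicit.
Unset Printing Implicit Defensive.

Import Order.TTheory GRing.Theory Num.Theory numFieldNormedType.Exports.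

Local Open Scope classical_set_scope.
Local Open Scope complex_scope.
Local Open Scope ring_scope.

Section ModularFunctions.
Variable R : realType.
Implicit Types z tau : R[i].

Definition cexp z : R[i] :=
  (expR (complex.Re z))%:C * (cos (complex.Im z) +i* sin (complex.Im z)).

(* [qpow tau r] is q^r for the branch q^r = e^(2 pi i tau r). *)
Definition qpow tau (r : R) : R[i] := cexp ((0 +i* (2 * pi * r)) * tau).

(* The topology of the complex plane is carried by the alias R[i]^o. *)
Definition eta tau : R[i] :=
  qpow tau (24%:R^-1) *
  lim ((\prod_(1 <= n < k.+1) (1 - qpow tau 1 ^+ n) : R[i]^o) @[k --> \oo]).

(* The value at the levels M that are not listed is irrelevant. *)
Definition hauptmodul (M : nat) tau : R[i] :=
  match M with
  | 2  => eta tau ^+ 24 / eta (2 * tau) ^+ 24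
  | 3  => eta tau ^+ 12 / eta (3 * tau) ^+ 12
  | 4  => eta tau ^+ 8 / eta (4 * tau) ^+ 8
  | 5  => eta tau ^+ 6 / eta (5 * tau) ^+ 6
  | 6  => eta tau ^+ 5 * eta (3 * tau) / (eta (2 * tau) * eta (6 * tau) ^+ 5)
  | 7  => eta tau ^+ 4 / eta (7 * tau) ^+ 4
  | 8  => eta tau ^+ 4 * eta (4 * tau) ^+ 2
          / (eta (2 * tau) ^+ 2 * eta (8 * tau) ^+ 4)
  | 9  => eta tau ^+ 3 / eta (9 * tau) ^+ 3
  | 10 => eta tau ^+ 3 * eta (5 * tau) / (eta (2 * tau) * eta (10 * tau) ^+ 3)
  | 12 => eta tau ^+ 3 * eta (4 * tau) * eta (6 * tau) ^+ 2
          / (eta (2 * tau) ^+ 2 * eta (3 * tau) * eta (12 * tau) ^+ 3)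
  | 13 => eta tau ^+ 2 / eta (13 * tau) ^+ 2
  | 16 => eta tau ^+ 2 * eta (8 * tau) / (eta (2 * tau) * eta (16 * tau) ^+ 2)
  | 18 => eta tau ^+ 2 * eta (6 * tau) * eta (9 * tau)
          / (eta (2 * tau) * eta (3 * tau) * eta (18 * tau) ^+ 2)
  | 25 => eta tau / eta (25 * tau)
  | _  => 0
  end.

(* In {poly {poly int}} the outer variable is X and the inner one is Y.  The
   bounds on a and d lose nothing, as both divide N > 0. *)
Definition is_modular_polynomial (M N : nat) (Psi : {poly {poly int}}) : Prop :=
  forall tau, 0 < complex.Im tau ->
    map_poly (fun c : {poly int} => (map_poly intr c).[hauptmodul M tau]) Psi =
    \prod_(a < N.+1) \prod_(d < N.+1 | [&& 0 < a, 0 < d & a * d == N]%N)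
      \prod_(b < d | gcdn (gcdn a b) d == 1%N)
        ('X - (hauptmodul M ((a%:R * tau + b%:R) / d%:R))%:P).

Definition poly_over_CY (Psi : {poly {poly int}}) :
    {poly {fraction {poly R[i]}}} :=
  map_poly (fun c : {poly int} => tofrac (map_poly intr c : {poly R[i]})) Psi.

End ModularFunctions.

(* Main.v *)
Require Import Defs.
From mathcomp Require Import all_boot all_order all_algebra fraction generic_quotient.
From mathcomp Require Import complex.
From mathcomp Require Import all_classical all_reals all_analysis.
From mathcomp Require Import ring lra zify.

(* The Hauptmodul t is Gamma_0(M)-invariant.  This rests on the inversion formula
   of eta: Euler's pentagonal series for eta is summed against its dual through
   discrete Fourier sums, the integral of a Gaussian over a slanted line being
   compared with that over the real line by deforming Riemann sums.  Euclid's
   algorithm then gives the multiplier of eta on SL_2(Z), and the invariance is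
   checked by computation on Schreier generators of Gamma_0(M).

   If e(Y) Psi = A B over C[Y], then for each conjugate f = t(alpha tau) the
   product A(f, t) B(f, t) is zero; both factors are quotients of power series in
   a fractional power of q, so one of them is identically zero.  Matrices in
   Gamma_0(M) permute the conjugates transitively because gcd(M, N) = 1, so that
   factor is zero at every conjugate.  The conjugates are pairwise distinct for
   Im tau large, by their leading q-exponents and coefficients, hence that factor
   has full degree in X. *)

Set Implicit Arguments.
Unset Strict Implicit.
Unset Printing Implicit Defensive.

Import Order.TTheory GRing.Theory Num.Theory numFieldNormedType.Exports.

Local Open Scope classical_set_scope.
Local Open Scope complex_scope.
Local Open Scope ring_scope.

(** * The complex exponential and elementary estimates *)

(** No contour integral and no identity theorem is invoked. Functions on the half plane are handled
    as limits of polynomials in a root of q, and the dichotomy for such limits, zero everywhere or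
    nonzero near the cusp, does the work of the identity theorem; it suffices because every
    comparison can be made at large Im tau. The Gaussian integral is never evaluated: a Riemann sum
    on the real line stands for it up to the last step, where the fixed point i of tau -> -1/tau, at
    which eta is nonzero, shows that the accumulated constant tends to 1. Slanted lines are forced
    because the Gaussian that matches the pentagonal exponents has a direction V with V^2 = -3 i
    tau, which is real only on the imaginary axis. Invariance of an eta quotient becomes a finite
    check because all its factors share one automorphy factor, whose total power is 0; only a 24th
    root of unity is left to compute on generators. *)

Section ComplexModulus.
Variable R : realType.
Implicit Types z w : R[i].

Definition cmod z : R := Normc.normc z.

Lemma cmodE z : `|z| = (cmod z)%:C.
Proof. by case: z. Qed.

Lemma cmod_ge0 z : 0 <= cmod z.
Proof. by rewrite -lecR -cmodE normr_ge0. Qed.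

Lemma cmod0 : cmod 0 = 0. Proof. exact: Normc.normc0. Qed.
Lemma cmod1 : cmod 1 = 1. Proof. exact: Normc.normc1. Qed.

Lemma cmodM z w : cmod (z * w) = cmod z * cmod w.
Proof. exact: Normc.normcM. Qed.

Lemma cmodV z : cmod z^-1 = (cmod z)^-1.
Proof. exact: Normc.normcV. Qed.

Lemma cmodN z : cmod (- z) = cmod z.
Proof. by apply: complexI; rewrite -!cmodE normrN. Qed.

Lemma cmodB z w : cmod (z - w) = cmod (w - z).
Proof. by rewrite -cmodN opprB. Qed.

Lemma cmodD z w : cmod (z + w) <= cmod z + cmod w.
Proof. by rewrite -lecR rmorphD /= -!cmodE ler_normD. Qed.

Lemma cmod_sub z w : cmod z - cmod w <= cmod (z - w).
Proof. by rewrite lerBlDr; apply: le_trans (cmodD _ _); rewrite subrK. Qed.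

Lemma cmodX z n : cmod (z ^+ n) = cmod z ^+ n.
Proof. by elim: n => [|n IH]; rewrite ?expr0 ?cmod1 // !exprS cmodM IH. Qed.

Lemma cmod_real (x : R) : cmod x%:C = `|x|.
Proof. by rewrite /cmod /= expr0n /= addr0 sqrtr_sqr. Qed.

Lemma cmod_nat n : cmod (n%:R : R[i]) = n%:R.
Proof. by rewrite -(rmorph_nat (real_complex R)) cmod_real normr_nat. Qed.

Lemma cmod_i : cmod 'i%C = 1.
Proof. by rewrite /cmod /= expr0n expr1n /= add0r sqrtr1. Qed.

Lemma cmod_eq0 z : (cmod z == 0) = (z == 0).
Proof. by apply/eqP/eqP => [/Normc.eq0_normc|->]; rewrite ?cmod0. Qed.

Lemma cmod_gt0 z : (0 < cmod z) = (z != 0).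
Proof. by rewrite lt_def cmod_ge0 andbT cmod_eq0. Qed.

Lemma cmod_sum (I : Type) (s : seq I) (P : pred I) (F : I -> R[i]) :
  cmod (\sum_(i <- s | P i) F i) <= \sum_(i <- s | P i) cmod (F i).
Proof.
elim/big_ind2: _ => [|x1 x2 y1 y2 h1 h2|//]; first by rewrite cmod0.
by apply: le_trans (cmodD _ _) _; apply: lerD.
Qed.

Lemma cmod_prod (I : Type) (s : seq I) (P : pred I) (F : I -> R[i]) :
  cmod (\prod_(i <- s | P i) F i) = \prod_(i <- s | P i) cmod (F i).
Proof. by apply: (big_morph cmod cmodM cmod1). Qed.

Lemma normRe_le z : `|complex.Re z| <= cmod z.
Proof. by rewrite -lecR -cmodE; exact: normc_ge_Re. Qed.

Lemma normIm_le z : `|complex.Im z| <= cmod z.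
Proof.
case: z => a b; rewrite /cmod /= -sqrtr_sqr ler_wsqrtr // lerDr.
exact: sqr_ge0.
Qed.

Lemma cmod_le_ReIm z : cmod z <= `|complex.Re z| + `|complex.Im z|.
Proof.
rewrite [z in cmod z]complexE; apply: le_trans (cmodD _ _) _.
by rewrite cmodM cmod_i mul1r !cmod_real.
Qed.

Lemma ReD z w : complex.Re (z + w) = complex.Re z + complex.Re w.
Proof. by case: z w => a b [c d]. Qed.
Lemma ImD z w : complex.Im (z + w) = complex.Im z + complex.Im w.
Proof. by case: z w => a b [c d]. Qed.
Lemma ReN z : complex.Re (- z) = - complex.Re z.
Proof. by case: z. Qed.
Lemma ImN z : complex.Im (- z) = - complex.Im z.
Proof. by case: z. Qed.
Lemma ReM z w : complex.Re (z * w) =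
  complex.Re z * complex.Re w - complex.Im z * complex.Im w.
Proof. by case: z w => a b [c d]. Qed.
Lemma ImM z w : complex.Im (z * w) =
  complex.Re z * complex.Im w + complex.Im z * complex.Re w.
Proof. by case: z w => a b [c d] /=; rewrite mulrC. Qed.
Lemma ReC (x : R) : complex.Re x%:C = x. Proof. by []. Qed.
Lemma ImC (x : R) : complex.Im x%:C = 0. Proof. by []. Qed.
Lemma RealD (x y : R) : (x + y)%:C = x%:C + y%:C. Proof. exact: rmorphD. Qed.
Lemma RealM (x y : R) : (x * y)%:C = x%:C * y%:C. Proof. exact: rmorphM. Qed.
Lemma RealN (x : R) : (- x)%:C = - x%:C. Proof. exact: rmorphN. Qed.
Lemma RealV (x : R) : (x^-1)%:C = (x%:C)^-1. Proof. exact: fmorphV. Qed.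
Lemma Realn n : (n%:R : R)%:C = n%:R. Proof. exact: rmorph_nat. Qed.
Lemma imE (x : R) : 0 +i* x = 'i%C * x%:C.
Proof. by simpc. Qed.
Lemma ii : ('i * 'i = -1 :> R[i])%C.
Proof. by rewrite -expr2 sqr_i. Qed.

End ComplexModulus.

Section ComplexExp.
Variable R : realType.
Implicit Types z w : R[i].

Lemma cexpD z w : cexp (z + w) = cexp z * cexp w.
Proof.
rewrite /cexp ReD ImD expRD cosD sinD rmorphM /=.
rewrite mulrACA; congr (_ * _).
by simpc; congr (_ +i* _); ring.
Qed.

Lemma cexp0 : cexp (0 : R[i]) = 1.
Proof. by rewrite /cexp /= expR0 cos0 sin0 mul1r. Qed.

Lemma cmod_cexp z : cmod (cexp z) = expR (complex.Re z).
Proof.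
rewrite /cexp cmodM cmod_real ger0_norm ?expR_ge0 // /cmod /=.
by rewrite cos2Dsin2 sqrtr1 mulr1.
Qed.

Lemma cexp_neq0 z : cexp z != 0.
Proof. by rewrite -cmod_gt0 cmod_cexp expR_gt0. Qed.

Lemma cexpN z : cexp (- z) = (cexp z)^-1.
Proof.
apply: (mulfI (cexp_neq0 z)); rewrite -cexpD subrr cexp0 mulfV //.
exact: cexp_neq0.
Qed.

Lemma cexpMn z n : cexp (n%:R * z) = cexp z ^+ n.
Proof.
elim: n => [|n IH]; first by rewrite mul0r cexp0 expr0.
by rewrite -natr1 mulrDl mul1r cexpD IH exprSr.
Qed.

Lemma cexp_2pii : cexp ('i%C * (2 * pi : R)%:C) = 1.
Proof.
rewrite -imE /cexp /= expR0 mul1r mulr_natl cos2pi sin2pi.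
by [].
Qed.

Lemma cexp_pii : cexp ('i%C * (pi : R)%:C) = -1.
Proof.
rewrite -imE /cexp /= expR0 mul1r cospi sinpi.
by simpc; congr (_ +i* _); rewrite oppr0.
Qed.

Lemma cexp_2pii_eq1 (r : R) : `|r| < 1 -> cexp ('i%C * (2 * pi * r)%:C) = 1 ->
  r = 0.
Proof.
move=> r1; rewrite -imE /cexp /= expR0 mul1r => -[+ _].
rewrite (_ : 2 * pi * r = (pi * r) *+ 2); last by ring.
rewrite cos_mulr2n cos2sin2 => /eqP h.
have s0 : sin (pi * r) = 0.
  by apply/eqP; rewrite -sqrf_eq0; apply/eqP; move/eqP: h; rewrite !mulr2n; lra.
have p0 := pi_gt0 R.
have [r0|r0|//] := ltgtP r 0; exfalso.
- have : 0 < sin (pi * - r).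
    apply: sin_gt0_pi; apply/andP; split; first by rewrite mulr_gt0 // oppr_gt0.
    by rewrite gtr_pMr //; move: r1; rewrite ltr0_norm.
  by rewrite mulrN sinN s0 oppr0 ltxx.
- have : 0 < sin (pi * r).
    apply: sin_gt0_pi; apply/andP; split; first by rewrite mulr_gt0.
    by rewrite gtr_pMr //; move: r1; rewrite gtr0_norm.
  by rewrite s0 ltxx.
Qed.

End ComplexExp.

(** * Elementary bounds for exp, sin and cos *)

Section RealInequalities.
Variable R : realType.
Implicit Types a b x : R.

Lemma abs_expR_sub1 a : `|expR a - 1| <= `|a| * Num.max 1 (expR a).
Proof.
have h1 := expR_ge1Dx a; have h2 := expR_ge1Dx (- a).
have e0 := expR_gt0 a; have h3 := expRxMexpNx_1 a.
have h4 : expR a - 1 <= a * expR a.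
  by move: h2; rewrite -(ler_pM2l e0) h3 mulrDr; lra.
have [a0|a0] := leP 0 a.
  rewrite (max_idPr _); last by lra.
  by rewrite !ger0_norm //; lra.
have ea : expR a <= 1 by rewrite expR_le1 ltW.
by rewrite (max_idPl ea) (ltr0_norm a0) mulr1 ler0_norm; lra.
Qed.

Lemma abs_expR_sub1D a : `|expR a - 1 - a| <= a ^+ 2 * Num.max 1 (expR a).
Proof.
have h1 := expR_ge1Dx a; have h2 := expR_ge1Dx (- a).
have e0 := expR_gt0 a; have h3 := expRxMexpNx_1 a.
have h4 : expR a - 1 <= a * expR a.
  by move: h2; rewrite -(ler_pM2l e0) h3 mulrDr; lra.
rewrite ger0_norm; last by lra.
have h5 : expR a - 1 - a <= a * (expR a - 1) by lra.
apply: (le_trans h5); apply: (le_trans (ler_norm _)).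
rewrite normrM -(real_normK (num_real a)) expr2 -mulrA.
by rewrite ler_wpM2l // abs_expR_sub1.
Qed.

Lemma abs_sin_le x : `|sin x| <= `|x|.
Proof.
wlog x0 : x / 0 <= x.
  move=> h; have [/h//|x0] := leP 0 x.
  by rewrite -[`|sin x|]normrN -[`|x|]normrN -sinN h // oppr_ge0 ltW.
have [|c _] := @MVT_segment R sin cos 0 x x0.
- by apply: continuous_subspaceT; exact: continuous_sin.
rewrite sin0 !subr0 => ->; rewrite normrM ler_piMl //; exact: cos_max.
Qed.

Lemma abs_cos_sub1 x : `|cos x - 1| <= x ^+ 2.
Proof.
have -> : cos x - 1 = - (2 * sin (x / 2) ^+ 2).
  have -> : cos x = cos ((x / 2) *+ 2) by congr cos; rewrite -mulr_natr divfK.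
  by rewrite cos_mulr2n cos2sin2 !mulr2n; lra.
rewrite normrN normrM normrX (ger0_norm (ler0n _ _)).
have h := abs_sin_le (x / 2).
have : `|sin (x / 2)| ^+ 2 <= `|x / 2| ^+ 2 by rewrite lerXn2r ?nnegrE.
rewrite (real_normK (num_real (x/2))) => h2.
apply: (le_trans (ler_wpM2l _ h2)) => //.
by rewrite expr_div_n; have := sqr_ge0 x; lra.
Qed.

Lemma abs_sin_subid x : `|sin x - x| <= x ^+ 2.
Proof.
wlog x0 : x / 0 <= x.
  move=> h; have [/h//|x0] := leP 0 x.
  rewrite -[`|_|]normrN opprB -(sqrrN x).
  rewrite (_ : x - sin x = sin (- x) - - x); last by rewrite sinN; ring.
  by rewrite h // oppr_ge0 ltW.
have [|c /andP[]] := @MVT_segment R (fun y => sin y - y) (fun y => cos y - 1) 0 x x0.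
- apply: continuous_subspaceT => y; apply: cvgB; last exact: cvg_id.
  exact: continuous_sin.
rewrite !bnd_simp => c0 cx; rewrite sin0 !subr0 => ->.
have c1 : `|cos c - 1| <= c.
  have [|d _] := @MVT_segment R cos (fun y => - sin y) 0 c c0.
  - by apply: continuous_subspaceT; exact: continuous_cos.
  rewrite cos0 subr0 => ->; rewrite normrM normrN (ger0_norm c0).
  by rewrite ler_piMl //; exact: sin_max.
rewrite normrM (ger0_norm x0) expr2 ler_wpM2r //.
exact: le_trans cx.
Qed.

(** By the mean value theorem sin(x/2) >= cos(x/2) x/2, so sin x >= 2 cos(x/2)^2 x/2 = (1 + cos x)
    x/2, and cos x is nonnegative on this range. *)
Lemma sin_ge_half x : 0 <= x <= pi / 2 -> x / 2 <= sin x.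
Proof.
move=> /andP[x0 x2]; have p0 := pi_gt0 R.
have y0 : 0 <= x / 2 by lra.
have [|c] := @MVT_segment R sin cos 0 (x / 2) y0.
- by apply: continuous_subspaceT; exact: continuous_sin.
rewrite in_itv /= sin0 !subr0 => /andP[c0 cx] e.
have cc : cos (x / 2) <= cos c.
  rewrite leNgt ltr_cos ?in_itv /=; last 2 first.
  - by apply/andP; split; lra.
  - by apply/andP; split; lra.
  by rewrite -leNgt.
have cp : 0 <= cos (x / 2) by apply: cos_ge0_pihalf; apply/andP; split; lra.
have dbl : cos x = 2 * cos (x / 2) ^+ 2 - 1.
  have -> : cos x = cos ((x / 2) *+ 2) by congr cos; rewrite -mulr_natr divfK.
  by rewrite cos_mulr2n -mulr_natl.
have cx0 : 0 <= cos x by apply: cos_ge0_pihalf; apply/andP; split; lra.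
have -> : sin x = 2 * cos (x / 2) * sin (x / 2).
  have -> : sin x = sin ((x / 2) *+ 2) by congr sin; rewrite -mulr_natr divfK.
  by rewrite sin_mulr2n -mulr_natl mulrA.
rewrite e.
have : cos (x / 2) ^+ 2 * (x / 2) <= cos (x / 2) * (cos c * (x / 2)).
  by rewrite expr2 -mulrA ler_wpM2l // ler_wpM2r.
have : (1 / 2) * (x / 2) <= cos (x / 2) ^+ 2 * (x / 2) by rewrite ler_wpM2r //; lra.
by lra.
Qed.

End RealInequalities.

(** * Second-order bound for the complex exponential; convergence of sequences *)

Section ComplexInequalities.
Variable R : realType.
Implicit Types z w y : R[i].

(** The maximum replaces a bound on [y]: multiplied by the modulus of a Gaussian at one point it
    becomes the larger of two Gaussian moduli, which is how [gs_taylor] uses it. *)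
Lemma cmod_cexp_sub1D y :
  cmod (cexp y - 1 - y) <= 4 * cmod y ^+ 2 * Num.max 1 (expR (complex.Re y)).
Proof.
have := normRe_le y; have := normIm_le y; move: (cmod_ge0 y).
move: (cmod y) => m m0; set a := complex.Re y; set b := complex.Im y => hb ha.
set M := Num.max _ _.
have M1 : 1 <= M by rewrite le_max lexx.
have Me : expR a <= M by rewrite le_max lexx orbT.
have hs (t : R) : `|t| <= m -> t ^+ 2 <= m ^+ 2.
  by move=> h; rewrite -(real_normK (num_real t)) lerXn2r // nnegrE.
have -> : cexp y - 1 - y =
  (expR a)%:C * ((cos b - 1)%:C + 'i%C * (sin b - b)%:C) + (expR a - 1 - a)%:C
   + 'i%C * (b * (expR a - 1))%:C.
  by rewrite /cexp /a /b {a b hb ha M M1 Me}; case: y => a b /=; simpc; congr (_ +i* _); ring.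
have b2 := hs _ hb; have a2 := hs _ ha.
have t1 : cmod ((expR a)%:C * ((cos b - 1)%:C + 'i%C * (sin b - b)%:C)) <=
   M * (2 * m ^+ 2).
  rewrite cmodM cmod_real (ger0_norm (expR_ge0 _)).
  apply: ler_pM; rewrite ?expR_ge0 ?cmod_ge0 //.
  apply: le_trans (cmodD _ _) _; rewrite cmodM cmod_i !cmod_real.
  by have := abs_cos_sub1 b; have := abs_sin_subid b; lra.
have t2 : cmod (expR a - 1 - a)%:C <= m ^+ 2 * M.
  rewrite cmod_real; apply: (le_trans (abs_expR_sub1D a)).
  by rewrite ler_wpM2r //; lra.
have t3 : cmod ('i%C * (b * (expR a - 1))%:C) <= m * (m * M).
  rewrite cmodM cmod_i mul1r cmod_real normrM.
  apply: ler_pM => //; apply: (le_trans (abs_expR_sub1 a)).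
  by rewrite ler_wpM2r //; lra.
apply: le_trans (cmodD _ _) _; apply: le_trans (lerD (cmodD _ _) (lexx _)) _.
apply: le_trans (lerD (lerD t1 t2) t3) _.
by rewrite le_eqVlt; apply/orP; left; apply/eqP; ring.
Qed.

Definition ctends (u : nat -> R[i]) (l : R[i]) :=
  forall e : R, 0 < e -> exists K, forall k, (K <= k)%N -> cmod (u k - l) < e.

(** One-sided, so that domination needs no sign condition. By conversion [ctends u l] is
    [small (fun k => cmod (u k - l))], and the proofs below pass one for the other. *)
Definition small (a : nat -> R) :=
  forall e : R, 0 < e -> exists K, forall k, (K <= k)%N -> a k < e.

Lemma smallP (a : nat -> R) : (forall k, 0 <= a k) ->
  (a @ \oo --> (0 : R)) <-> small a.
Proof.
move=> a0; split=> [/cvgrPdist_lt h e e0|h].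
  have [K _ hK] := h e e0; exists K => k Kk.
  by have := hK k Kk; rewrite /= sub0r normrN ger0_norm.
apply/cvgrPdist_lt => e e0; have [K hK] := h e e0.
by exists K => // k Kk /=; rewrite sub0r normrN ger0_norm //; apply: hK.
Qed.

Lemma small_le (a b : nat -> R) : (forall k, b k <= a k) -> small a -> small b.
Proof.
move=> h ha e /ha[K hK]; exists K => k Kk.
by apply: le_lt_trans (h k) (hK k Kk).
Qed.

Lemma smallD (a b : nat -> R) : small a -> small b -> small (fun k => a k + b k).
Proof.
move=> ha hb e e0; have e2 : 0 < e / 2 by lra.
have [K1 h1] := ha _ e2; have [K2 h2] := hb _ e2.
exists (maxn K1 K2) => k; rewrite geq_max => /andP[/h1 ? /h2 ?]; lra.
Qed.

Lemma smallZ (c : R) (a : nat -> R) : 0 <= c -> small a -> small (fun k => c * a k).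
Proof.
move=> c0 ha e e0; have e2 : 0 < e / (c + 1) by rewrite divr_gt0 //; lra.
have [K h] := ha _ e2; exists K => k /h.
rewrite ltr_pdivlMr; last lra.
move=> h1; have [x|x] := leP 0 (a k); first nra.
by apply: le_lt_trans e0; rewrite mulr_ge0_le0 // ltW.
Qed.

Lemma small0 : small (fun=> 0). Proof. by move=> e e0; exists 0%N. Qed.

Lemma small_geo (r : R) : 0 <= r < 1 -> small (fun k => r ^+ k).
Proof.
move=> /andP[r0 r1]; apply/smallP => [k|]; first exact: exprn_ge0.
by apply: cvg_expr; rewrite ger0_norm.
Qed.

Lemma small_inv : small (fun k => k.+1%:R^-1).
Proof. by apply/smallP => [k|]; [rewrite invr_ge0 | exact: cvg_harmonic]. Qed.

Lemma small_const_le (c : R) (a : nat -> R) : small a -> (forall k, c <= a k) -> c <= 0.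
Proof.
move=> ha h; rewrite leNgt; apply/negP => c0.
by have [K /(_ K (leqnn _))] := ha _ c0; rewrite ltNge h.
Qed.

Lemma ctends_unique (u : nat -> R[i]) l1 l2 : ctends u l1 -> ctends u l2 -> l1 = l2.
Proof.
move=> h1 h2; apply/eqP; rewrite -subr_eq0 -cmod_eq0 eq_le cmod_ge0 andbT.
apply: (small_const_le (smallD h1 h2)) => k.
rewrite [X in _ <= X + _]cmodB; apply: le_trans (cmodD _ _).
by rewrite addrA subrK.
Qed.

Lemma ctends_near (u v : nat -> R[i]) (a : nat -> R) l :
  ctends u l -> (forall k, cmod (v k - u k) <= a k) -> small a -> ctends v l.
Proof.
move=> h1 h2 /(smallD h1); apply: small_le => k /=.
rewrite (_ : v k - l = (u k - l) + (v k - u k)); last by ring.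
by apply: le_trans (cmodD _ _) _; rewrite lerD2l.
Qed.

Lemma ctends_ext (u v : nat -> R[i]) l : u =1 v -> ctends u l -> ctends v l.
Proof. by move=> /funext ->. Qed.

Lemma ctends_cst (c : R[i]) : ctends (fun=> c) c.
Proof. by move=> e e0; exists 0%N => k _; rewrite subrr cmod0. Qed.

Lemma ctendsD (u v : nat -> R[i]) l m :
  ctends u l -> ctends v m -> ctends (fun k => u k + v k) (l + m).
Proof.
move=> h1 h2; apply: small_le (smallD h1 h2) => k /=.
by rewrite opprD addrACA; apply: cmodD.
Qed.

Lemma ctendsZ c (u : nat -> R[i]) l :
  ctends u l -> ctends (fun k => c * u k) (c * l).
Proof.
move=> h; apply: small_le (smallZ (cmod_ge0 c) h) => k /=.
by rewrite -mulrBr cmodM.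
Qed.

Lemma ctends_bounded (u : nat -> R[i]) l : ctends u l ->
  exists K, forall k, (K <= k)%N -> cmod (u k) <= cmod l + 1.
Proof.
move=> /(_ 1 ltr01) [K h]; exists K => k /h hk.
by have := cmod_sub (u k) l; lra.
Qed.

Lemma ctendsM (u v : nat -> R[i]) l m :
  ctends u l -> ctends v m -> ctends (fun k => u k * v k) (l * m).
Proof.
move=> h1 h2 e e0.
have [K hK] := ctends_bounded h1.
have l1 : 0 <= cmod l + 1 by rewrite addr_ge0 ?cmod_ge0.
have [K2 hK2] := smallD (smallZ l1 h2) (smallZ (cmod_ge0 m) h1) e0.
exists (maxn K K2) => k; rewrite geq_max => /andP[/hK kK /hK2].
apply: le_lt_trans; rewrite (_ : _ - _ = u k * (v k - m) + m * (u k - l)); last by ring.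
apply: le_trans (cmodD _ _) _; rewrite !cmodM lerD2r ler_wpM2r //; exact: cmod_ge0.
Qed.

Lemma ctends_sub (u : nat -> R[i]) l (f : nat -> nat) :
  (forall k, (k <= f k)%N) -> ctends u l -> ctends (u \o f) l.
Proof.
move=> hf h e /h[K hK]; exists K => k Kk; apply: hK.
exact: leq_trans Kk (hf k).
Qed.

Lemma cmod_lim_le (u : nat -> R[i]) l (c : R) : ctends u l ->
  (forall k, cmod (u k) <= c) -> cmod l <= c.
Proof.
move=> h hc; rewrite -subr_le0; apply: (small_const_le h) => k.
by have := cmod_sub l (u k); have := hc k; rewrite cmodB; lra.
Qed.

Lemma cmod_lim_ge (u : nat -> R[i]) l (c : R) : ctends u l ->
  (forall k, c <= cmod (u k)) -> c <= cmod l.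
Proof.
move=> h hc; rewrite -subr_le0; apply: (small_const_le h) => k.
by have := cmod_sub (u k) l; have := hc k; lra.
Qed.

Lemma real_cauchy (u : nat -> R) :
  (forall e : R, 0 < e -> exists K, forall k l, (K <= k)%N -> (K <= l)%N ->
     `|u k - u l| < e) ->
  exists l, forall e : R, 0 < e -> exists K, forall k, (K <= k)%N -> `|u k - l| < e.
Proof.
move=> h.
have /cauchy_cvgP hc : cauchy (u @ \oo).
  apply/cauchyP => e e0; have [K hK] := h e e0.
  exists (u K); exists K => // k Kk /=; rewrite /ball /=; exact: hK.
exists (limn u) => e e0.
have /cvgrPdist_lt/(_ e e0) [K _ hK] := hc.
by exists K => k Kk; rewrite distrC; apply: hK.
Qed.

Lemma ccauchy_tends (u : nat -> R[i]) :
  (forall e : R, 0 < e -> exists K, forall k l, (K <= k)%N -> (K <= l)%N ->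
     cmod (u k - u l) < e) -> exists l, ctends u l.
Proof.
move=> h.
have [|a ha] := @real_cauchy (fun k => complex.Re (u k)).
  move=> e /h[K hK]; exists K => k l Kk Kl; apply: le_lt_trans (hK k l Kk Kl).
  by rewrite -ReN -ReD normRe_le.
have [|b hb] := @real_cauchy (fun k => complex.Im (u k)).
  move=> e /h[K hK]; exists K => k l Kk Kl; apply: le_lt_trans (hK k l Kk Kl).
  by rewrite -ImN -ImD normIm_le.
exists (a +i* b) => e e0; have e2 : 0 < e / 2 by lra.
have [K1 h1] := ha _ e2; have [K2 h2] := hb _ e2.
exists (maxn K1 K2) => k; rewrite geq_max => /andP[/h1 + /h2].
have := cmod_le_ReIm (u k - (a +i* b)); rewrite ReD ImD ReN ImN /=; lra.
Qed.

Lemma ctends_lim (u : nat -> R[i]) l : ctends u l ->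
  lim ((u k : R[i]^o) @[k --> \oo]) = l.
Proof.
move=> h; apply: cvg_lim; first exact: norm_hausdorff.
apply/cvgrPdist_lt => -[e e'] /=; rewrite ltcE /= => /andP[/eqP -> e0].
have [K hK] := h e e0; exists K => // k Kk /=.
by rewrite cmodE ltcR cmodB; apply: hK.
Qed.

End ComplexInequalities.

(** * Power series on the unit disc as limits of polynomials *)

Section WeightedNorm.
Variable R : realType.
Implicit Types (p q : {poly R[i]}) (r : R).

Definition pnorm r p : R := \sum_(i < size p) cmod p`_i * r ^+ i.

Lemma pnormE r p n : (size p <= n)%N -> pnorm r p = \sum_(i < n) cmod p`_i * r ^+ i.
Proof.
move=> h; rewrite -(subnKC h) big_split_ord /= [X in _ = _ + X]big1 ?addr0 // => i _.
by rewrite nth_default ?leq_addr // cmod0 mul0r.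
Qed.

Lemma pnorm_ge0 r p : 0 <= r -> 0 <= pnorm r p.
Proof. by move=> r0; apply: sumr_ge0 => i _; rewrite mulr_ge0 ?cmod_ge0 ?exprn_ge0. Qed.

Lemma pnormD r p q : 0 <= r -> pnorm r (p + q) <= pnorm r p + pnorm r q.
Proof.
move=> r0; rewrite (pnormE _ (size_polyD _ _)).
rewrite (pnormE r (leq_maxl (size p) (size q))) (pnormE r (leq_maxr (size p) (size q))).
rewrite -big_split /=; apply: ler_sum => i _.
by rewrite -mulrDl coefD ler_wpM2r ?exprn_ge0 ?cmodD.
Qed.

Lemma pnormN r p : pnorm r (- p) = pnorm r p.
Proof. by rewrite /pnorm size_polyN; apply: eq_bigr => i _; rewrite coefN cmodN. Qed.

Lemma pnorm_sum r (I : Type) (s : seq I) (F : I -> {poly R[i]}) : 0 <= r ->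
  pnorm r (\sum_(i <- s) F i) <= \sum_(i <- s) pnorm r (F i).
Proof.
move=> r0; elim: s => [|a s IH]; first by rewrite !big_nil /pnorm size_poly0 big_ord0.
by rewrite !big_cons; apply: le_trans (pnormD _ _ r0) _; rewrite lerD2l.
Qed.

Lemma pnorm_monom r (c : R[i]) n p :
  pnorm r (c *: 'X^n * p) = cmod c * r ^+ n * pnorm r p.
Proof.
rewrite (@pnormE _ _ (n + size p)); last first.
  rewrite -scalerAl; apply: (leq_trans (size_scale_leq _ _)).
  by apply: (leq_trans (size_polyMleq _ _)); rewrite size_polyXn.
rewrite big_split_ord /= big1 ?add0r => [|i _]; last first.
  by rewrite -scalerAl coefZ coefXnM ltn_ord mulr0 cmod0 mul0r.
rewrite /pnorm mulr_sumr; apply: eq_bigr => i _.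
by rewrite -scalerAl coefZ coefXnM ltnNge leq_addr /= addKn cmodM exprD; ring.
Qed.

Lemma pnormM r p q : 0 <= r -> pnorm r (p * q) <= pnorm r p * pnorm r q.
Proof.
move=> r0; rewrite -[p in p * q]coefK poly_def mulr_suml.
apply: le_trans (pnorm_sum _ _ r0) _; rewrite [pnorm r p]/pnorm mulr_suml.
by apply: ler_sum => i _; rewrite pnorm_monom.
Qed.

Lemma pnorm_horner r p x : cmod x <= r -> cmod p.[x] <= pnorm r p.
Proof.
move=> xr; rewrite horner_coef; apply: le_trans (cmod_sum _ _ _) _.
apply: ler_sum => i _; rewrite cmodM cmodX ler_wpM2l ?cmod_ge0 //.
by rewrite lerXn2r ?nnegrE ?cmod_ge0 // (le_trans (cmod_ge0 x)).
Qed.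

Lemma pnorm_coef r p n : 0 <= r -> cmod p`_n * r ^+ n <= pnorm r p.
Proof.
move=> r0; rewrite (@pnormE _ _ (n.+1 + size p)) ?leq_addl //.
rewrite (bigD1 (@Ordinal (n.+1 + size p) n (ltn_addr _ (ltnSn n)))) //= lerDl.
by apply: sumr_ge0 => i _; rewrite mulr_ge0 ?cmod_ge0 ?exprn_ge0.
Qed.

Lemma pnorm_drop r p n : 0 <= r -> pnorm r (drop_poly n p) * r ^+ n <= pnorm r p.
Proof.
move=> r0; rewrite (@pnormE _ (drop_poly n p) (size p)); last first.
  by rewrite size_drop_poly leq_subr.
rewrite (@pnormE _ p (n + size p)) ?leq_addl // big_split_ord /= mulr_suml.
rewrite -[X in X <= _]add0r lerD //.
  by apply: sumr_ge0 => i _; rewrite mulr_ge0 ?cmod_ge0 ?exprn_ge0.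
apply: ler_sum => i _; rewrite coef_drop_poly addnC exprD mulrA.
by rewrite [_ * r ^+ n * _]mulrAC.
Qed.

Lemma pnormC r c : pnorm r c%:P = cmod c.
Proof.
by rewrite (pnormE _ (size_polyC_leq1 c)) big_ord1 coefC eqxx mulr1.
Qed.

(** The difference is x^n times the value of [drop_poly n p], whose norm of radius 1/2 is at most
    2^n times that of [p]. *)
Lemma cmod_horner_sub_take p n (x : R[i]) : cmod x <= 1 / 2 ->
  cmod (p.[x] - (take_poly n p).[x]) <= (2 * cmod x) ^+ n * pnorm (1 / 2) p.
Proof.
move=> x2; have h0 : 0 <= 1 / 2 :> R by lra.
rewrite -[p in p.[x]](poly_take_drop n) hornerD addrAC subrr add0r hornerM hornerXn.
have d : cmod (drop_poly n p).[x] <= 2 ^+ n * pnorm (1 / 2) p.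
  apply: le_trans (pnorm_horner _ x2) _.
  have h2 : 0 <= (2 : R) ^+ n by rewrite exprn_ge0.
  have := ler_wpM2l h2 (pnorm_drop p n h0).
  rewrite mulrCA -exprMn (_ : 2 * (1 / 2) = 1 :> R); last by field.
  by rewrite expr1n mulr1.
rewrite cmodM cmodX exprMn mulrC [2 ^+ n * _]mulrC -mulrA.
by rewrite ler_wpM2l // exprn_ge0 ?cmod_ge0.
Qed.

End WeightedNorm.

(** * Analytic functions on the unit disc and their zeros near the origin *)

Section AnalyticDisc.
Variable R : realType.
Implicit Types (P Q : nat -> {poly R[i]}) (F G : R[i] -> R[i]).

Definition acauchy P := forall r : R, 0 <= r < 1 -> forall e : R, 0 < e ->
  exists K, forall k l, (K <= k)%N -> (K <= l)%N -> pnorm r (P k - P l) < e.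

(* The functions on the open unit disc that are limits of polynomials in every
   weighted l1-norm of coefficients, i.e. the sums of power series of radius at
   least 1; with this description products need no Cauchy product. *)
Definition adisc F := exists2 P, acauchy P &
  forall x, cmod x < 1 -> ctends (fun k => (P k).[x]) (F x).

Lemma acauchy_bounded P (r : R) : acauchy P -> 0 <= r < 1 ->
  exists (B : R) K, 0 <= B /\ forall k, (K <= k)%N -> pnorm r (P k) <= B.
Proof.
move=> h r01; have [K hK] := h r r01 1 ltr01; case/andP: r01 => r0 _.
exists (pnorm r (P K) + 1), K; split; first by rewrite addr_ge0 ?pnorm_ge0.
move=> k kK; rewrite -[P k](subrK (P K)) addrC.
apply: le_trans (pnormD _ _ r0) _; rewrite lerD2l ltW // hK //.
Qed.

Lemma acauchyD P Q : acauchy P -> acauchy Q -> acauchy (fun k => P k + Q k).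
Proof.
move=> hP hQ r r01 e e0; have e2 : 0 < e / 2 by lra.
have [K1 h1] := hP r r01 _ e2; have [K2 h2] := hQ r r01 _ e2.
exists (maxn K1 K2) => k l; rewrite !geq_max => /andP[k1 k2] /andP[l1 l2].
have := h1 k l k1 l1; have := h2 k l k2 l2; case/andP: r01 => r0 _.
by rewrite opprD addrACA; have := pnormD (P k - P l) (Q k - Q l) r0; lra.
Qed.

Lemma acauchyM P Q : acauchy P -> acauchy Q -> acauchy (fun k => P k * Q k).
Proof.
move=> hP hQ r r01 e e0.
have [B1 [K1 [b1 h1]]] := acauchy_bounded hP r01.
have [B2 [K2 [b2 h2]]] := acauchy_bounded hQ r01.
have d1 : 0 < e / 2 / (B2 + 1) by rewrite !divr_gt0 //; lra.
have d2 : 0 < e / 2 / (B1 + 1) by rewrite !divr_gt0 //; lra.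
have [K3 h3] := hP r r01 _ d1; have [K4 h4] := hQ r r01 _ d2.
exists (maxn (maxn K1 K2) (maxn K3 K4)) => k l.
rewrite !geq_max => /andP[/andP[k1 k2] /andP[k3 k4]] /andP[/andP[l1 l2] /andP[l3 l4]].
case/andP: r01 => r0 _.
rewrite (_ : _ - _ = (P k - P l) * Q k + P l * (Q k - Q l)); last by ring.
apply: le_lt_trans (pnormD _ _ r0) _.
have := le_trans (pnormM (P k - P l) (Q k) r0) (ler_wpM2l (pnorm_ge0 _ r0) (h2 k k2)).
have := le_trans (pnormM (P l) (Q k - Q l) r0) (ler_wpM2r (pnorm_ge0 _ r0) (h1 l l1)).
have := h3 k l k3 l3; have := h4 k l k4 l4.
rewrite !ltr_pdivlMr ?ltr0n //; try lra.
have := pnorm_ge0 (P k - P l) r0; have := pnorm_ge0 (Q k - Q l) r0.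
move: (pnorm r (P k - P l)) (pnorm r (Q k - Q l)) (pnorm r (_ * _)) (pnorm r (_ * _)).
move=> a b c d; nra.
Qed.

Lemma acauchy_cst p : acauchy (fun=> p).
Proof.
move=> r r01 e e0; exists 0%N => k l _ _.
by rewrite subrr /pnorm size_poly0 big_ord0.
Qed.

Lemma acauchy_tends P (x : R[i]) : acauchy P -> cmod x < 1 ->
  exists l, ctends (fun k => (P k).[x]) l.
Proof.
move=> h x1; apply: ccauchy_tends => e e0.
have [|K hK] := h (cmod x) _ e e0; first by rewrite cmod_ge0.
exists K => k l kK lK; rewrite -hornerN -hornerD.
exact: le_lt_trans (pnorm_horner _ (lexx _)) (hK k l kK lK).
Qed.

Lemma adiscD F G : adisc F -> adisc G -> adisc (fun x => F x + G x).
Proof.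
move=> [P hP cP] [Q hQ cQ]; exists (fun k => P k + Q k); first exact: acauchyD.
move=> x x1; apply: ctends_ext (ctendsD (cP x x1) (cQ x x1)) => k.
by rewrite hornerD.
Qed.

Lemma adiscM F G : adisc F -> adisc G -> adisc (fun x => F x * G x).
Proof.
move=> [P hP cP] [Q hQ cQ]; exists (fun k => P k * Q k); first exact: acauchyM.
move=> x x1; apply: ctends_ext (ctendsM (cP x x1) (cQ x x1)) => k.
by rewrite hornerM.
Qed.

Lemma adisc_poly p : adisc (fun x => p.[x]).
Proof.
exists (fun=> p); first exact: acauchy_cst.
by move=> x _; apply: ctends_cst.
Qed.

Lemma acauchy_coef P n : acauchy P -> exists l, ctends (fun k => (P k)`_n) l.
Proof.
move=> h; apply: ccauchy_tends => e e0.
have r01 : 0 <= (1 / 2 : R) < 1 by lra.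
have p0 : 0 < (1 / 2 : R) ^+ n by rewrite exprn_gt0 //; lra.
have [K hK] := h _ r01 _ (mulr_gt0 e0 p0).
exists K => k l kK lK; rewrite -coefB -(ltr_pM2r p0).
apply: le_lt_trans (pnorm_coef _ _ _) (hK k l kK lK); lra.
Qed.

(** For fixed [k] only the finitely many coefficients of [P k] matter. In a comparison with
    [P (K + l)] for growing [l], the coefficients of [P (K + l)] at these indices tend to 0, and the
    Cauchy bound on the difference remains. *)
Lemma acauchy_eq0 P r : 0 <= r < 1 -> acauchy P ->
  (forall n, ctends (fun k => (P k)`_n) 0) -> small (fun k => pnorm r (P k)).
Proof.
move=> r01 hP h e e0; have e2 : 0 < e / 2 by lra.
have [K hK] := hP r r01 _ e2; exists K => k kK.
case/andP: (r01) => r0 r1.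
apply: (@le_lt_trans _ _ (e / 2)); last by lra.
rewrite -subr_le0.
apply: (@small_const_le _ _ (fun l => \sum_(i < size (P k)) cmod (P (K + l))`_i)).
  elim: (size (P k)) => [|m IH].
    by move=> d d0; exists 0%N => l _; rewrite big_ord0.
  apply: small_le (smallD IH (_ : small (fun l => cmod (P (K + l))`_m))) => [l|].
    by rewrite big_ord_recr.
  move=> d /(h m)[L hL]; exists L => l lL.
  by have := hL (K + l)%N; rewrite subr0; apply; exact: leq_trans (leq_addl _ _).
move=> l; have h1 := hK k (K + l)%N kK (leq_addr _ _).
rewrite lerBlDr; apply: (@le_trans _ _ (\sum_(i < size (P k)) cmod (P (K + l)%N)`_i +
   pnorm r (P k - P (K + l)%N))); last by rewrite lerD2l ltW.
rewrite (@pnormE _ _ (P k - P (K + l)%N) (size (P k) + size (P (K + l)%N))); last first.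
  apply: (leq_trans (size_polyD _ _)); rewrite size_polyN geq_max.
  by rewrite leq_addr leq_addl.
rewrite big_split_ord /=.
have t0 : 0 <= \sum_(i < size (P (K + l)%N))
  cmod (P k - P (K + l)%N)`_(size (P k) + i) * r ^+ (size (P k) + i).
  by apply: sumr_ge0 => i _; rewrite mulr_ge0 ?cmod_ge0 ?exprn_ge0.
rewrite addrA; apply: ler_wpDr => //.
rewrite -big_split /=; apply: ler_sum => i _.
have ri : r ^+ i <= 1 by apply: exprn_ile1 => //; apply: ltW.
have ri0 : 0 <= r ^+ i by apply: exprn_ge0.
have := cmodD (P (K + l)%N)`_i ((P k)`_i - (P (K + l)%N)`_i).
rewrite addrCA subrr addr0 coefB; move: (cmod_ge0 (P (K + l)%N)`_i).
move: (cmod _) (cmod _) (cmod _) (r ^+ i) ri ri0 => a b c d; nra.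
Qed.

(** The first nonzero limit coefficient dominates near the origin; if there is none, the limit is
    zero on the whole disc. *)
Lemma adisc_dichotomy F : adisc F ->
  (forall x, cmod x < 1 -> F x = 0) \/
  (exists2 d : R, 0 < d & forall x, 0 < cmod x < d -> F x != 0).
Proof.
move=> [P hP cP].
have /choice[c hc] : forall n, exists l, ctends (fun k => (P k)`_n) l.
  by move=> n; apply: acauchy_coef.
have [c0|cn0] := pselect (forall n, c n = 0).
  left=> x x1; apply/eqP; rewrite -cmod_eq0 eq_le cmod_ge0 andbT.
  have r01 : 0 <= cmod x < 1 by rewrite cmod_ge0.
  have hs : small (fun k => pnorm (cmod x) (P k)).
    by apply: acauchy_eq0 => // n; have := hc n; rewrite c0.
  apply: (small_const_le (smallD hs (cP x x1))) => k.
  have := pnorm_horner (P k) (lexx (cmod x)).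
  by have := cmod_sub (F x) (P k).[x]; rewrite cmodB; lra.
right; have /existsNP[n1 hn1] := cn0.
have ex : exists n, c n != 0 by exists n1; apply/eqP.
case: (ex_minnP ex) => n cnn nmin.
have small_n m : (m < n)%N -> c m = 0.
  by move=> mn; apply/eqP; apply: contraTT mn => /nmin; rewrite -leqNgt.
have r01 : 0 <= (1 / 2 : R) < 1 by lra.
have [B [K [B0 hB]]] := acauchy_bounded hP r01.
(* The truncation bound passes to the limit, where the first n + 1 coefficients leave only c_n
   x^n. *)
have est x : cmod x <= 1 / 2 ->
  cmod (F x - c n * x ^+ n) <= (2 * cmod x) ^+ n.+1 * B.
  move=> x2; have x1 : cmod x < 1 by lra.
  have l1 : ctends (fun k => (take_poly n.+1 (P k)).[x]) (c n * x ^+ n).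
    have -> : c n * x ^+ n = \sum_(i < n.+1) c i * x ^+ i.
      by rewrite big_ord_recr /= big1 ?add0r // => i _; rewrite small_n ?mul0r.
    rewrite /take_poly; apply: (@ctends_ext _ (fun k => \sum_(i < n.+1) (P k)`_i * x ^+ i)).
      by move=> k; rewrite horner_poly.
    elim: (n.+1) => [|m IH].
      by rewrite big_ord0; apply: ctends_ext (ctends_cst _) => k; rewrite big_ord0.
    rewrite big_ord_recr /=.
    have hm := ctendsM (hc m) (ctends_cst (x ^+ m)).
    by apply: ctends_ext (ctendsD IH hm) => k; rewrite big_ord_recr.
  have l2 := ctendsD (cP x x1) (ctendsZ (-1) l1).
  have := @cmod_lim_le _ _ _ ((2 * cmod x) ^+ n.+1 * B) (ctends_sub (leq_addl K) l2).
  rewrite mulN1r; apply => k /=; rewrite mulN1r.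
  apply: le_trans (cmod_horner_sub_take _ _ x2) _.
  by rewrite ler_wpM2l ?hB ?leq_addr // exprn_ge0 // mulr_ge0 ?cmod_ge0.
have cn : 0 < cmod (c n) by rewrite cmod_gt0.
have D0 : 0 < 2 ^+ n.+1 * (B + 1) :> R by rewrite mulr_gt0 ?exprn_gt0 //; lra.
(* Inside this radius (2|x|)^(n+1) (B + 1) is smaller than |c_n| |x|^n; [B + 1] keeps the
   denominator positive. *)
exists (Num.min (1 / 2) (cmod (c n) / (2 ^+ n.+1 * (B + 1)))).
  by rewrite lt_min; apply/andP; split; [lra|rewrite divr_gt0].
move=> x /andP[x0]; rewrite lt_min => /andP[x2]; rewrite ltr_pdivlMr // => xs.
apply/eqP => Fx; have := est x (ltW x2); rewrite Fx sub0r cmodN cmodM cmodX.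
rewrite exprMn exprS [(cmod x) ^+ n.+1]exprS.
have xn : 0 < cmod x ^+ n by rewrite exprn_gt0.
have := ltr_pM2r xn (cmod x * (2 ^+ n.+1 * (B + 1))) (cmod (c n)); rewrite xs exprS.
have t0 : 0 < (2:R) ^+ n by rewrite exprn_gt0.
move: (cmod x ^+ n) xn => u xn; move: (2 ^+ n) (cmod x) (cmod (c n)) t0 x0 => t v w t0 v0 h1 h2.
have : 0 < 2 * t * v * u by rewrite !mulr_gt0.
have {}h1 : v * (2 * t * (B + 1)) * u < w * u by rewrite h1.
by move: h1 h2; rewrite (_ : v * _ * u = 2 * t * v * u * B + 2 * t * v * u);
  [rewrite (_ : 2 * t * (v * u) * B = 2 * t * v * u * B); [lra|ring]|ring].
Qed.

End AnalyticDisc.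

(** * Euler's product and the pentagonal number theorem *)

Section EulerProduct.
Variable R : realType.
Implicit Types (x q : R[i]) (r : R).

Lemma sum_geo_le r n : 0 <= r < 1 -> \sum_(0 <= i < n) r ^+ i <= (1 - r)^-1.
Proof.
move=> /andP[r0 r1].
have -> : \sum_(0 <= i < n) r ^+ i = (1 - r ^+ n) / (1 - r).
  apply: (mulIf (_ : 1 - r != 0)); first by lra.
  rewrite divfK; last by lra.
  elim: n => [|n IH]; first by rewrite big_geq // expr0 mul0r subrr.
  by rewrite big_nat_recr //= mulrDl IH exprS; ring.
have d0 : 0 <= (1 - r)^-1 by rewrite invr_ge0; lra.
by rewrite mulrC ler_piMr // lerBlDr lerDl exprn_ge0.
Qed.

Lemma sum_geo1_le r n : 0 <= r < 1 -> \sum_(1 <= i < n.+1) r ^+ i <= (1 - r)^-1.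
Proof.
move=> r01; apply: le_trans (sum_geo_le n.+1 r01).
by rewrite [leRHS]big_nat_recl // big_add1 /= lerDr expr0.
Qed.

Lemma prod_exp_le (F : nat -> R) m n : (forall i, 0 <= F i) ->
  0 <= \prod_(m <= i < n) (1 + F i) <= expR (\sum_(m <= i < n) F i).
Proof.
move=> F0; elim/big_rec2: _ => [|i y1 y2 _ /andP[h0 h]].
  by rewrite expR0 ler01 lexx.
have f1 : 0 <= 1 + F i by rewrite addr_ge0.
rewrite mulr_ge0 //= expRD; apply: ler_pM => //; exact: expR_ge1Dx.
Qed.

Lemma pnorm_geo_acauchy (P : nat -> {poly R[i]}) :
  (forall r, 0 <= r < 1 -> exists2 B, 0 <= B &
     forall k, pnorm r (P k.+1 - P k) <= B * r ^+ k) ->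
  acauchy P.
Proof.
move=> h r r01 e e0; have [B B0 hB] := h r r01; case/andP: (r01) => r0 r1.
have step k m : pnorm r (P (k + m)%N - P k) <= B * r ^+ k * (1 - r)^-1.
  apply: (@le_trans _ _ (B * r ^+ k * \sum_(0 <= i < m) r ^+ i)); last first.
    by rewrite ler_wpM2l ?sum_geo_le // mulr_ge0 ?exprn_ge0.
  elim: m => [|m IH].
    by rewrite addn0 subrr big_geq // mulr0 /pnorm size_poly0 big_ord0.
  rewrite big_nat_recr //= mulrDr addnS -[B * _ * r ^+ m]mulrA -exprD.
  rewrite (_ : _ - _ = (P (k + m)%N - P k) + (P (k + m).+1 - P (k + m)%N)); last by ring.
  by apply: le_trans (pnormD _ _ r0) _; apply: lerD.
have e2 : 0 < e / 2 by lra.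
have d0 : 0 <= (1 - r)^-1 by rewrite invr_ge0; lra.
have [K hK] := smallZ (mulr_ge0 B0 d0) (small_geo r01) e2.
have hs k m : (K <= k)%N -> pnorm r (P (k + m)%N - P k) < e / 2.
  move=> /hK; apply: le_lt_trans; apply: le_trans (step k m) _.
  by rewrite mulrAC.
exists K => k l kK lK; have [kl|lk] := leqP k l.
  rewrite -(subnKC kl) -opprB pnormN; apply: lt_trans (hs k (l - k)%N kK) _; lra.
rewrite -(subnKC (ltnW lk)); apply: lt_trans (hs l (k - l)%N lK) _; lra.
Qed.

(** The partial products of [euler_phi (c * x ^+ e)]. The phase [c] and the exponent [e] are what
    the expansion of eta at a conjugate a tau + b in powers of q^(1/D) calls for. *)
Definition euler_poly (c : R[i]) (e k : nat) : {poly R[i]} :=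
  \prod_(1 <= i < k.+1) (1 - c ^+ i *: 'X^(e * i)).

Lemma euler_polyS c e k : euler_poly c e k.+1 =
  euler_poly c e k * (1 - c ^+ k.+1 *: 'X^(e * k.+1)).
Proof. by rewrite /euler_poly big_nat_recr. Qed.

Lemma pnorm_cX (c : R[i]) (e i : nat) r : (0 < e)%N -> cmod c <= 1 -> 0 <= r < 1 ->
  pnorm r (c ^+ i *: 'X^(e * i)) <= r ^+ i.
Proof.
move=> e0 c1 /andP[r0 r1].
rewrite -[_ *: _]mulr1 pnorm_monom (pnormC r 1) cmod1 mulr1 cmodX.
apply: (@le_trans _ _ (1 * r ^+ (e * i))).
  by rewrite ler_wpM2r ?exprn_ge0 // exprn_ile1 ?cmod_ge0.
by rewrite mul1r ler_wiXn2l // ?ltW // leq_pmull.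
Qed.

Lemma euler_poly_bounded c e k r : (0 < e)%N -> cmod c <= 1 -> 0 <= r < 1 ->
  pnorm r (euler_poly c e k) <= expR (1 - r)^-1.
Proof.
move=> e0 c1 r01; case/andP: (r01) => r0 r1.
apply: (@le_trans _ _ (\prod_(1 <= i < k.+1) (1 + r ^+ i))).
  elim: k => [|k IH].
    by rewrite /euler_poly !big_geq // (pnormC r 1) cmod1.
  rewrite euler_polyS [leRHS]big_nat_recr //=.
  apply: le_trans (pnormM _ _ r0) _; apply: ler_pM => //; rewrite ?pnorm_ge0 //.
  apply: le_trans (pnormD _ _ r0) _; rewrite pnormN (pnormC r 1) cmod1 lerD2l.
  exact: pnorm_cX.
have /andP[_ h] := @prod_exp_le (fun i => r ^+ i) 1 k.+1 (fun i => exprn_ge0 i r0).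
by apply: le_trans h _; rewrite ler_expR sum_geo1_le.
Qed.

Lemma euler_poly_acauchy c e : (0 < e)%N -> cmod c <= 1 -> acauchy (euler_poly c e).
Proof.
move=> e0 c1; apply: pnorm_geo_acauchy => r r01; case/andP: (r01) => r0 r1.
exists (expR (1 - r)^-1); first exact: expR_ge0.
move=> k; rewrite euler_polyS mulrBr mulr1 addrC addKr pnormN.
apply: le_trans (pnormM _ _ r0) _; apply: ler_pM; rewrite ?pnorm_ge0 //.
  exact: euler_poly_bounded.
apply: le_trans (pnorm_cX _ e0 c1 r01) _.
by rewrite ler_wiXn2l // ltW.
Qed.

Lemma horner_euler_poly c e k x :
  (euler_poly c e k).[x] = \prod_(1 <= i < k.+1) (1 - (c * x ^+ e) ^+ i).
Proof.
rewrite /euler_poly horner_prod; apply: eq_bigr => i _.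
by rewrite !hornerE exprMn exprM.
Qed.

Definition euler_phi x : R[i] :=
  lim ((\prod_(1 <= n < k.+1) (1 - x ^+ n) : R[i]^o) @[k --> \oo]).

Lemma euler_phi_tends x : cmod x < 1 ->
  ctends (fun k => \prod_(1 <= n < k.+1) (1 - x ^+ n)) (euler_phi x).
Proof.
move=> x1.
have c1 : cmod (1 : R[i]) <= 1 by rewrite cmod1.
have [l hl] := acauchy_tends (@euler_poly_acauchy 1 1 isT c1) x1.
have hl' : ctends (fun k => \prod_(1 <= n < k.+1) (1 - x ^+ n)) l.
  by apply: ctends_ext hl => k; rewrite horner_euler_poly mul1r expr1.
by rewrite /euler_phi (ctends_lim hl').
Qed.

Lemma euler_phi_adisc c e : (0 < e)%N -> cmod c <= 1 ->
  adisc (fun x => euler_phi (c * x ^+ e)).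
Proof.
move=> e0 c1; exists (euler_poly c e); first exact: euler_poly_acauchy.
move=> x x1; apply: ctends_ext (euler_phi_tends _).
  by move=> k; rewrite horner_euler_poly.
rewrite cmodM cmodX; apply: (@le_lt_trans _ _ (1 * cmod x)); last by rewrite mul1r.
apply: ler_pM; rewrite ?cmod_ge0 ?exprn_ge0 ?cmod_ge0 //.
by rewrite -[leRHS]expr1 ler_wiXn2l ?cmod_ge0 // ltW.
Qed.

(** With c = 1/(1 - r), every y in [0, r] satisfies (1 - y)(1 + c y) >= 1 because c r = c - 1, hence
    1 - y >= e^(-c y). Summing the geometric series bounds all partial products below by
    e^(-c^2). *)
Lemma euler_phi_neq0 x : cmod x < 1 -> euler_phi x != 0.
Proof.
move=> x1; rewrite -cmod_gt0; set r := cmod x.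
have r0 : 0 <= r by apply: cmod_ge0.
have r01 : 0 <= r < 1 by rewrite r0.
set c := (1 - r)^-1; have c0 : 0 <= c by rewrite invr_ge0; rewrite -/r in x1; lra.
apply: (@lt_le_trans _ _ (expR (- (c * c)))); first exact: expR_gt0.
apply: cmod_lim_ge (euler_phi_tends x1) _ => k.
rewrite cmod_prod.
apply: (@le_trans _ _ (\prod_(1 <= i < k.+1) expR (- (c * r ^+ i)))).
  rewrite -expR_sum ler_expR sumrN lerN2 -mulr_sumr ler_wpM2l // sum_geo1_le //.
rewrite big_seq [leRHS]big_seq; apply: ler_prod => i.
rewrite mem_index_iota => /andP[i0 _]; rewrite expR_ge0 /=.
apply: (@le_trans _ _ (1 - r ^+ i)); last first.
  by have := cmod_sub 1 (x ^+ i); rewrite cmod1 cmodX.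
have ri : r ^+ i <= r by rewrite -[leRHS]expr1 ler_wiXn2l // ltW.
have ri0 : 0 <= r ^+ i by rewrite exprn_ge0.
have c1 : c * (1 - r) = 1 by rewrite mulVf //; rewrite -/r in x1; lra.
have e0 := expR_gt0 (c * r ^+ i).
have h := expR_ge1Dx (c * r ^+ i).
rewrite expRN -(ler_pM2l e0) mulfV ?expR_eq0 //.
apply: le_trans (ler_wpM2r _ h); last by rewrite -/r in x1; lra.
have s1 : 0 <= c * (r - r ^+ i) * r ^+ i by rewrite !mulr_ge0 // subr_ge0.
have s2 : c * r = c - 1 by rewrite -[X in _ - X]c1; ring.
by move: s1; rewrite mulrBr s2; lra.
Qed.

Lemma euler_phi_near1 x : cmod x <= 1 / 2 ->
  cmod (euler_phi x - 1) <= 2 * expR 2 * cmod x.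
Proof.
move=> x2; have x1 : cmod x < 1 by lra.
have l := ctendsD (euler_phi_tends x1) (ctends_cst (-1)).
apply: cmod_lim_le l _ => k.
have r01 : 0 <= (1 / 2 : R) < 1 by lra.
have c1 : cmod (1 : R[i]) <= 1 by rewrite cmod1.
(* The constant coefficient of each partial product is 1, so truncation at order 1 measures the
   distance to 1; e^2 bounds the norm of radius 1/2. *)
have := cmod_horner_sub_take (euler_poly 1 1 k) 1 x2.
have := @euler_poly_bounded 1 1 k (1 / 2) isT c1 r01.
rewrite (_ : (1 - 1 / 2)^-1 = 2 :> R); last by field.
have -> : (take_poly 1 (euler_poly 1 1 k)).[x] = 1.
  rewrite /take_poly horner_poly big_ord1 expr0 mulr1 -horner_coef0 horner_euler_poly.
  rewrite big_nat big1 // => i /andP[i0 _].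
  by rewrite expr1 mulr0 expr0n gtn_eqF //= subr0.
rewrite horner_euler_poly => h1 h2.
rewrite (eq_bigr (fun i => 1 - (1 * x ^+ 1) ^+ i)); last by move=> i _; rewrite mul1r.
apply: le_trans h2 _.
by rewrite expr1 mulrAC ler_wpM2r ?cmod_ge0 // ler_pM2l.
Qed.

End EulerProduct.

(** * A finite identity behind the pentagonal number theorem *)

Section Shanks.
Variable A : comNzRingType.
Implicit Type q : A.

Definition shanks_prod q (s n : nat) := \prod_(s.+1 <= i < n.+1) (1 - q ^+ i).

Definition shanks_term q (n s : nat) :=
  (-1) ^+ s * shanks_prod q s n * q ^+ (s * n + 'C(s.+1, 2)).

(** The exponents are s(3s - 1)/2 and s(3s + 1)/2, the generalized pentagonal numbers. *)
Definition pent q (s : nat) :=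
  (-1) ^+ s * (q ^+ (s ^ 2 + 'C(s, 2)) + q ^+ (s ^ 2 + 'C(s.+1, 2))).

Lemma shanks_prod_recl q s n : (s < n)%N ->
  shanks_prod q s n = (1 - q ^+ s.+1) * shanks_prod q s.+1 n.
Proof. by move=> h; rewrite /shanks_prod big_ltn. Qed.

Lemma shanks_prod_recr q s n : (s <= n)%N ->
  shanks_prod q s n.+1 = shanks_prod q s n * (1 - q ^+ n.+1).
Proof. by move=> h; rewrite /shanks_prod big_nat_recr. Qed.

Lemma shanks_prod_nn q n : shanks_prod q n n = 1.
Proof. by rewrite /shanks_prod big_geq. Qed.

(* Shanks' finite form of Euler's pentagonal number theorem. *)
Lemma shanks q n :
  \sum_(0 <= s < n.+1) shanks_term q n s = 1 + \sum_(1 <= s < n.+1) pent q s.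
Proof.
elim: n => [|n IH].
  by rewrite big_nat1 big_geq // addr0 /shanks_term shanks_prod_nn !expr0 !mul1r.
rewrite [RHS](_ : _ = 1 + \sum_(1 <= s < n.+1) pent q s + pent q n.+1); last first.
  by rewrite big_nat_recr // addrA.
rewrite -IH big_nat_recr //=.
have -> : \sum_(0 <= s < n.+1) shanks_term q n.+1 s =
  \sum_(0 <= s < n.+1) (shanks_term q n s * q ^+ s * (1 - q ^+ n.+1)).
  rewrite !big_nat; apply: eq_bigr => s; rewrite ltnS => /andP[_ sn].
  rewrite /shanks_term shanks_prod_recr // (_ : s * n.+1 + _ = s * n + 'C(s.+1, 2) + s)%N.
    by rewrite exprD; ring.
  by rewrite mulnS; lia.
(* Passing from n to n + 1 changes the first terms by differences whose partial sums telescope to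
   -D. At k = n this is the first monomial of [pent q n.+1]; the new last term of the sum is the
   second one. *)
pose D k := (-1) ^+ k * shanks_prod q k n * q ^+ (k.+1 * n.+1 + 'C(k.+1, 2)).
have tele k : (k <= n)%N -> \sum_(0 <= s < k.+1)
  (shanks_term q n s * q ^+ s * (1 - q ^+ n.+1) - shanks_term q n s) = - D k.
  elim: k => [_|k IHk kn].
    rewrite big_nat1 /D /shanks_term; have -> : 'C(1, 2) = 0%N by [].
    by rewrite mul1n mul0n !addn0 !expr0; ring.
  rewrite big_nat_recr //= IHk ?(ltnW kn) // /D /shanks_term (shanks_prod_recl q kn).
  rewrite [X in q ^+ (k.+2 * _ + X)]binS bin1 [in X in _ + X](binS k.+1) bin1.
  rewrite (_ : k.+2 * n.+1 + ('C(k.+1, 2) + k.+1) =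
    (k.+1 * n + 'C(k.+1, 2)) + k.+1 + k.+1 + n.+1)%N; last by rewrite !mulSn !mulnS; lia.
  rewrite (_ : k.+1 * n.+1 + 'C(k.+1, 2) = (k.+1 * n + 'C(k.+1, 2)) + k.+1)%N; last first.
    by rewrite mulnS; lia.
  rewrite !addnA !exprD [in (-1) ^+ k.+1]exprS.
  ring.
have := tele n (leqnn n); rewrite sumrB => /(canRL (subrK _)) ->.
set S := \sum_(0 <= s < n.+1) _.
rewrite /pent /D /shanks_term !shanks_prod_nn !mulr1 mulnn [in RHS]exprS [(-1) ^+ n.+1]exprS.
by ring.
Qed.

End Shanks.

(** * Functions of q on the upper half plane *)

Section QPower.
Variable R : realType.
Implicit Types (tau z : R[i]) (r s : R).

Lemma qpowE tau r : qpow tau r = cexp ('i%C * (2 * pi * r)%:C * tau).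
Proof. by rewrite /qpow imE. Qed.

Lemma cmod_qpow tau r : cmod (qpow tau r) = expR (- (2 * pi * r * complex.Im tau)).
Proof.
rewrite qpowE cmod_cexp; congr expR; rewrite ReM ReM ImM /=; ring.
Qed.

Lemma qpow_neq0 tau r : qpow tau r != 0.
Proof. by rewrite qpowE cexp_neq0. Qed.

Lemma qpowX tau r n : qpow tau r ^+ n = qpow tau (r * n%:R).
Proof.
rewrite !qpowE -cexpMn; congr cexp; rewrite !RealM Realn; ring.
Qed.

Lemma qpowM tau r s : qpow tau r * qpow tau s = qpow tau (r + s).
Proof. by rewrite !qpowE -cexpD; congr cexp; rewrite !RealM RealD; ring. Qed.

Lemma qpow_affine tau (a b r : R) :
  qpow (a%:C * tau + b%:C) r = cexp ('i%C * (2 * pi * (r * b))%:C) * qpow tau (a * r).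
Proof. by rewrite !qpowE -cexpD; congr cexp; rewrite !RealM; ring. Qed.

Lemma cmod_qpow_lt1 tau r : 0 < complex.Im tau -> 0 < r -> cmod (qpow tau r) < 1.
Proof.
move=> t0 r0; rewrite cmod_qpow expR_lt1 oppr_lt0 !mulr_gt0 //; exact: pi_gt0.
Qed.

Lemma cmod_cexp_imag (x : R) : cmod (cexp ('i%C * x%:C)) = 1.
Proof. by rewrite cmod_cexp ReM /= mul0r mulr0 subr0 expR0. Qed.

Lemma etaE tau : eta tau = qpow tau (24%:R^-1) * euler_phi (qpow tau 1).
Proof. by []. Qed.

Lemma eta_neq0 tau : 0 < complex.Im tau -> eta tau != 0.
Proof.
move=> t0; rewrite etaE mulf_neq0 ?qpow_neq0 //.
by rewrite euler_phi_neq0 // cmod_qpow_lt1.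
Qed.

Lemma cmod_qpow_small (r : R) : 0 < r -> forall d : R, 0 < d ->
  exists2 Y : R, 0 < Y & forall tau, Y < complex.Im tau -> cmod (qpow tau r) < d.
Proof.
move=> r0 d d0; have p0 := pi_gt0 R.
have c0 : 0 < 2 * pi * r by rewrite !mulr_gt0.
have m0 : 0 < d * (2 * pi * r) by rewrite mulr_gt0.
exists (d * (2 * pi * r))^-1; first by rewrite invr_gt0.
move=> tau hY; rewrite cmod_qpow expRN.
set y := complex.Im tau in hY *.
have h : d^-1 < 2 * pi * r * y.
  by move: hY; rewrite invfM -(ltr_pM2l c0) mulrCA mulfV ?mulr1 // lt0r_neq0.
rewrite -[d]invrK ltf_pV2 ?posrE ?expR_gt0 ?invr_gt0 //.
by have := expR_ge1Dx (2 * pi * r * y); lra.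
Qed.

End QPower.

(** * Power series in q^(1/D) and their quotients *)

Section UpperHalfPlane.
Variables (R : realType) (D : nat).
Hypothesis D0 : (0 < D)%N.
Implicit Types (h g : R[i] -> R[i]) (tau : R[i]).

Let x tau := qpow tau (D%:R^-1).

Let Dr0 : 0 < (D%:R^-1 : R). Proof. by rewrite invr_gt0 ltr0n. Qed.

(** Regularity at the cusp is built in, since [F] lives on the full disc; so a statement about [F]
    near the origin is one about [h] for large Im tau. *)
Definition holo h := exists2 F, adisc F &
  forall tau, 0 < complex.Im tau -> h tau = F (qpow tau (D%:R^-1)).

Lemma holo_ext h g : (forall tau, 0 < complex.Im tau -> h tau = g tau) ->
  holo h -> holo g.
Proof. by move=> e [F hF cF]; exists F => // tau t0; rewrite -e // cF. Qed.

Lemma holoD h g : holo h -> holo g -> holo (fun tau => h tau + g tau).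
Proof.
move=> [F hF cF] [G hG cG]; exists (fun z => F z + G z); first exact: adiscD.
by move=> tau t0; rewrite cF // cG.
Qed.

Lemma holoM h g : holo h -> holo g -> holo (fun tau => h tau * g tau).
Proof.
move=> [F hF cF] [G hG cG]; exists (fun z => F z * G z); first exact: adiscM.
by move=> tau t0; rewrite cF // cG.
Qed.

Lemma holo_cst c : holo (fun=> c).
Proof.
exists (fun z => c%:P.[z]); first exact: adisc_poly.
by move=> tau _; rewrite hornerC.
Qed.

Lemma holo_dichotomy h : holo h ->
  (forall tau, 0 < complex.Im tau -> h tau = 0) \/
  (exists2 Y : R, 0 < Y & forall tau, Y < complex.Im tau -> h tau != 0).
Proof.
move=> [F /adisc_dichotomy[F0|[d d0 hd]] cF].
  by left=> tau t0; rewrite cF // F0 // cmod_qpow_lt1.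
right; have [Y Y0 hY] := cmod_qpow_small Dr0 d0.
exists Y => // tau tY; rewrite cF ?(lt_trans Y0) //; apply: hd.
by rewrite hY // cmod_gt0 qpow_neq0.
Qed.

(** The condition turns the exponents a/24 and a, coming from the prefactor and from Euler's
    product, into k/D and 24k/D. *)
Lemma eta_holo (k : nat) (a b : R) : (0 < k)%N -> a * D%:R = 24 * k%:R ->
  holo (fun tau => eta (a%:C * tau + b%:C)).
Proof.
move=> k0 e; have Dn0 : D%:R != 0 :> R by rewrite pnatr_eq0 -lt0n.
have aE : a = D%:R^-1 * (24 * k)%:R by rewrite natrM -e mulrC mulfK.
pose c r := cexp ('i%C * (2 * pi * (r * b))%:C).
exists (fun z => (c (24%:R^-1) *: 'X^k).[z] * euler_phi (c 1 * z ^+ (24 * k))).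
  apply: adiscM; first exact: adisc_poly.
  by apply: euler_phi_adisc; rewrite ?muln_gt0 // cmod_cexp_imag.
move=> tau t0; rewrite etaE !qpow_affine hornerZ hornerXn !qpowX mulr1 -aE.
by congr (_ * qpow _ _ * _); rewrite aE natrM; field.
Qed.

(** The denominator has no zero in the half plane but may vanish at the cusp; this is how negative
    powers of q enter. *)
Definition mero h := exists U V, [/\ holo U, holo V,
  (forall tau, 0 < complex.Im tau -> V tau != 0) &
  (forall tau, 0 < complex.Im tau -> h tau = U tau / V tau)].

Lemma holo_mero h : holo h -> mero h.
Proof.
move=> hh; exists h, (fun=> 1); split => // [|tau _]; first exact: holo_cst.
by rewrite divr1.
Qed.

Lemma mero_ext h g : (forall tau, 0 < complex.Im tau -> h tau = g tau) ->
  mero h -> mero g.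
Proof.
move=> e [U [V [hU hV V0 hE]]]; exists U, V; split => // tau t0.
by rewrite -e // hE.
Qed.

Lemma mero_cst c : mero (fun=> c).
Proof. exact/holo_mero/holo_cst. Qed.

Lemma meroD h g : mero h -> mero g -> mero (fun tau => h tau + g tau).
Proof.
move=> [U [V [hU hV V0 hE]]] [U' [V' [hU' hV' V0' hE']]].
exists (fun tau => U tau * V' tau + U' tau * V tau), (fun tau => V tau * V' tau).
split; [by apply: holoD; apply: holoM | exact: holoM | |].
  by move=> tau t0; rewrite mulf_neq0 ?V0 ?V0'.
by move=> tau t0; rewrite hE // hE' // addf_div ?V0 ?V0'.
Qed.

Lemma meroM h g : mero h -> mero g -> mero (fun tau => h tau * g tau).
Proof.
move=> [U [V [hU hV V0 hE]]] [U' [V' [hU' hV' V0' hE']]].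
exists (fun tau => U tau * U' tau), (fun tau => V tau * V' tau).
split; [exact: holoM | exact: holoM | |].
  by move=> tau t0; rewrite mulf_neq0 ?V0 ?V0'.
by move=> tau t0; rewrite hE // hE' // mulf_div.
Qed.

Lemma meroX h n : mero h -> mero (fun tau => h tau ^+ n).
Proof.
move=> hh; elim: n => [|n IH]; first exact: mero_ext (mero_cst 1).
by apply: mero_ext (meroM hh IH) => tau _; rewrite exprS.
Qed.

Lemma meroV h : (forall tau, 0 < complex.Im tau -> h tau != 0) ->
  mero h -> mero (fun tau => (h tau)^-1).
Proof.
move=> h0 [U [V [hU hV V0 hE]]]; exists V, U; split => // tau t0.
  by move: (h0 _ t0); rewrite hE // mulf_eq0 negb_or => /andP[].
by rewrite hE // invf_div.
Qed.

Lemma mero_poly (p : {poly R[i]}) h : mero h -> mero (fun tau => p.[h tau]).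
Proof.
move=> hh; elim/poly_ind: p => [|p c IH].
  by apply: mero_ext (mero_cst 0) => tau _; rewrite horner0.
apply: mero_ext (meroD (meroM IH hh) (mero_cst c)) => tau _.
by rewrite hornerMXaddC.
Qed.

Lemma mero_poly2 (p : {poly {poly R[i]}}) h g : mero h -> mero g ->
  mero (fun tau => (map_poly (horner_eval (g tau)) p).[h tau]).
Proof.
move=> hh hg; elim/poly_ind: p => [|p c IH].
  by apply: mero_ext (mero_cst 0) => tau _; rewrite rmorph0 horner0.
apply: mero_ext (meroD (meroM IH hh) (mero_poly c hg)) => tau _.
by rewrite rmorphD rmorphM /= map_polyX map_polyC hornerMXaddC.
Qed.

Lemma mero_dichotomy h : mero h ->
  (forall tau, 0 < complex.Im tau -> h tau = 0) \/
  (exists2 Y : R, 0 < Y & forall tau, Y < complex.Im tau -> h tau != 0).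
Proof.
move=> [U [V [/holo_dichotomy[U0|[Y Y0 hY]] hV V0 hE]]].
  by left=> tau t0; rewrite hE // U0 // mul0r.
right; exists Y => // tau tY; have t0 := lt_trans Y0 tY.
by rewrite hE // mulf_neq0 ?invr_eq0 ?hY ?V0.
Qed.

End UpperHalfPlane.

(** * Gaussian sums along slanted lines *)

Section Gaussian.
Variable R : realType.
Implicit Types (u w V z : R[i]) (x c b s d : R).

Definition gs u : R[i] := cexp (- ((pi : R)%:C * u ^+ 2)).

Lemma cmod_gs u : cmod (gs u) = expR (- (pi * complex.Re (u ^+ 2))).
Proof. by rewrite /gs cmod_cexp ReN ReM /= mul0r subr0. Qed.

Lemma gs_shift u k : gs (u + k) = gs u * cexp (- ((pi : R)%:C * (2 * u * k + k ^+ 2))).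
Proof. by rewrite /gs -cexpD; congr cexp; ring. Qed.

Lemma pi_lt4 : (pi : R) < 4.
Proof. by have := pihalf_lt2 R; lra. Qed.

(* First-order expansion of a Gaussian with moving amplitude and centre: the
   amplitude [A + d B] and the argument [u + d k] play symmetric roles in the
   linear term, which is what makes deformation and translation cancel below. *)
Lemma gs_taylor (A B k u : R[i]) (d S M : R) : 0 <= d <= 1 -> 1 <= S ->
  cmod A <= S -> cmod B <= S -> cmod k <= S -> cmod u <= S ->
  cmod (gs u) <= M -> cmod (gs (u + d%:C * k)) <= M ->
  cmod ((A + d%:C * B) * gs (u + d%:C * k) - A * gs u
        - d%:C * ((B - 2 * (pi : R)%:C * A * u * k) * gs u))
    <= d ^+ 2 * (1200 * S ^+ 5 * M).
Proof.
move=> /andP[d0 d1] S1 hA hB hk hu M1 M2.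
have p0 := pi_gt0 R; have p4 := pi_lt4.
have S0 : 0 <= S by lra.
have M0 : 0 <= M by apply: le_trans M1; exact: cmod_ge0.
set y := - ((pi : R)%:C * (2 * u * (d%:C * k) + (d%:C * k) ^+ 2)).
have gE : gs (u + d%:C * k) = gs u * cexp y by rewrite gs_shift.
have cd : cmod d%:C = d by rewrite cmod_real ger0_norm.
have cp : cmod (pi : R)%:C = pi by rewrite cmod_real ger0_norm // ltW.
have c2 : cmod (2 : R[i]) = 2 by rewrite (cmod_nat R 2).
have uk : cmod u * cmod k <= S ^+ 2 by rewrite expr2 ler_pM ?cmod_ge0.
have kk : cmod k ^+ 2 <= S ^+ 2 by rewrite !expr2 ler_pM ?cmod_ge0.
have hy : cmod y <= 12 * d * S ^+ 2.
  rewrite /y cmodN cmodM cp.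
  have h : cmod (2 * u * (d%:C * k) + (d%:C * k) ^+ 2) <= 3 * d * S ^+ 2.
    apply: le_trans (cmodD _ _) _; rewrite cmodX !cmodM cd c2 exprMn.
    have h1 : d * (cmod u * cmod k) <= d * S ^+ 2 by rewrite ler_wpM2l.
    have h2 : d ^+ 2 * cmod k ^+ 2 <= d * S ^+ 2.
      apply: ler_pM => //; rewrite ?exprn_ge0 ?cmod_ge0 //.
      by rewrite expr2 ler_piMr.
    by move: h1 h2;
      rewrite (_ : 2 * cmod u * (d * cmod k) = 2 * (d * (cmod u * cmod k))); [lra|ring].
  apply: (@le_trans _ _ (4 * (3 * d * S ^+ 2))); last by lra.
  by apply: ler_pM; rewrite ?cmod_ge0 //; lra.
have e1 : cmod (gs u * (cexp y - 1 - y)) <= 576 * d ^+ 2 * S ^+ 4 * M.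
  rewrite cmodM.
  apply: (@le_trans _ _ (cmod (gs u) * (4 * cmod y ^+ 2 * Num.max 1 (expR (complex.Re y))))).
    by rewrite ler_wpM2l ?cmod_ge0 // cmod_cexp_sub1D.
  rewrite mulrCA.
  have mm : cmod (gs u) * Num.max 1 (expR (complex.Re y)) <= M.
    by rewrite -cmod_cexp maxr_pMr ?cmod_ge0 // mulr1 ge_max M1 -cmodM -gE.
  apply: (@le_trans _ _ (4 * cmod y ^+ 2 * M)).
    by rewrite ler_wpM2l // mulr_ge0 // exprn_ge0 ?cmod_ge0.
  apply: ler_wpM2r => //.
  have : cmod y ^+ 2 <= (12 * d * S ^+ 2) ^+ 2.
    by rewrite lerXn2r ?nnegrE ?cmod_ge0 // !mulr_ge0 ?exprn_ge0.
  by rewrite (_ : (12 * d * S ^+ 2) ^+ 2 = 144 * (d ^+ 2 * S ^+ 4)); [lra|ring].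
have AB : cmod (A + d%:C * B) <= 2 * S.
  apply: le_trans (cmodD _ _) _; rewrite cmodM cd.
  have : d * cmod B <= 1 * S by rewrite ler_pM ?cmod_ge0.
  by lra.
(* These are the second-order terms of (A + d B)(1 + y) - A. The remainder of the exponential
   contributes 1152 and [rest] contributes 16, rounded up to 1200. *)
set rest := - (A * ((pi : R)%:C * (d%:C * k) ^+ 2)) + d%:C * (B * y).
have e2 : cmod rest <= 16 * d ^+ 2 * S ^+ 3.
  rewrite /rest; apply: le_trans (cmodD _ _) _.
  rewrite cmodN [cmod (A * _)]cmodM [cmod (_ * _ ^+ 2)]cmodM cmodX !cmodM cp cd exprMn.
  have h1 : cmod A * (pi * (d ^+ 2 * cmod k ^+ 2)) <= S * (4 * (d ^+ 2 * S ^+ 2)).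
    have t0 : 0 <= d ^+ 2 * cmod k ^+ 2 by rewrite mulr_ge0 ?exprn_ge0 ?cmod_ge0.
    have t1 : d ^+ 2 * cmod k ^+ 2 <= d ^+ 2 * S ^+ 2 by rewrite ler_wpM2l ?exprn_ge0.
    have t2 := ler_pM (ltW p0) t0 (ltW p4) t1.
    exact: ler_pM (cmod_ge0 _) (mulr_ge0 (ltW p0) t0) hA t2.
  have h2 : d * (cmod B * cmod y) <= d * (S * (12 * d * S ^+ 2)).
    by rewrite ler_wpM2l // ler_pM ?cmod_ge0.
  by move: h1 h2; rewrite !exprS expr0; lra.
have -> : (A + d%:C * B) * gs (u + d%:C * k) - A * gs u
   - d%:C * ((B - 2 * (pi : R)%:C * A * u * k) * gs u) =
   (A + d%:C * B) * (gs u * (cexp y - 1 - y)) + gs u * rest.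
  by rewrite gE /rest /y; ring.
apply: le_trans (cmodD _ _) _; rewrite !(cmodM _ (gs u * _)) (cmodM (gs u) rest).
have f1 := ler_pM (cmod_ge0 _) (cmod_ge0 _) AB e1.
have f2 := ler_pM (cmod_ge0 _) (cmod_ge0 _) M1 e2.
have S35 : S ^+ 3 <= S ^+ 5 by rewrite ler_weXn2l.
have f3 : d ^+ 2 * S ^+ 3 * M <= d ^+ 2 * S ^+ 5 * M.
  by rewrite ler_wpM2r // ler_wpM2l // exprn_ge0.
have f4 : 0 <= d ^+ 2 * S ^+ 5 * M by rewrite !mulr_ge0 ?exprn_ge0.
apply: le_trans (lerD f1 f2) _.
rewrite (_ : 2 * S * (576 * d ^+ 2 * S ^+ 4 * M) = 1152 * (d ^+ 2 * S ^+ 5 * M)); last by ring.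
rewrite (_ : M * (16 * d ^+ 2 * S ^+ 3) = 16 * (d ^+ 2 * S ^+ 3 * M)); last by ring.
by rewrite (_ : d ^+ 2 * (1200 * S ^+ 5 * M) = 1200 * (d ^+ 2 * S ^+ 5 * M)); [lra|ring].
Qed.

Lemma gs_decay c b : 0 < c -> 0 <= b -> exists2 C : R, 0 <= C & forall x u,
  c * x ^+ 2 - b * `|x| - b <= complex.Re (u ^+ 2) ->
  (1 + `|x|) ^+ 5 * cmod (gs u) <= C * expR (- `|x|).
Proof.
move=> c0 b0; have p0 := pi_gt0 R.
set K := 1 + pi * b + (2 + pi * b) ^+ 2 / (4 * pi * c).
exists (120 * expR K); first by rewrite mulr_ge0 // expR_ge0.
move=> x u; rewrite cmod_gs; set y := `|x|.
have y0 : 0 <= y by apply: normr_ge0.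
rewrite -(real_normK (num_real x)) -/y => h.
have h5 : (1 + y) ^+ 5 <= 120 * expR (1 + y).
  have := @expR_ge1Dxn R (1 + y) 4; rewrite (_ : (5`!)%:R = 120%:R :> R) // => H.
  have {}H : (1 + y) ^+ 5 / 120 <= expR (1 + y) by have := H (addr_ge0 ler01 y0); lra.
  by lra.
apply: (@le_trans _ _ (120 * expR (1 + y) * expR (- (pi * complex.Re (u ^+ 2))))).
  by rewrite ler_wpM2r // expR_ge0.
rewrite -!mulrA ler_wpM2l // -!expRD ler_expR.
have ph := ler_wpM2l (ltW p0) h.
have pc : 0 < 4 * pi * c by rewrite !mulr_gt0.
have sq : (2 + pi * b) * y - pi * c * y ^+ 2 <= (2 + pi * b) ^+ 2 / (4 * pi * c).
  rewrite ler_pdivlMr //.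
  have := sqr_ge0 (2 + pi * b - 2 * pi * c * y).
  have p1 : 0 <= pi * c by rewrite mulr_ge0 // ltW.
  by rewrite !expr2; lra.
by move: ph sq; rewrite /K !mulrBr; lra.
Qed.

End Gaussian.

(** * Gaussians along a segment of lines, with uniform constants *)

Section GaussianFamily.
Variable R : realType.
Implicit Types (u w V z : R[i]) (x c b s d : R).

(** The open sector |arg V| < pi/4: it is convex, and there Re V^2 > 0, so that Gaussians decay
    along every line x -> V x + w. *)
Definition cone V := `|complex.Im V| < complex.Re V.

Definition gquad c b x u := c * x ^+ 2 - b * `|x| - b <= complex.Re (u ^+ 2).

Lemma gs_amp_decay c b (D : R) : 0 < c -> 0 <= b -> 1 <= D ->
  exists2 C : R, 0 <= C & forall x A u, gquad c b x u ->
  cmod A <= D * (1 + `|x|) -> cmod (A * gs u) <= C * expR (- `|x|).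
Proof.
move=> c0 b0 D1; have [C C0 hC] := gs_decay c0 b0.
exists (D * C); first by rewrite mulr_ge0 //; lra.
move=> x A u /hC h hA; rewrite cmodM.
have y1 : 1 <= 1 + `|x| by rewrite lerDl.
have h1 : 1 + `|x| <= (1 + `|x|) ^+ 5 by rewrite -[leLHS]expr1 ler_weXn2l.
apply: (@le_trans _ _ (D * (1 + `|x|) * cmod (gs u))).
  by rewrite ler_wpM2r ?cmod_ge0.
rewrite -!mulrA ler_wpM2l //; first by lra.
by apply: le_trans h; rewrite ler_wpM2r ?cmod_ge0.
Qed.

Lemma gs_taylor_decay c b (D : R) : 0 < c -> 0 <= b -> 1 <= D ->
  exists2 C : R, 0 <= C & forall x d A B k u, 0 <= d <= 1 ->
  gquad c b x u -> gquad c b x (u + d%:C * k) ->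
  cmod A <= D * (1 + `|x|) -> cmod B <= D * (1 + `|x|) ->
  cmod k <= D * (1 + `|x|) -> cmod u <= D * (1 + `|x|) ->
  cmod ((A + d%:C * B) * gs (u + d%:C * k) - A * gs u
        - d%:C * ((B - 2 * (pi : R)%:C * A * u * k) * gs u))
    <= d ^+ 2 * (C * expR (- `|x|)).
Proof.
move=> c0 b0 D1; have [C C0 hC] := gs_decay c0 b0.
exists (1200 * D ^+ 5 * C).
  by rewrite -mulrA mulr_ge0 ?ler0n // mulr_ge0 // exprn_ge0 //; lra.
move=> x d A B k u d01 /hC h1 /hC h2 hA hB hk hu.
have y1 : 1 <= 1 + `|x| by rewrite lerDl.
have y5 : 0 < (1 + `|x|) ^+ 5 by rewrite exprn_gt0 //; lra.
have S1 : 1 <= D * (1 + `|x|) by apply: mulr_ege1.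
pose M := C * expR (- `|x|) / (1 + `|x|) ^+ 5.
have m1 : cmod (gs u) <= M by rewrite ler_pdivlMr // mulrC.
have m2 : cmod (gs (u + d%:C * k)) <= M by rewrite ler_pdivlMr // mulrC.
apply: le_trans (gs_taylor d01 S1 hA hB hk hu m1 m2) _.
rewrite le_eqVlt; apply/orP; left; apply/eqP; congr (_ * _).
by rewrite /M exprMn; field; rewrite lt0r_neq0.
Qed.

Section Segment.
Variables V0 V1 w0 w1 : R[i].
Hypotheses (cone0 : cone V0) (cone1 : cone V1).

(** A homotopy of lines x -> V_s x + w_s between two given ones; [segp x] is its velocity in [s]. *)
Definition segV s := V0 + s%:C * (V1 - V0).
Definition segw s := w0 + s%:C * (w1 - w0).
Definition segp x := (V1 - V0) * x%:C + (w1 - w0).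

Let D : R := 1 + 2 * (cmod V0 + cmod V1 + cmod w0 + cmod w1).

Let D1 : 1 <= D.
Proof. by rewrite /D lerDl mulr_ge0 // !addr_ge0 ?cmod_ge0. Qed.

Lemma segV_le s : 0 <= s <= 1 -> cmod (segV s) <= D.
Proof.
move=> /andP[s0 s1]; rewrite /segV.
have h := cmodD V0 (s%:C * (V1 - V0)); apply: le_trans h _.
rewrite cmodM cmod_real ger0_norm //.
have h2 : cmod (V1 - V0) <= cmod V1 + cmod V0 by rewrite -(cmodN V0) cmodD.
have h3 : s * cmod (V1 - V0) <= cmod (V1 - V0) by rewrite ler_piMl ?cmod_ge0.
have := cmod_ge0 V0; have := cmod_ge0 V1; have := cmod_ge0 w0; have := cmod_ge0 w1.
by rewrite /D; lra.
Qed.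

Lemma segw_le s : 0 <= s <= 1 -> cmod (segw s) <= D.
Proof.
move=> /andP[s0 s1]; rewrite /segw.
have h := cmodD w0 (s%:C * (w1 - w0)); apply: le_trans h _.
rewrite cmodM cmod_real ger0_norm //.
have h2 : cmod (w1 - w0) <= cmod w1 + cmod w0 by rewrite -(cmodN w0) cmodD.
have h3 : s * cmod (w1 - w0) <= cmod (w1 - w0) by rewrite ler_piMl ?cmod_ge0.
have := cmod_ge0 V0; have := cmod_ge0 V1; have := cmod_ge0 w0; have := cmod_ge0 w1.
by rewrite /D; lra.
Qed.

Lemma segp_le x : cmod (segp x) <= D * (1 + `|x|).
Proof.
rewrite /segp; apply: le_trans (cmodD _ _) _; rewrite cmodM cmod_real.
have h1 : cmod (w1 - w0) <= cmod w1 + cmod w0 by rewrite -(cmodN w0) cmodD.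
have h2 : cmod (V1 - V0) <= cmod V1 + cmod V0 by rewrite -(cmodN V0) cmodD.
have := cmod_ge0 V0; have := cmod_ge0 V1; have := cmod_ge0 w0; have := cmod_ge0 w1.
move=> a1 a2 a3 a4.
have h3 : cmod (V1 - V0) <= D by rewrite /D; lra.
have h4 : cmod (w1 - w0) <= D by rewrite /D; lra.
have h5 : cmod (V1 - V0) * `|x| <= D * `|x| by rewrite ler_wpM2r.
by lra.
Qed.

(** The margin [m] by which Re V exceeds |Im V| is a minimum of linear forms in V, so it persists
    along the segment, and Re V^2 = (Re V - Im V)(Re V + Im V) >= m^2. The shift by d V with |d| <=
    1 covers steps to neighbouring grid points. *)
Lemma seg_quad : exists c b, [/\ 0 < c, 0 <= b & forall s d x, 0 <= s <= 1 ->
  -1 <= d <= 1 -> gquad c b x (segV s * x%:C + segw s + d%:C * segV s)].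
Proof.
move: (cone0) (cone1); rewrite /cone !ltr_norml => /andP[p1 p2] /andP[p3 p4].
set m := Num.min (Num.min (complex.Re V0 - complex.Im V0) (complex.Re V0 + complex.Im V0))
  (Num.min (complex.Re V1 - complex.Im V1) (complex.Re V1 + complex.Im V1)).
have m0 : 0 < m by rewrite !lt_min; do !(apply/andP; split); lra.
have : m <= m by [].
rewrite {2}/m !le_min => /andP[/andP[m1 m2] /andP[m3 m4]].
have D0 : 0 <= D := le_trans ler01 D1.
exists (m ^+ 2), (4 * D * D + 4 * D * D).
split; [by rewrite exprn_gt0 | by rewrite addr_ge0 // !mulr_ge0 |].
move=> s d x s01 d1; rewrite /gquad.
set V := segV s; set W := segw s + d%:C * segV s.
have hV : cmod V <= D by apply: segV_le.
have hW : cmod W <= 2 * D.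
  apply: le_trans (cmodD _ _) _; rewrite cmodM cmod_real.
  have := segw_le s01; have : `|d| * cmod (segV s) <= 1 * D.
    by rewrite ler_pM ?cmod_ge0 // ler_norml.
  by lra.
have -> : (V * x%:C + segw s + d%:C * V) ^+ 2 =
    V ^+ 2 * (x ^+ 2)%:C + (2 * x)%:C * (V * W) + W ^+ 2.
  by rewrite /W /V !RealM; ring.
rewrite !ReD [complex.Re (V ^+ 2 * _)]ReM [complex.Re ((2 * x)%:C * _)]ReM.
rewrite !ReC !ImC mulr0 mul0r !subr0.
have v1 : m <= complex.Re V - complex.Im V.
  rewrite /V /segV !ReD !ImD !ReM !ImM !ReD !ImD !ReN !ImN /=.
  case/andP: s01 => s0 s1.
  have := ler_wpM2l s0 m3; have s1' : 0 <= 1 - s by lra.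
  by have := ler_wpM2l s1' m1; lra.
have v2 : m <= complex.Re V + complex.Im V.
  rewrite /V /segV !ReD !ImD !ReM !ImM !ReD !ImD !ReN !ImN /=.
  case/andP: s01 => s0 s1.
  have := ler_wpM2l s0 m4; have s1' : 0 <= 1 - s by lra.
  by have := ler_wpM2l s1' m2; lra.
have r1 : m ^+ 2 * x ^+ 2 <= complex.Re (V ^+ 2) * x ^+ 2.
  rewrite ler_wpM2r ?sqr_ge0 // expr2 ReM.
  by have := ler_pM (ltW m0) (ltW m0) v1 v2; lra.
have r2 : - (4 * D * D * `|x|) <= 2 * x * complex.Re (V * W).
  have : `|2 * x * complex.Re (V * W)| <= 4 * D * D * `|x|.
    rewrite !normrM ger0_norm //.
    have h : `|complex.Re (V * W)| <= D * (2 * D).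
      apply: le_trans (normRe_le _) _; rewrite cmodM.
      by rewrite ler_pM ?cmod_ge0.
    have h2 : 2 * `|x| * `|complex.Re (V * W)| <= 2 * `|x| * (D * (2 * D)).
      by rewrite ler_wpM2l // mulr_ge0.
    by apply: le_trans h2 _; rewrite le_eqVlt; apply/orP; left; apply/eqP; ring.
  by rewrite ler_norml => /andP[].
have r3 : - (4 * D * D) <= complex.Re (W ^+ 2).
  have : `|complex.Re (W ^+ 2)| <= 4 * D * D.
    apply: le_trans (normRe_le _) _; rewrite cmodX expr2.
    by have := ler_pM (cmod_ge0 _) (cmod_ge0 _) hW hW; lra.
  by rewrite ler_norml => /andP[].
have x0 := normr_ge0 x.
have DD : 0 <= 4 * D * D by rewrite !mulr_ge0.
have : 0 <= 4 * D * D * `|x| by rewrite mulr_ge0.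
by lra.
Qed.

(* The derivative in [s] of [segV s * gs u] at [u = segV s * x + segw s] equals
   the derivative in [x] of [segp x * gs u]. *)
Definition segT s x :=
  (V1 - V0 - 2 * (pi : R)%:C * segV s * (segV s * x%:C + segw s) * segp x)
  * gs (segV s * x%:C + segw s).

(** The first two bounds share the linear term [segT]: up to second order, moving the line has the
    same effect as a difference in [x], which telescopes over a grid. The last bound is a second
    difference in [x], for the decay of Fourier sums. *)
Lemma seg_estimates : exists2 C : R, 0 <= C & forall s d x, 0 <= s <= 1 -> 0 <= d <= 1 ->
  [/\ (s + d <= 1 -> cmod (segV (s + d) * gs (segV (s + d) * x%:C + segw (s + d)) -
         segV s * gs (segV s * x%:C + segw s) - d%:C * segT s x)
        <= d ^+ 2 * (C * expR (- `|x|))),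
     cmod (segp (x + d) * gs (segV s * (x + d)%:C + segw s) -
         segp x * gs (segV s * x%:C + segw s) - d%:C * segT s x)
        <= d ^+ 2 * (C * expR (- `|x|)),
     cmod (segp x * gs (segV s * x%:C + segw s)) <= C * expR (- `|x|),
     cmod (segV s * gs (segV s * x%:C + segw s)) <= C * expR (- `|x|) &
     cmod (segV s * gs (segV s * (x + d)%:C + segw s) +
           segV s * gs (segV s * (x - d)%:C + segw s) -
           2 * (segV s * gs (segV s * x%:C + segw s))) <= d ^+ 2 * (C * expR (- `|x|))].
Proof.
have [c [b [c0 b0 hq]]] := seg_quad.
have D2 : 1 <= 2 * D by have := D1; lra.
have [C1 C10 h1] := gs_taylor_decay c0 b0 D2.
have [C2 C20 h2] := gs_amp_decay c0 b0 D2.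
exists (2 * C1 + C2); first by rewrite addr_ge0 ?mulr_ge0.
move=> s d x s01 d01.
set u := segV s * x%:C + segw s.
have e0 := expR_ge0 (- `|x|).
have hqx s' : 0 <= s' <= 1 -> gquad c b x (segV s' * x%:C + segw s').
  move=> hs; have := hq s' 0 x hs; rewrite mul0r addr0; apply; lra.
have y1 : 1 <= 1 + `|x| by rewrite lerDl.
have grow (z : R[i]) : cmod z <= D -> cmod z <= 2 * D * (1 + `|x|).
  move=> h; apply: (le_trans h); have d1 := D1.
  by have := ler_wpM2l (_ : 0 <= 2 * D) y1; lra.
have hV := grow _ (segV_le s01).
have hp : cmod (segp x) <= 2 * D * (1 + `|x|).
  by have := segp_le x; have := ler_wpM2l (_ : 0 <= D) y1; have := D1; nra.
have hV' : cmod (V1 - V0) <= 2 * D * (1 + `|x|).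
  apply: grow; have h : cmod (V1 - V0) <= cmod V1 + cmod V0 by rewrite -(cmodN V0) cmodD.
  have := cmod_ge0 V0; have := cmod_ge0 V1; have := cmod_ge0 w0; have := cmod_ge0 w1.
  by rewrite /D; lra.
have hu : cmod u <= 2 * D * (1 + `|x|).
  apply: le_trans (cmodD _ _) _; rewrite cmodM cmod_real.
  have a1 : cmod (segV s) * `|x| <= D * `|x| by rewrite ler_wpM2r // segV_le.
  have := segw_le s01; have := D1; have := normr_ge0 x; nra.
have wk C (t : R) : 0 <= C -> C <= 2 * C1 + C2 -> t <= d ^+ 2 * (C * expR (- `|x|)) ->
   t <= d ^+ 2 * ((2 * C1 + C2) * expR (- `|x|)).
  move=> hC hC' ht; apply: le_trans ht _.
  by rewrite ler_wpM2l ?sqr_ge0 // ler_wpM2r.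
have wk2 (t : R) : t <= C2 * expR (- `|x|) -> t <= (2 * C1 + C2) * expR (- `|x|).
  by move=> ht; apply: le_trans ht _; rewrite ler_wpM2r //; lra.
have ud : gquad c b x (u + d%:C * segV s) by apply: hq => //; lra.
split.
- move=> sd; have sd01 : 0 <= s + d <= 1 by lra.
  apply: (wk C1); [lra|lra|].
  have -> : segV (s + d) = segV s + d%:C * (V1 - V0) by rewrite /segV RealD; ring.
  have E : segV (s + d) * x%:C + segw (s + d) = u + d%:C * segp x.
    by rewrite /u /segV /segw /segp RealD; ring.
  have -> : (segV s + d%:C * (V1 - V0)) * x%:C + segw (s + d) = u + d%:C * segp x.
    by rewrite /u /segV /segw /segp RealD; ring.
  apply: h1 => //; first exact: hqx.
  by rewrite -E; apply: hqx.
- apply: (wk C1); [lra|lra|].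
  have -> : segp (x + d) = segp x + d%:C * (V1 - V0) by rewrite /segp RealD; ring.
  have -> : segV s * (x + d)%:C + segw s = u + d%:C * segV s by rewrite /u RealD; ring.
  have -> : segT s x = (V1 - V0 - 2 * (pi : R)%:C * segp x * u * segV s) * gs u.
    by rewrite /segT -/u; ring.
  by apply: h1 => //; exact: hqx.
- by apply: wk2; apply: h2 => //; exact: hqx.
- by apply: wk2; apply: h2 => //; exact: hqx.
apply: (wk (2 * C1)); [by rewrite mulr_ge0 | by rewrite lerDl |].
have -> : segV s * (x + d)%:C + segw s = u + d%:C * segV s by rewrite /u RealD; ring.
have -> : segV s * (x - d)%:C + segw s = u + d%:C * (- segV s).
  by rewrite /u RealD RealN; ring.
have ud' : gquad c b x (u + d%:C * (- segV s)).
  have := hq s (- d) x s01; rewrite RealN mulNr mulrN; apply; lra.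
have hz : cmod (0 : R[i]) <= 2 * D * (1 + `|x|) by rewrite cmod0 mulr_ge0 //; lra.
have hVN : cmod (- segV s) <= 2 * D * (1 + `|x|) by rewrite cmodN.
have := h1 x d (segV s) 0 (segV s) u d01 (hqx s s01) ud hV hz hV hu.
have := h1 x d (segV s) 0 (- segV s) u d01 (hqx s s01) ud' hV hz hVN hu.
rewrite !mulr0 !addr0 !sub0r => g1 g2.
set g := (X in cmod X <= _) in g1.
set g' := (X in cmod X <= _) in g2.
rewrite (_ : _ - _ = g + g'); last by rewrite /g /g'; ring.
by apply: le_trans (cmodD _ _) _; lra.
Qed.

End Segment.
End GaussianFamily.

(** * Riemann sums of Gaussians: deformation and Fourier decay *)

Section RiemannSums.
Variable R : realType.
Implicit Types (u w V z : R[i]) (x c b s d : R).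

(** Mesh 1/L on the window from -L to L, which takes 2 L^2 steps; refining and widening are driven
    by one parameter. *)
Definition grid (L i : nat) : R := i%:R / L%:R - L%:R.

Lemma gridS L i : (0 < L)%N -> grid L i.+1 = grid L i + L%:R^-1.
Proof. by move=> L0; rewrite /grid -natr1 mulrDl mul1r; ring. Qed.

Lemma expR_inv_lt (L : nat) : (0 < L)%N -> (1 - expR (- (L%:R^-1 : R)))^-1 <= L%:R + 1.
Proof.
move=> L0; have l0 : 0 < (L%:R : R) by rewrite ltr0n.
set t : R := L%:R^-1; have t0 : 0 < t by rewrite invr_gt0.
have h := expR_ge1Dx t; have e0 := expR_gt0 t.
have tL : t * L%:R = 1 by rewrite mulVf // lt0r_neq0.
have pos : 0 < 1 - expR (- t) by rewrite subr_gt0 expR_lt1 oppr_lt0.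
rewrite -(ler_pM2l pos) mulfV ?lt0r_neq0 // expRN.
have h2 : (expR t)^-1 <= (1 + t)^-1 by rewrite lef_pV2 ?posrE //; lra.
have h3 : 1 - (1 + t)^-1 <= 1 - (expR t)^-1 by lra.
have L1 : 0 <= L%:R + 1 :> R by lra.
apply: le_trans (ler_wpM2r L1 h3).
rewrite le_eqVlt; apply/orP; left; apply/eqP.
have -> : L%:R = t^-1 by rewrite invrK.
by field; rewrite !lt0r_neq0 //; lra.
Qed.

Lemma sum_exp_grid L : (0 < L)%N ->
  \sum_(0 <= i < 2 * L ^ 2) expR (- `|grid L i|) <= 4 * L%:R.
Proof.
move=> L0; have l0 : 0 < (L%:R : R) by rewrite ltr0n.
have l1 : 1 <= (L%:R : R) by rewrite ler1n.
have lne : L%:R != 0 :> R by rewrite lt0r_neq0.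
set r := expR (- (L%:R^-1 : R)).
have r01 : 0 <= r < 1 by rewrite expR_ge0 /r expR_lt1 oppr_lt0 invr_gt0.
have geo n : \sum_(0 <= i < n) r ^+ i <= L%:R + 1.
  apply: le_trans (sum_geo_le n r01) _; exact: expR_inv_lt.
have gE : grid L (L ^ 2) = 0 by rewrite /grid natrX expr2 mulfK // subrr.
rewrite mul2n -addnn (big_cat_nat (leq0n (L ^ 2)%N)) ?leq_addr //=.
have -> : 4 * (L%:R : R) = 2 * L%:R + 2 * L%:R by ring.
apply: lerD.
  rewrite big_nat_rev /= add0n.
  apply: (@le_trans _ _ (\sum_(0 <= i < L ^ 2) r ^+ i)); last first.
    by apply: le_trans (geo _) _; lra.
  rewrite !big_nat; apply: ler_sum => i /andP[_ iL].
  rewrite /r -expRM_natl ler_expR mulrN lerN2.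
  rewrite /grid natrB // natrX expr2 -natr1 -[X in _ <= X]normrN.
  apply: le_trans (ler_norm _); rewrite le_eqVlt; apply/orP; right.
  rewrite -subr_gt0 (_ : _ - _ = L%:R^-1); first by rewrite invr_gt0.
  by field.
rewrite -[in X in X <= _](add0n (L ^ 2)%N) big_addn addnK.
apply: (@le_trans _ _ (\sum_(0 <= i < L ^ 2) r ^+ i)); last first.
  by apply: le_trans (geo _) _; lra.
rewrite !big_nat; apply: ler_sum => i /andP[_ iL].
rewrite /r -expRM_natl ler_expR mulrN lerN2.
apply: le_trans (ler_norm _); rewrite /grid natrD natrX expr2.
by rewrite le_eqVlt; apply/orP; left; apply/eqP; field.
Qed.

Lemma grid0 L : grid L 0 = - L%:R.
Proof. by rewrite /grid mul0r sub0r. Qed.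

Lemma gridn L : (0 < L)%N -> grid L (2 * L ^ 2) = L%:R.
Proof.
move=> L0; rewrite /grid natrM natrX; field.
by rewrite pnatr_eq0 -lt0n.
Qed.

(** A Riemann sum of the Gaussian integral over the line through [w] with direction [V]. *)
Definition hsum V w (L : nat) : R[i] :=
  L%:R^-1 * \sum_(0 <= i < 2 * L ^ 2) V * gs (V * (grid L i)%:C + w).

Lemma exp_decay_le (L : nat) : (0 < L)%N -> expR (- (L%:R : R)) <= L%:R^-1.
Proof.
move=> L0; have l0 : 0 < (L%:R : R) by rewrite ltr0n.
rewrite expRN lef_pV2 ?posrE ?expR_gt0 //.
by have := expR_ge1Dx (L%:R : R); lra.
Qed.

Lemma cmod_ninv (L : nat) : cmod (L%:R^-1 : R[i]) = L%:R^-1.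
Proof. by rewrite cmodV cmod_nat. Qed.

(** The segment of lines is cut into L steps of length d = 1/L. In each step the sum changes by a
    telescoping part, whose end values are at most C e^(-L) <= C d, and by 2 L^2 second-order errors
    with exponentially decaying weights. Both are O(d^2), so L steps cost O(d). *)
Lemma hsum_deform V0 V1 w0 w1 : cone V0 -> cone V1 ->
  exists2 C : R, 0 <= C & forall L, (0 < L)%N ->
    cmod (hsum V1 w1 L - hsum V0 w0 L) <= C / L%:R.
Proof.
move=> c0 c1; have [C C0 hC] := seg_estimates w0 w1 c0 c1.
exists (2 * C + 8 * C); first by rewrite addr_ge0 // mulr_ge0.
move=> L L0; have l0 : 0 < (L%:R : R) by rewrite ltr0n.
have l1 : 1 <= (L%:R : R) by rewrite ler1n.
have lne : L%:R != 0 :> R by rewrite lt0r_neq0.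
set d : R := L%:R^-1.
have d0 : 0 < d by rewrite invr_gt0.
have d1 : d <= 1 by rewrite invf_le1.
have dL : d * L%:R = 1 by rewrite mulVf.
pose h s := hsum (segV V0 V1 s) (segw w0 w1 s) L.
have step s : 0 <= s -> s + d <= 1 ->
    cmod (h (s + d) - h s) <= d ^+ 2 * (2 * C + 8 * C).
  move=> s0 s1; have s01 : 0 <= s <= 1 by lra.
  have d01 : 0 <= d <= 1 by lra.
  have z01 : 0 <= (0 : R) <= 1 by rewrite lexx ler01.
  pose G i := segp V0 V1 w0 w1 (grid L i) *
     gs (segV V0 V1 s * (grid L i)%:C + segw w0 w1 s).
  pose phi t i := segV V0 V1 t * gs (segV V0 V1 t * (grid L i)%:C + segw w0 w1 t).
  (* The increments of [G] in [x] are inserted so that the linear term [segT] cancels in the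
     remaining sum. *)
  have -> : h (s + d) - h s = L%:R^-1 * (G (2 * L ^ 2)%N - G 0%N) +
      L%:R^-1 * \sum_(0 <= i < 2 * L ^ 2) (phi (s + d) i - phi s i - (G i.+1 - G i)).
    rewrite -(telescope_sumr _ (leq0n (2 * L ^ 2)%N)) -mulrDr -big_split /=.
    rewrite /h /hsum -mulrBr -sumrB; congr (_ * _).
    by apply: eq_bigr => i _; rewrite /phi; ring.
  have hGn : cmod (G (2 * L ^ 2)%N) <= C * d.
    have [_ _ + _ _] := hC s 0 (grid L (2 * L ^ 2)) s01 z01.
    move=> H; apply: le_trans H _.
    rewrite ler_wpM2l // gridn // ger0_norm ?ler0n //; exact: exp_decay_le.
  have hG0 : cmod (G 0%N) <= C * d.
    have [_ _ + _ _] := hC s 0 (grid L 0) s01 z01.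
    move=> H; apply: le_trans H _.
    rewrite ler_wpM2l // grid0 normrN ger0_norm ?ler0n //; exact: exp_decay_le.
  apply: le_trans (cmodD _ _) _; rewrite !cmodM !cmod_ninv -/d.
  have f1 : d * cmod (G (2 * L ^ 2)%N - G 0%N) <= d ^+ 2 * (2 * C).
    have : cmod (G (2 * L ^ 2)%N - G 0%N) <= C * d + C * d.
      by apply: le_trans (cmodD _ _) _; rewrite cmodN lerD.
    by move=> /(ler_wpM2l (ltW d0)); rewrite expr2; lra.
  have f2 : cmod (\sum_(0 <= i < 2 * L ^ 2) (phi (s + d) i - phi s i - (G i.+1 - G i)))
     <= d ^+ 2 * (2 * C) * (4 * L%:R).
    apply: le_trans (cmod_sum _ _ _) _.
    apply: (@le_trans _ _ (\sum_(0 <= i < 2 * L ^ 2) d ^+ 2 * (2 * C) * expR (- `|grid L i|))).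
      apply: ler_sum => i _.
      have [a1 a2 _ _ _] := hC s d (grid L i) s01 d01.
      have {}a1 := a1 s1.
      rewrite /phi /G gridS //.
      set T := segT V0 V1 w0 w1 s (grid L i) in a1 a2.
      set A := (X in cmod (X - _) <= _) in a1.
      set B := (X in cmod (X - _) <= _) in a2.
      rewrite (_ : A - B = (A - d%:C * T) - (B - d%:C * T)); last by ring.
      by apply: le_trans (cmodD _ _) _; rewrite cmodN; lra.
    by rewrite -mulr_sumr ler_wpM2l ?sum_exp_grid // mulr_ge0 ?sqr_ge0 // mulr_ge0.
  have := ler_wpM2l (ltW d0) f2.
  rewrite (_ : d * (d ^+ 2 * (2 * C) * (4 * L%:R)) = d ^+ 2 * (8 * C) * (d * L%:R)); last by ring.
  by rewrite dL mulr1; lra.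
have key j : (j <= L)%N -> cmod (h (j%:R * d) - h 0) <= j%:R * (d ^+ 2 * (2 * C + 8 * C)).
  elim: j => [_|j IH jL]; first by rewrite !mul0r subrr cmod0.
  have jd : j%:R * d + d = j.+1%:R * d by rewrite -natr1 mulrDl mul1r.
  have j1 : j.+1%:R * d <= 1.
    apply: (@le_trans _ _ (L%:R * d)); last by rewrite mulrC dL.
    by rewrite ler_wpM2r ?ler_nat // ltW.
  have j0 : 0 <= j%:R * d by rewrite mulr_ge0 // ltW.
  have := step (j%:R * d) j0; rewrite jd => /(_ j1) h1.
  have h2 := IH (ltnW jL).
  rewrite (_ : h _ - h 0 = (h (j.+1%:R * d) - h (j%:R * d)) + (h (j%:R * d) - h 0)); last by ring.
  by apply: le_trans (cmodD _ _) _; rewrite [in leRHS]mulrSr mulrDl mul1r addrC lerD.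
have := key L (leqnn L).
rewrite mulrC dL /h /segV /segw !mul1r !mul0r !addr0 ![_ + (_ - _)]addrC !subrK.
rewrite (_ : L%:R * (d ^+ 2 * _) = (2 * C + 8 * C) * d * (d * L%:R)); last by ring.
by rewrite dL mulr1.
Qed.

Lemma sum_by_parts (f : nat -> R[i]) z n :
  (1 - z) * \sum_(0 <= i < n) f i * z ^+ i =
  f 0%N - f n * z ^+ n + z * \sum_(0 <= i < n) (f i.+1 - f i) * z ^+ i.
Proof.
elim: n => [|n IH]; first by rewrite !big_geq // !mulr0 expr0 mulr1 subrr addr0.
rewrite !big_nat_recr //= !mulrDr IH exprS; ring.
Qed.

Lemma sum_by_parts2 (f : nat -> R[i]) z n :
  (1 - z) ^+ 2 * \sum_(0 <= i < n) f i * z ^+ i =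
  (1 - z) * (f 0%N - f n * z ^+ n) + z * (f 1%N - f 0%N - (f n.+1 - f n) * z ^+ n)
  + z ^+ 2 * \sum_(0 <= i < n) (f i.+2 - 2 * f i.+1 + f i) * z ^+ i.
Proof.
have h := sum_by_parts (fun i => f i.+1 - f i) z n.
rewrite expr2 -mulrA sum_by_parts mulrDr [(1 - z) * (z * _)]mulrCA h [z * (_ + _)]mulrDr addrA.
congr (_ + _); rewrite mulrA -expr2; congr (_ * _).
by apply: eq_bigr => i _; congr (_ * _); ring.
Qed.

(** Two summations by parts trade (1 - z)^2 for second differences of the Gaussian, of size d^2, and
    for boundary terms: the discrete form of the decay of a Fourier transform, uniform in [z]. *)
Lemma hsum_fourier_bound V w : cone V ->
  exists2 C : R, 0 <= C & forall L z, (0 < L)%N -> cmod z = 1 ->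
    cmod (1 - z) ^+ 2 * cmod (L%:R^-1 * \sum_(0 <= i < 2 * L ^ 2)
       (V * gs (V * (grid L i)%:C + w)) * z ^+ i) <= C / L%:R ^+ 2.
Proof.
move=> cV; have [C C0 hC] := seg_estimates w w cV cV.
have e1 : 1 <= expR 1 :> R by have := expR_ge1Dx (1 : R); lra.
exists (8 * (C * expR 1) + 4 * (C * expR 1)).
  by rewrite addr_ge0 // !mulr_ge0 ?expR_ge0.
move=> L z L0 z1; have l0 : 0 < (L%:R : R) by rewrite ltr0n.
have l1 : 1 <= (L%:R : R) by rewrite ler1n.
have lne : L%:R != 0 :> R by rewrite lt0r_neq0.
set d : R := L%:R^-1.
have d0 : 0 < d by rewrite invr_gt0.
have d1 : d <= 1 by rewrite invf_le1.
have dL : d * L%:R = 1 by rewrite mulVf.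
set n := (2 * L ^ 2)%N.
pose f i := V * gs (V * (grid L i)%:C + w).
have s01 : 0 <= (0 : R) <= 1 by rewrite lexx ler01.
have d01 : 0 <= d <= 1 by lra.
have est x : [/\ cmod (V * gs (V * x%:C + w)) <= C * expR (- `|x|) &
   cmod (V * gs (V * (x + d)%:C + w) + V * gs (V * (x - d)%:C + w) -
           2 * (V * gs (V * x%:C + w))) <= d ^+ 2 * (C * expR (- `|x|))].
  have [_ _ _] := hC 0 d x s01 d01.
  by rewrite /segV /segw !mul0r !addr0.
have eL := exp_decay_le L0; rewrite -/d in eL.
(* The boundary indices 0, 1, n, n + 1 lie within one mesh of -L or L; the lost unit in the exponent
   costs the factor e. *)
have bnd i : L%:R - 1 <= `|grid L i| -> cmod (f i) <= C * expR 1 * d.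
  move=> h; have [+ _] := est (grid L i); move=> h1; apply: (le_trans h1).
  rewrite -mulrA ler_wpM2l //; apply: (@le_trans _ _ (expR 1 * expR (- L%:R))).
    by rewrite -expRD ler_expR; lra.
  by rewrite ler_wpM2l ?expR_ge0.
have b0 : cmod (f 0%N) <= C * expR 1 * d.
  by apply: bnd; rewrite grid0 normrN ger0_norm //; lra.
have b1 : cmod (f 1%N) <= C * expR 1 * d.
  apply: bnd; rewrite gridS // grid0 -/d -normrN; apply: le_trans (ler_norm _).
  by lra.
have bn : cmod (f n) <= C * expR 1 * d.
  by apply: bnd; rewrite gridn // ger0_norm //; lra.
have bn1 : cmod (f n.+1) <= C * expR 1 * d.
  apply: bnd; rewrite gridS // gridn // -/d; apply: le_trans (ler_norm _).
  by lra.
have zn : cmod (z ^+ n) = 1 by rewrite cmodX z1 expr1n.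
rewrite cmodM mulrCA -cmodX -cmodM sum_by_parts2 cmod_ninv -/d.
set K := C * expR 1 * d in b0 b1 bn bn1.
have t1 : cmod ((1 - z) * (f 0%N - f n * z ^+ n)) <= 2 * (K + K).
  rewrite cmodM; apply: ler_pM; rewrite ?cmod_ge0 //.
    by apply: le_trans (cmodD _ _) _; rewrite cmodN cmod1 z1.
  by apply: le_trans (cmodD _ _) _; rewrite cmodN cmodM zn mulr1 lerD.
have t2 : cmod (z * (f 1%N - f 0%N - (f n.+1 - f n) * z ^+ n)) <= K + K + (K + K).
  rewrite cmodM z1 mul1r; apply: le_trans (cmodD _ _) _.
  rewrite cmodN cmodM zn mulr1; apply: lerD.
    by apply: le_trans (cmodD _ _) _; rewrite cmodN lerD.
  by apply: le_trans (cmodD _ _) _; rewrite cmodN lerD.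
have t3 : cmod (z ^+ 2 * \sum_(0 <= i < n) (f i.+2 - 2 * f i.+1 + f i) * z ^+ i)
   <= d ^+ 2 * (C * expR 1) * (4 * L%:R).
  rewrite cmodM cmodX z1 expr1n mul1r; apply: le_trans (cmod_sum _ _ _) _.
  apply: (@le_trans _ _ (\sum_(0 <= i < n) d ^+ 2 * (C * expR 1) * expR (- `|grid L i|))).
    apply: ler_sum => i _; rewrite cmodM cmodX z1 expr1n mulr1.
    have [_] := est (grid L i.+1).
    rewrite (_ : grid L i.+1 + d = grid L i.+2); last by rewrite [RHS]gridS.
    rewrite (_ : grid L i.+1 - d = grid L i); last by rewrite gridS // addrK.
    rewrite (_ : _ - _ = f i.+2 - 2 * f i.+1 + f i); last by rewrite /f; ring.
    move=> h; apply: le_trans h _; rewrite -mulrA ler_wpM2l ?sqr_ge0 //.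
    rewrite -mulrA ler_wpM2l // -expRD ler_expR.
    rewrite gridS // -/d.
    have : `|grid L i| <= `|grid L i + d| + `|- d|
       by rewrite -[in leLHS](addrK d (grid L i)) ler_normD.
    by rewrite normrN (gtr0_norm d0); lra.
  by rewrite -mulr_sumr ler_wpM2l ?sum_exp_grid // mulr_ge0 ?sqr_ge0 // mulr_ge0 // expR_ge0.
have h : cmod ((1 - z) * (f 0%N - f n * z ^+ n) + z * (f 1%N - f 0%N - (f n.+1 - f n) * z ^+ n)
  + z ^+ 2 * \sum_(0 <= i < n) (f i.+2 - 2 * f i.+1 + f i) * z ^+ i) <=
  8 * K + d ^+ 2 * (C * expR 1) * (4 * L%:R).
  apply: le_trans (cmodD _ _) _; apply: le_trans (lerD (cmodD _ _) (lexx _)) _; lra.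
have := ler_wpM2l (ltW d0) h; move=> hh; apply: (le_trans hh).
rewrite /K -exprVn -/d.
rewrite (_ : d * _ =
  8 * (C * expR 1) * d ^+ 2 + 4 * (C * expR 1) * d ^+ 2 * (d * L%:R)); last by ring.
by rewrite dL; lra.
Qed.

Lemma hsum_bounded V w : cone V ->
  exists2 C : R, 0 <= C & forall L, (0 < L)%N -> cmod (hsum V w L) <= C.
Proof.
move=> cV; have [C C0 hC] := seg_estimates w w cV cV.
exists (4 * C); first by rewrite mulr_ge0.
move=> L L0; have l0 : 0 < (L%:R : R) by rewrite ltr0n.
have lne : L%:R != 0 :> R by rewrite lt0r_neq0.
have s01 : 0 <= (0 : R) <= 1 by rewrite lexx ler01.
rewrite /hsum cmodM cmod_ninv -(ler_pM2l l0) mulrA mulfV // mul1r.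
apply: le_trans (cmod_sum _ _ _) _.
apply: (@le_trans _ _ (\sum_(0 <= i < 2 * L ^ 2) C * expR (- `|grid L i|))).
  apply: ler_sum => i _.
  have [_ _ _ + _] := hC 0 0 (grid L i) s01 s01.
  by rewrite /segV /segw !mul0r !addr0.
rewrite -mulr_sumr mulrC (_ : L%:R * (4 * C) = 4 * L%:R * C); last by ring.
by rewrite ler_wpM2r // sum_exp_grid.
Qed.

End RiemannSums.

(** * Poisson summation and the inversion of eta *)

Section Poisson.
Variable R : realType.
Implicit Types (u w V z : R[i]) (x c b s d m : R).

Lemma RealB (x y : R) : (x - y)%:C = x%:C - y%:C.
Proof. exact: rmorphB. Qed.

Lemma cexp_2pii_nat n : cexp ('i%C * (2 * pi * n%:R : R)%:C) = 1.
Proof. by rewrite RealM mulrA Realn mulrC cexpMn cexp_2pii expr1n. Qed.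

Lemma cexp_2pii_subn j h : cexp ('i%C * (2 * pi * (j%:R - h%:R) : R)%:C) = 1.
Proof.
rewrite mulrBr RealD mulrDr cexpD cexp_2pii_nat mul1r RealN mulrN cexpN.
by rewrite cexp_2pii_nat invr1.
Qed.

Lemma sum_mul_block (T : nmodType) (F : nat -> T) n L :
  \sum_(0 <= i < n * L) F i = \sum_(0 <= k < n) \sum_(0 <= r < L) F (k * L + r)%N.
Proof.
elim: n => [|n IH]; first by rewrite mul0n !big_geq.
rewrite big_nat_recr //= -IH mulSnr (big_cat_nat (leq0n (n * L)%N)) ?leq_addr //=.
congr (_ + _); rewrite -[in LHS](add0n (n * L)%N) big_addn addKn.
by apply: eq_bigr => i _; rewrite addnC.
Qed.

Lemma sum_window (T : nmodType) (F : R -> T) n :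
  \sum_(0 <= k < 2 * n) F (k%:R - n%:R) =
  \sum_(0 <= k < n) F k%:R + \sum_(0 <= k < n) F (- k.+1%:R).
Proof.
rewrite mul2n -addnn (big_cat_nat (leq0n n)) ?leq_addr //= addrC; congr (_ + _).
  rewrite -[in LHS](add0n n) big_addn addnK.
  by apply: eq_bigr => i _; rewrite natrD addrK.
rewrite big_nat_rev /= add0n !big_nat; apply: eq_bigr => i /andP[_ h].
by congr F; rewrite natrB // addrAC subrr add0r.
Qed.

(** Completing the square in the Gaussian times e^(-2 pi i m x) moves the centre by i m / V and
    leaves this factor; up to the Gaussian integral it is the Fourier transform of V e^(-pi (V x +
    w)^2) at [m]. *)
Definition gE V w m : R[i] :=
  cexp (2 * (pi : R)%:C * 'i%C * m%:C * w / V - (pi : R)%:C * m%:C ^+ 2 / V ^+ 2).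

Lemma gs_modulation V w m x : V != 0 ->
  gs (V * x%:C + w) * cexp (- ('i%C * (2 * pi * (m * x))%:C)) =
  gE V w m * gs (V * x%:C + (w + 'i%C * m%:C / V)).
Proof.
move=> V0; rewrite /gs /gE -!cexpD; congr cexp.
apply/eqP; rewrite -subr_eq0; apply/eqP.
rewrite !RealM Realn.
rewrite (_ : _ - _ = (pi : R)%:C * m%:C ^+ 2 / V ^+ 2 * ('i%C * 'i%C + 1)).
  by rewrite ii addNr mulr0.
by field.
Qed.

Definition zrot m (L : nat) : R[i] := cexp (- ('i%C * (2 * pi * (m / L%:R))%:C)).

Definition fsum V w m (L : nat) : R[i] :=
  L%:R^-1 * \sum_(0 <= i < 2 * L ^ 2) (V * gs (V * (grid R L i)%:C + w)) * zrot m L ^+ i.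

Lemma fsumE V w m (L : nat) : V != 0 -> (0 < L)%N ->
  (exists j h : nat, m = j%:R - h%:R) ->
  fsum V w m L = gE V w m * hsum V (w + 'i%C * m%:C / V) L.
Proof.
move=> V0 L0 [j [h mE]]; rewrite /fsum /hsum mulrCA; congr (_ * _).
rewrite mulr_sumr; apply: eq_bigr => i _.
have -> : zrot m L ^+ i = cexp (- ('i%C * (2 * pi * (m * grid R L i))%:C)).
  have lne : (L%:R : R[i]) != 0 by rewrite pnatr_eq0 -lt0n.
  (* For integral [m] the product m L is an integer, so a factor e^(2 pi i m L) = 1 replaces i/L by
     the grid point i/L - L. *)
  rewrite /zrot -cexpMn -[LHS]mulr1 -[X in _ * X](cexp_2pii_subn (j * L) (h * L)) -cexpD.
  congr cexp; rewrite !natrM -mulrBl -mE /grid !RealM RealB !RealM RealV !Realn.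
  by field.
by rewrite [RHS]mulrCA -gs_modulation // [RHS]mulrA.
Qed.

Lemma zrot_neq1 (L r : nat) : (0 < r < L)%N -> zrot r%:R L != 1.
Proof.
move=> /andP[r0 rL]; apply/eqP; rewrite /zrot cexpN => /(congr1 GRing.inv).
rewrite invrK invr1 => /cexp_2pii_eq1 h.
have l0 : 0 < (L%:R : R) by rewrite ltr0n (ltn_trans r0).
have h2 : r%:R / L%:R = 0 :> R.
  by apply: h; rewrite ger0_norm ?divr_ge0 // ltr_pdivrMr // mul1r ltr_nat.
have : 0 < r%:R / L%:R :> R by rewrite divr_gt0 // ltr0n.
by rewrite h2 ltxx.
Qed.

Lemma zrot_sum (h i L : nat) : (0 < L)%N ->
  \sum_(0 <= j < L) zrot (j%:R - h%:R) L ^+ i = if (L %| i)%N then L%:R else 0.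
Proof.
move=> L0.
have lne : (L%:R : R[i]) != 0 by rewrite pnatr_eq0 -lt0n.
have lne' : (L%:R : R) != 0 by rewrite pnatr_eq0 -lt0n.
have zE j : zrot (j%:R - h%:R) L ^+ i = zrot (- h%:R) L ^+ i * zrot i%:R L ^+ j.
  rewrite /zrot -!cexpMn -cexpD; congr cexp.
  by rewrite !RealM RealD RealN !RealV !Realn; field.
rewrite (eq_bigr (fun j => zrot (- h%:R) L ^+ i * zrot i%:R L ^+ j)); last by [].
rewrite -mulr_sumr.
have zmod : zrot i%:R L = zrot (i %% L)%:R L.
  have e : i%:R / L%:R = (i %/ L)%:R + (i %% L)%:R / L%:R :> R.
    by rewrite {1}(divn_eq i L) natrD natrM mulrDl mulfK.
  rewrite {1}/zrot e mulrDr RealD mulrDr opprD cexpD cexpN cexp_2pii_nat.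
  by rewrite invr1 mul1r.
have [dL|ndL] := boolP (L %| i)%N.
  have z1 : zrot i%:R L = 1.
    by rewrite zmod (eqP dL) /zrot mul0r mulr0 mulr0 oppr0 cexp0.
  have z2 : zrot (- h%:R) L ^+ i = 1.
    rewrite /zrot -cexpMn (_ : _ * _ = 'i%C * (2 * pi * (h * (i %/ L))%:R : R)%:C).
      exact: cexp_2pii_nat.
    rewrite -{1}(divnK dL) !natrM !RealM RealN RealV !Realn.
    by field.
  rewrite z1 z2 mul1r (eq_bigr (fun=> 1)); last by move=> j _; rewrite expr1n.
  by rewrite big_const_nat iter_addr_0 subn0.
have zn : zrot i%:R L != 1.
  by rewrite zmod zrot_neq1 // ltn_mod L0 lt0n ndL.
have zL : zrot i%:R L ^+ L = 1.
  rewrite /zrot -cexpMn (_ : L%:R * _ = - ('i%C * (2 * pi * i%:R : R)%:C)).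
    by rewrite cexpN cexp_2pii_nat invr1.
  by rewrite !RealM RealV !Realn; field.
have := subrX1 (zrot i%:R L) L; rewrite zL subrr => /esym/eqP.
rewrite mulf_eq0 subr_eq0 (negbTE zn) /= => /eqP s0.
by rewrite big_mkord s0 mulr0.
Qed.

(** Orthogonality of the L-th roots of unity keeps the indices divisible by L, that is the grid
    points that are integers: an exact finite Poisson formula, in which only the limit in L is left
    to take. *)
Lemma fsum_sum V w (h L : nat) : (0 < L)%N ->
  \sum_(0 <= j < L) fsum V w (j%:R - h%:R) L =
  \sum_(0 <= k < 2 * L) V * gs (V * (k%:R - L%:R)%:C + w).
Proof.
move=> L0.
have lne : (L%:R : R[i]) != 0 by rewrite pnatr_eq0 -lt0n.
have lne' : (L%:R : R) != 0 by rewrite pnatr_eq0 -lt0n.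
rewrite /fsum -[LHS]mulr_sumr exchange_big /=.
under eq_bigr => i _ do rewrite -mulr_sumr zrot_sum //.
rewrite (_ : 2 * L ^ 2 = 2 * L * L)%N; last by rewrite -mulnn mulnA.
rewrite sum_mul_block mulr_sumr; apply: eq_bigr => k _.
rewrite big_ltn // addn0 dvdn_mull // big_nat big1 ?addr0; last first.
  move=> r /andP[r0 rL]; rewrite dvdn_addr ?dvdn_mull //.
  by rewrite gtnNdvd // mulr0.
by rewrite mulrC mulfK // /grid natrM mulfK.
Qed.

(** With t = pi m / L the right side is 2 |sin t|, and |t| <= pi/2 allows [sin_ge_half]; then pi >=
    2. *)
Lemma cmod_1zrot m (L : nat) : (0 < L)%N -> `|m| <= L%:R / 2 ->
  2 * `|m| / L%:R <= cmod (1 - zrot m L).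
Proof.
move=> L0 hm; have l0 : 0 < (L%:R : R) by rewrite ltr0n.
have p0 := pi_gt0 R; have p2 := pi_ge2 R.
set t := pi * (m / L%:R) : R.
have -> : zrot m L = cexp (0 +i* (- (t *+ 2))).
  by rewrite /zrot (imE (- (t *+ 2))) RealN mulrN; congr (cexp (- ('i%C * _%:C)));
     rewrite /t -mulr_natl; ring.
have -> : cmod (1 - cexp (0 +i* (- (t *+ 2)))) = 2 * `|sin t|.
  have -> : 1 - cexp (0 +i* (- (t *+ 2))) = (1 - cos (t *+ 2)) +i* sin (t *+ 2).
    by rewrite /cexp /= expR0 mul1r cosN sinN; simpc.
  rewrite /cmod /=.
  have -> : (1 - cos (t *+ 2)) ^+ 2 + sin (t *+ 2) ^+ 2 = (2 * sin t) ^+ 2.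
    rewrite cos_mulr2n sin_mulr2n !mulr2n.
    transitivity ((1 - (cos t ^+ 2 + cos t ^+ 2 - 1)) ^+ 2 + 4 * cos t ^+ 2 * sin t ^+ 2).
      by ring.
    by rewrite cos2sin2; ring.
  by rewrite sqrtr_sqr normrM ger0_norm.
have st : `|t| / 2 <= `|sin t|.
  have hs y : `|sin y| = `|sin `|y| | :> R.
    have [y0|y0] := leP 0 y; first by rewrite (ger0_norm y0).
    by rewrite (ltr0_norm y0) sinN normrN.
  rewrite hs; apply: le_trans (ler_norm _); apply: sin_ge_half.
  rewrite normr_ge0 /= /t normrM (gtr0_norm p0) (ler_wpM2l (ltW p0)) //.
  by rewrite normrM normfV (gtr0_norm l0) ler_pdivrMr // mulrC.
have : 2 * (`|m| / L%:R) <= pi * (`|m| / L%:R).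
  by rewrite ler_wpM2r // divr_ge0 // ltW.
by move: st; rewrite /t !normrM normfV (gtr0_norm l0) (gtr0_norm p0); lra.
Qed.

Lemma fsum_bound V w : cone V -> exists2 C : R, 0 <= C &
  forall L m, (0 < L)%N -> `|m| <= L%:R / 2 -> cmod (fsum V w m L) * m ^+ 2 <= C.
Proof.
move=> /(hsum_fourier_bound w)[C C0 hC]; exists C => // L m L0 hm.
have l0 : 0 < (L%:R : R) by rewrite ltr0n.
have z1 : cmod (zrot m L) = 1 by rewrite /zrot cexpN cmodV cmod_cexp_imag invr1.
have := hC L _ L0 z1; rewrite -/(fsum V w m L).
have := cmod_1zrot L0 hm; set k := cmod (1 - _); set f := cmod _ => h1.
have f0 : 0 <= f by apply: cmod_ge0.
have h2 : (2 * `|m| / L%:R) ^+ 2 <= k ^+ 2.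
  by rewrite lerXn2r ?nnegrE ?cmod_ge0 // divr_ge0 ?mulr_ge0 // ltW.
move=> h3; have h4 := le_trans (ler_wpM2r f0 h2) h3.
have l2 : 0 < (L%:R : R) ^+ 2 by rewrite exprn_gt0.
move: h4; rewrite expr_div_n mulrAC ler_pM2r ?invr_gt0 // exprMn (real_normK (num_real m)).
have : 0 <= f * m ^+ 2 by rewrite mulr_ge0 // sqr_ge0.
by lra.
Qed.

Lemma coneV V : cone V -> cone V^-1.
Proof.
case: V => a b; rewrite /cone /= => h.
have a0 : 0 < a by apply: le_lt_trans h.
have n0 : 0 < a ^+ 2 + b ^+ 2 by rewrite ltr_pwDl ?exprn_gt0 // sqr_ge0.
by rewrite normrN normrM normfV (gtr0_norm n0) ltr_pM2r ?invr_gt0.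
Qed.

Lemma cone_neq0 V : cone V -> V != 0.
Proof.
by move=> h; apply/eqP => V0; move: h; rewrite V0 /cone /= normr0 ltxx.
Qed.

(** Up to a constant, [gE V w m] is itself a Gaussian at m/V - i w, along a line of direction 1/V,
    and the sector is stable under inversion. *)
Lemma gE_decay V w : cone V -> exists2 C : R, 0 <= C &
  forall m, cmod (gE V w m) <= C * expR (- `|m|).
Proof.
move=> cV; have V0 := cone_neq0 cV; have cV' := coneV cV.
have [C C0 hC] := seg_estimates (- 'i%C * w) (- 'i%C * w) cV' cV'.
have s01 : 0 <= (0 : R) <= 1 by rewrite lexx ler01.
exists (cmod V * cmod (cexp (- (pi : R)%:C * w ^+ 2)) * C).
  by rewrite !mulr_ge0 ?cmod_ge0.
move=> m; have [_ _ _ + _] := hC 0 0 m s01 s01.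
rewrite /segV /segw !mul0r !addr0 => h.
have -> : gE V w m = V * cexp (- (pi : R)%:C * w ^+ 2) * (V^-1 * gs (V^-1 * m%:C + - 'i%C * w)).
  have -> : V^-1 * m%:C + - 'i%C * w = m%:C / V - 'i%C * w by rewrite mulNr mulrC.
  rewrite /gE /gs mulrACA mulfV // mul1r -cexpD; congr cexp.
  apply/eqP; rewrite -subr_eq0; apply/eqP.
  rewrite (_ : _ - _ = (pi : R)%:C * w ^+ 2 * ('i%C * 'i%C + 1)).
    by rewrite ii addNr mulr0.
  by field.
rewrite 2!cmodM -!mulrA ler_wpM2l ?cmod_ge0 // ler_wpM2l ?cmod_ge0 //.
Qed.

(** Dominated convergence for sums whose length grows with the index; the tail telescopes through
    1/(k + 1)^2 <= 1/k - 1/(k + 1). *)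
Lemma tannery (d : nat -> nat -> R) (C : R) : 0 <= C ->
  (forall h k, 0 <= d h k) -> (forall k, small (fun h => d h k)) ->
  (forall h k, (k < h)%N -> d h k <= C / k.+1%:R ^+ 2) ->
  small (fun h => \sum_(0 <= k < h) d h k).
Proof.
move=> C0 d0 ds dC e e0; have e2 : 0 < e / 2 by lra.
have [M1 hM1] := smallZ C0 (@small_inv R) e2.
have {hM1} := hM1 M1 (leqnn _); set M := M1.+1 => hM.
have M0 : 0 < (M%:R : R) by rewrite ltr0n.
have tail h n : (M <= n)%N -> (n <= h)%N ->
    \sum_(M <= k < n) d h k <= C * (M%:R^-1 - n%:R^-1).
  move=> Mn nh; rewrite -(subnKC Mn) in nh *.
  elim: (n - M)%N nh => [|p IH] nh; first by rewrite addn0 big_geq // subrr mulr0.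
  rewrite addnS big_nat_recr ?leq_addr //=.
  have a0 : 0 < ((M + p)%:R : R) by rewrite ltr0n.
  have := IH (ltnW (_ : (M + p < h)%N)); rewrite -addnS => /(_ nh) h1.
  have := dC h (M + p)%N; rewrite -addnS => /(_ nh) h2.
  apply: le_trans (lerD h1 h2) _.
  rewrite -mulrDr ler_wpM2l // addnS -natr1.
  set a := (M + p)%:R in a0 *; rewrite -subr_ge0.
  rewrite (_ : _ - _ = (a * (a + 1) ^+ 2)^-1).
    by rewrite invr_ge0 mulr_ge0 ?sqr_ge0 // ltW.
  by field; rewrite !lt0r_neq0 //; lra.
have sM : small (fun h => \sum_(0 <= k < M) d h k).
  elim: M {hM tail M0} => [|p IH]; first by apply: small_le (@small0 R) => h; rewrite big_geq.
  by apply: small_le (smallD IH (ds p)) => h; rewrite big_nat_recr.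
have [K hK] := sM _ e2; exists (maxn K M) => h; rewrite geq_max => /andP[/hK h1 Mh].
rewrite (big_cat_nat (leq0n M) Mh) /=.
have := tail h h Mh (leqnn _).
have h0 : 0 <= (h%:R^-1 : R) by rewrite invr_ge0.
have : C * (M%:R^-1 - h%:R^-1) <= C * M%:R^-1 by rewrite ler_wpM2l // gerBl.
by lra.
Qed.

End Poisson.

(** * The theta series of eta and its transformation under tau -> -1/tau *)

Section EtaInversion.
Variable R : realType.
Implicit Types (u w V z tau : R[i]) (x c b m : R).

Lemma cone1 : cone (1 : R[i]).
Proof. by rewrite /cone /= normr0. Qed.

Lemma sqr_exp_decay (y : R) : 0 <= y -> (1 + y) ^+ 2 * expR (- y) <= 4.
Proof.
move=> y0; have h := expR_ge1Dx (y / 2).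
have e : expR y = expR (y / 2) ^+ 2 by rewrite -expRM_natl; congr expR; field.
rewrite expRN ler_pdivrMr ?expR_gt0 // e.
have : (1 + y / 2) ^+ 2 <= expR (y / 2) ^+ 2 by rewrite lerXn2r ?nnegrE ?expR_ge0 //; lra.
by rewrite !expr2; nra.
Qed.

(** With L = 2h the frequencies j - h satisfy |m| <= L/2, the range of [fsum_bound]. Each Fourier
    sum is [gE] times a Riemann sum on a shifted line, which deformation compares with [hsum 1 0];
    the errors are then added up by [tannery]. *)
Lemma poisson_summation V w : cone V ->
  small (fun h => cmod (\sum_(0 <= k < 2 * (2 * h)) V * gs (V * (k%:R - (2 * h)%:R)%:C + w)
    - hsum 1 0 (2 * h) * \sum_(0 <= j < 2 * h) gE V w (j%:R - h%:R))).
Proof.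
move=> cV; have V0 := cone_neq0 cV.
have [C1 C10 h1] := fsum_bound w cV.
have [C2 C20 h2] := hsum_bounded w cV.
have [C3 C30 h3] := gE_decay w cV.
have [C4 C40 h4] := hsum_bounded 0 cone1.
(* At h = 0 the grid is empty, and the value 0 keeps the bounds below valid there. *)
pose D h m := if (0 < h)%N then cmod (fsum V w m (2 * h) - hsum 1 0 (2 * h) * gE V w m) else 0.
have D0 h m : 0 <= D h m by rewrite /D; case: ifP => // _; exact: cmod_ge0.
set C := C3 * C2 + 4 * C1 + 4 * C4 * C3.
have C0 : 0 <= C by rewrite !addr_ge0 ?mulr_ge0.
have L0 h : (0 < h)%N -> (0 < 2 * h)%N by move=> h0; rewrite muln_gt0.
have intm h : (exists j k : nat, h%:R = j%:R - k%:R :> R).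
  by exists h, 0%N; rewrite subr0.
have intmN h : (exists j k : nat, - h%:R = j%:R - k%:R :> R).
  by exists 0%N, h; rewrite sub0r.
(* At m = 0 the bound of [fsum_bound] is void and [gE_decay] with [hsum_bounded] takes its place;
   the integers used below satisfy one of the two cases. *)
have bnd h m : m = 0 \/ 1 <= `|m| -> `|m| <= h%:R -> D h m * (1 + `|m|) ^+ 2 <= C.
  rewrite /D; case: ifP => [h0|_ _ _]; last by rewrite mul0r.
  move=> m01 mh; have m0 := normr_ge0 m.
  have mh2 : `|m| <= (2 * h)%:R / 2 by rewrite natrM mulrC mulKf.
  have sq0 : 0 <= (1 + `|m|) ^+ 2 by apply: sqr_ge0.
  have g3 := h3 m; have g4 := h4 _ (L0 _ h0).
  have e1 : cmod (fsum V w m (2 * h)) * (1 + `|m|) ^+ 2 <= C3 * C2 + 4 * C1.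
    have p1 : 0 <= C3 * C2 by rewrite mulr_ge0.
    case: m01 => [m_0|m1].
      rewrite m_0 normr0 addr0 expr1n mulr1 fsumE ?L0 //; last exact: (intm 0%N).
      rewrite mulr0 mul0r addr0 cmodM.
      have := h3 0; rewrite normr0 oppr0 expR0 mulr1 => g30.
      have := ler_pM (cmod_ge0 _) (cmod_ge0 _) g30 (h2 _ (L0 _ h0)); lra.
    have := h1 _ _ (L0 _ h0) mh2; rewrite -(real_normK (num_real m)).
    have : (1 + `|m|) ^+ 2 <= 4 * `|m| ^+ 2 by rewrite !expr2; nra.
    move=> /(ler_wpM2l (cmod_ge0 (fsum V w m (2 * h)))); lra.
  have e2 : cmod (hsum 1 0 (2 * h) * gE V w m) * (1 + `|m|) ^+ 2 <= 4 * C4 * C3.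
    have hm := sqr_exp_decay m0.
    rewrite cmodM; have := ler_pM (cmod_ge0 _) (cmod_ge0 _) g4 g3.
    move=> /(ler_wpM2r sq0) g; apply: (le_trans g).
    have := ler_wpM2l (mulr_ge0 C40 C30) hm; lra.
  have := ler_wpM2r sq0 (cmodD (fsum V w m (2 * h)) (- (hsum 1 0 (2 * h) * gE V w m))).
  rewrite cmodN mulrDl /C; lra.
have ptw m : (exists j k : nat, m = j%:R - k%:R) -> small (fun h => D h m).
  move=> mi; have [B B0 hB] := hsum_deform 0 (w + 'i%C * m%:C / V) cone1 cV.
  have E0 : 0 <= cmod (gE V w m) * B by rewrite mulr_ge0 ?cmod_ge0.
  apply: small_le (smallZ E0 (@small_inv R)) => h; rewrite /D.
  case: ifP => [h0|_]; last by rewrite mulr_ge0 ?invr_ge0.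
  rewrite fsumE ?L0 // [hsum 1 0 _ * _]mulrC -mulrBr cmodM -[leRHS]mulrA.
  rewrite ler_wpM2l ?cmod_ge0 //; apply: le_trans (hB _ (L0 _ h0)) _.
  rewrite ler_wpM2l // lef_pV2 ?posrE ?ltr0n ?L0 // ler_nat mul2n -addnn.
  by rewrite -[h.+1]addn1 leq_add2l.
have t1 : small (fun h => \sum_(0 <= k < h) D h k%:R).
  apply: (tannery C0) => // [k|h k kh]; first exact: ptw.
  rewrite ler_pdivlMr ?exprn_gt0 ?ltr0n //.
  have := bnd h k%:R; rewrite ger0_norm // ler_nat ler1n -natr1 addrC; apply; last exact: ltnW.
  by case: k kh => [|k] _; [left|right].
have t2 : small (fun h => \sum_(0 <= k < h) D h (- k.+1%:R)).
  apply: (tannery C0) => // [k|h k kh]; first exact: ptw.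
  rewrite ler_pdivlMr ?exprn_gt0 ?ltr0n //.
  have := bnd h (- k.+1%:R); rewrite normrN ger0_norm // ler_nat ler1n => H.
  apply: le_trans (H _ kh); last by right.
  by rewrite ler_wpM2l // lerXn2r ?nnegrE // lerDr.
apply: small_le (smallD t1 t2) => h.
rewrite -(sum_window (D h)) /D.
case: h => [|h]; first by rewrite !muln0 !big_geq // mulr0 subrr cmod0.
rewrite -(@fsum_sum _ V w h.+1) ?L0 // mulr_sumr -sumrB.
exact: cmod_sum.
Qed.

(** At an integer x this is (-1)^x q^((6x + 1)^2 / 24), a term of Euler's series for eta; real
    arguments let it be matched with a Gaussian. *)
Definition theta tau x : R[i] :=
  cexp ('i%C * (pi : R)%:C * x%:C) *
  cexp ('i%C * (pi : R)%:C * tau * ((6 * x + 1) ^+ 2 / 12)%:C).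

Lemma cexp_pii_nat n : cexp ('i%C * (pi : R)%:C * (n%:R : R)%:C) = (-1) ^+ n.
Proof. by rewrite mulrC Realn cexpMn cexp_pii. Qed.

Lemma cexp_pii_natN n : cexp ('i%C * (pi : R)%:C * (- n%:R : R)%:C) = (-1) ^+ n.
Proof.
by rewrite RealN mulrN cexpN cexp_pii_nat -signr_odd; case: odd;
  rewrite ?expr0 ?expr1 ?invr1 ?invrN1.
Qed.

Lemma theta_nat tau n :
  theta tau n%:R = qpow tau (24%:R^-1) * ((-1) ^+ n * qpow tau 1 ^+ (n ^ 2 + 'C(n.+1, 2))).
Proof.
rewrite /theta cexp_pii_nat [RHS]mulrCA; congr (_ * _).
rewrite qpowX qpowM qpowE; congr cexp.
have h : 2 * ('C(n.+1, 2))%:R = n%:R * (n%:R + 1) :> R.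
  by rewrite -natrM mulnC -[2%N]/(2`!) bin_ffact ffactnS ffactn1 /= natrM natr1 mulrC.
have h2 : ('C(n.+1, 2))%:R = n%:R * (n%:R + 1) / 2 :> R by rewrite -h mulrC mulKf.
set Y := _ + _ : R; have -> : (6 * n%:R + 1) ^+ 2 / 12 = 2 * Y :> R.
  by rewrite /Y natrD natrX h2; field.
by rewrite !RealM; ring.
Qed.

Lemma theta_natN tau n :
  theta tau (- n%:R) = qpow tau (24%:R^-1) * ((-1) ^+ n * qpow tau 1 ^+ (n ^ 2 + 'C(n, 2))).
Proof.
rewrite /theta cexp_pii_natN [RHS]mulrCA; congr (_ * _).
rewrite qpowX qpowM qpowE; congr cexp.
have h : 2 * ('C(n, 2))%:R = n%:R * (n%:R - 1) :> R.
  case: n => [|n]; first by rewrite mul0r mulr0.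
  by rewrite -natrM mulnC -[2%N]/(2`!) bin_ffact ffactnS ffactn1 /= natrM -natr1 addrK.
have h2 : ('C(n, 2))%:R = n%:R * (n%:R - 1) / 2 :> R by rewrite -h mulrC mulKf.
set Y := _ + _ : R; have -> : (6 * (- n%:R) + 1) ^+ 2 / 12 = 2 * Y :> R.
  by rewrite /Y natrD natrX h2; field.
by rewrite !RealM; ring.
Qed.

(** In Shanks' identity the term s = 0 is Euler's partial product. The term s >= 1 has exponent at
    least n + s - 1 and a bounded product in front, so the others add up to O(r^n). *)
Lemma shanks_tends (q : R[i]) : cmod q < 1 ->
  ctends (fun n => 1 + \sum_(1 <= s < n.+1) pent q s) (euler_phi q).
Proof.
move=> q1; set r := cmod q; have r0 : 0 <= r by apply: cmod_ge0.
have r01 : 0 <= r < 1 by rewrite r0.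
set B := expR (1 - r)^-1.
have bP (s n : nat) : cmod (shanks_prod q s n) <= B.
  rewrite /shanks_prod cmod_prod.
  have r0i i : 0 <= r ^+ i by apply: exprn_ge0.
  have /andP[_ hp] := prod_exp_le s.+1 n.+1 r0i.
  apply: (@le_trans _ _ (\prod_(s.+1 <= i < n.+1) (1 + r ^+ i))).
    apply: ler_prod => i _; rewrite cmod_ge0 /=; apply: le_trans (cmodD _ _) _.
    by rewrite cmod1 cmodN cmodX.
  apply: (le_trans hp); rewrite ler_expR; apply: le_trans (sum_geo_le n.+1 r01).
  have [sn|ns] := leqP s.+1 n.+1; last first.
    by rewrite big_geq ?(ltnW ns) // sumr_ge0.
  by rewrite (big_cat_nat (leq0n s.+1) sn) /= lerDr sumr_ge0.
have sm : small (fun n => B * (1 - r)^-1 * r ^+ n).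
  have c0 : 0 <= B * (1 - r)^-1 by rewrite mulr_ge0 ?expR_ge0 // invr_ge0; case/andP: r01; lra.
  exact: smallZ c0 (small_geo r01).
apply: ctends_near (euler_phi_tends q1) _ sm => n.
rewrite -shanks (big_ltn (ltn0Sn n)) {1}/shanks_term expr0 !mul1r mul0n.
have -> : 'C(1, 2) = 0%N by [].
rewrite expr0 mulr1 {1}/shanks_prod addrAC subrr add0r.
apply: le_trans (cmod_sum _ _ _) _.
apply: (@le_trans _ _ (\sum_(1 <= i < n.+1) B * r ^+ n * r ^+ i.-1)).
  rewrite !big_nat; apply: ler_sum => i /andP[i0 _].
  rewrite /shanks_term !cmodM !cmodX cmodN cmod1 expr1n mul1r -/r -mulrA.
  apply: ler_pM; rewrite ?cmod_ge0 ?exprn_ge0 //.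
  case: i i0 => // i _; rewrite -exprD ler_wiXn2l // ?(ltW q1) //.
  rewrite mulSn binS bin1 [i.+1.-1]/=.
  have : (i <= i * n + ('C(i.+1, 2) + i.+1))%N by rewrite addnA (leq_trans (leqnSn i)) ?leq_addl.
  by rewrite -(leq_add2l n) addnA.
rewrite -mulr_sumr big_add1 /= [leRHS]mulrAC.
by rewrite ler_wpM2l ?sum_geo_le // mulr_ge0 ?expR_ge0 // exprn_ge0.
Qed.

Lemma theta_pair tau n : theta tau n%:R + theta tau (- n%:R) =
  qpow tau (24%:R^-1) * pent (qpow tau 1) n.
Proof. by rewrite theta_nat theta_natN -mulrDr -mulrDr [X in _ * (_ * X)]addrC. Qed.

Lemma theta_small tau : 0 < complex.Im tau ->
  small (fun n => cmod (theta tau n%:R)) /\ small (fun n => cmod (theta tau (- n%:R))).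
Proof.
move=> t0; have q1 := cmod_qpow_lt1 t0 (@ltr01 R).
have q01 : 0 <= cmod (qpow tau 1) < 1 by rewrite cmod_ge0.
have sm := smallZ (cmod_ge0 (qpow tau (24%:R^-1))) (small_geo q01).
have n2 n : (n <= n ^ 2)%N by case: n => // n; rewrite -mulnn leq_pmull.
split; apply: small_le sm => n; rewrite ?theta_nat ?theta_natN cmodM
  [cmod (_ ^+ _ * _)]cmodM !cmodX cmodN cmod1;
  rewrite expr1n mul1r ler_wpM2l ?cmod_ge0 // ler_wiXn2l ?cmod_ge0 ?(ltW q1) //;
  exact: leq_trans (n2 n) (leq_addr _ _).
Qed.

Lemma theta_window tau : 0 < complex.Im tau ->
  ctends (fun n => \sum_(0 <= k < 2 * n) theta tau (k%:R - n%:R)) (eta tau).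
Proof.
move=> t0; have q1 := cmod_qpow_lt1 t0 (@ltr01 R).
have [sm _] := theta_small t0.
(* The half-open window -n <= x < n lacks the term x = n of the symmetric partial sum, and that term
   tends to 0. *)
rewrite etaE; apply: ctends_near (ctendsZ _ (shanks_tends q1)) _ sm => n.
rewrite sum_window mulrDr mulr1 mulr_sumr.
have -> : \sum_(1 <= i < n.+1) qpow tau 24^-1 * pent (qpow tau 1) i =
    \sum_(1 <= i < n.+1) (theta tau i%:R + theta tau (- i%:R)).
  by apply: eq_bigr => i _; rewrite theta_pair.
rewrite big_split /= [X in _ + (_ + X)]big_add1 /=.
have -> : qpow tau 24^-1 = theta tau 0%:R.
  by rewrite theta_nat !expr0 !mulr1.
have e : theta tau 0%:R + \sum_(1 <= i < n.+1) theta tau i%:R =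
  \sum_(0 <= i < n) theta tau i%:R + theta tau n%:R.
  by rewrite -big_nat_recr // big_ltn.
rewrite [X in cmod (_ - X)]addrA e opprD opprD -!addrA.
by rewrite (_ : _ + _ = - theta tau n%:R) ?cmodN //; ring.
Qed.

Lemma theta_window_opp tau : 0 < complex.Im tau ->
  ctends (fun n => \sum_(0 <= k < 2 * n) theta tau (- (k%:R - n%:R))) (eta tau).
Proof.
move=> t0; have [s1 s2] := theta_small t0.
apply: ctends_near (theta_window t0) _ (smallD s1 s2) => n.
have -> : \sum_(0 <= k < 2 * n) theta tau (- (k%:R - n%:R)) =
    \sum_(0 <= k < n) theta tau (- k%:R) + \sum_(0 <= k < n) theta tau k.+1%:R.
  rewrite (sum_window (fun x => theta tau (- x))); congr (_ + _).
  by apply: eq_bigr => k _; rewrite opprK.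
rewrite sum_window.
have e1 : \sum_(0 <= k < n) theta tau (- k%:R) + theta tau (- n%:R) =
  theta tau 0 + \sum_(0 <= k < n) theta tau (- k.+1%:R).
  by rewrite -big_nat_recr // big_ltn // big_add1 oppr0.
have e2 : \sum_(0 <= k < n) theta tau k%:R + theta tau n%:R =
  theta tau 0 + \sum_(0 <= k < n) theta tau k.+1%:R.
  by rewrite -big_nat_recr // big_ltn // big_add1.
rewrite (_ : _ - _ = theta tau n%:R - theta tau (- n%:R)).
  by apply: le_trans (cmodD _ _) _; rewrite cmodN.
move: e1 e2 => /(canRL (addrK _)) -> /(canRL (addrK _)) ->; ring.
Qed.

(** The Fourier side of [theta], at z = -1/tau and up to a constant. The odd number 2m - 1 is 6k -
    1, 6k + 1 or 6k + 3 according to m mod 3. *)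
Definition rho z m : R[i] :=
  cexp ('i%C * (pi : R)%:C * (m / 3)%:C) *
  cexp ('i%C * (pi : R)%:C * z * ((2 * m - 1) ^+ 2 / 12)%:C).

Let e3 : R[i] := cexp ('i%C * (pi : R)%:C / 3).

(** The classes m = 3k and m = 3k + 1 give [theta] at -k and, with phase [e3], at k. For m = 3k + 2
    the indices k and -k - 1 cancel: they share (6k + 3)^2 and have opposite signs. The window is a
    multiple of 3 to hold complete classes. *)
Lemma rho_window z : 0 < complex.Im z ->
  ctends (fun l => \sum_(0 <= j < 2 * (3 * l)) rho z (j%:R - (3 * l)%:R)) ((1 + e3) * eta z).
Proof.
move=> z0; have w1 := theta_window_opp z0; have w2 := ctendsZ e3 (theta_window z0).
rewrite mulrDl mul1r; apply: ctends_ext (ctendsD w1 w2) => l.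
rewrite (_ : 2 * (3 * l) = 2 * l * 3)%N; last by rewrite mulnCA mulnC.
rewrite [RHS]sum_mul_block.
pose G x := cexp ('i%C * (pi : R)%:C * x%:C) *
  cexp ('i%C * (pi : R)%:C * z * ((6 * x + 3) ^+ 2 / 12)%:C).
have G0 : \sum_(0 <= k < 2 * l) G (k%:R - l%:R) = 0.
  rewrite sum_window -big_split /= big1 // => k _.
  rewrite /G (_ : 6 * - k.+1%:R + 3 = - (6 * k%:R + 3) :> R); last by rewrite -natr1; ring.
  rewrite sqrrN -mulrDl cexp_pii_natN cexp_pii_nat exprS mulN1r subrr.
  by rewrite mul0r.
transitivity (\sum_(0 <= k < 2 * l) theta z (- (k%:R - l%:R)) +
  e3 * (\sum_(0 <= k < 2 * l) theta z (k%:R - l%:R)) +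
  cexp ('i%C * (pi : R)%:C * (2 / 3 : R)%:C) * \sum_(0 <= k < 2 * l) G (k%:R - l%:R)).
  by rewrite G0 mulr0 addr0.
rewrite !mulr_sumr -!big_split /=; apply: eq_bigr => k _.
rewrite !big_nat_recl // big_geq // addr0 addrA; congr (_ + _ + _).
- rewrite /rho /theta; congr (_ * _); last first.
    by congr (cexp (_ * _%:C)); rewrite addn0 !natrM; field.
  rewrite (_ : ((k * 3 + 0)%N%:R - (3 * l)%:R) / 3 = k%:R - l%:R :> R); last first.
    by rewrite addn0 !natrM; field.
  set x := k%:R - l%:R.
  apply: (mulfI (cexp_neq0 ('i%C * (pi : R)%:C * x%:C))); rewrite -!cexpD.
  rewrite RealN mulrN subrr cexp0.
  by rewrite -(cexp_2pii_subn R k l) -/x; congr cexp; rewrite !RealM Realn; ring.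
- rewrite /rho /theta /e3 mulrA -cexpD; congr (cexp _ * cexp (_ * _%:C)).
    set x := k%:R - l%:R.
    rewrite (_ : ((k * 3 + 1)%N%:R - (3 * l)%:R) / 3 = x + 3^-1 :> R); last first.
      by rewrite /x natrD !natrM; field.
    by rewrite (RealD x) RealV Realn; ring.
  by rewrite natrD !natrM; field.
rewrite /rho /G mulrA -cexpD; congr (cexp _ * cexp (_ * _%:C)).
  set x := k%:R - l%:R.
  rewrite (_ : ((k * 3 + 2)%N%:R - (3 * l)%:R) / 3 = 2 / 3 + x :> R); last first.
    by rewrite /x natrD !natrM; field.
  by rewrite (RealD (2 / 3)); ring.
by rewrite natrD !natrM; field.
Qed.

Lemma cone_sqrtc z : 0 < complex.Re z -> cone (sqrtc z).
Proof.
move=> z0; have := sqr_sqrtc z.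
have r0 : 0 <= complex.Re (sqrtc z) by case: z {z0} => a b /=; rewrite sqrtr_ge0.
move: (sqrtc z) r0 => u r0 uE; rewrite /cone.
have : complex.Re z = complex.Re u ^+ 2 - complex.Im u ^+ 2 by rewrite -uE ReM !expr2.
move=> e; have h : `|complex.Im u| ^+ 2 < complex.Re u ^+ 2.
  by rewrite (real_normK (num_real _)); lra.
rewrite ltNge; apply/negP => hle.
have : complex.Re u ^+ 2 <= `|complex.Im u| ^+ 2 by rewrite lerXn2r ?nnegrE.
lra.
Qed.

Lemma cone_scale (r : R) V : 0 < r -> cone V -> cone (r%:C * V).
Proof.
move=> r0; rewrite /cone ReM ImM /= !mul0r subr0 addr0 => h.
by rewrite normrM (gtr0_norm r0) ltr_pM2l.
Qed.

Let e6 : R[i] := cexp ('i%C * (pi : R)%:C / 6).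

(** Everything in the transformation formula that is independent of tau, the Gaussian Riemann sum
    included; [l.+1] keeps the mesh positive. *)
Definition inv_const (l : nat) : R[i] :=
  hsum 1 0 (2 * (3 * l.+1)) * (1 + e3) / ((Num.sqrt 3 : R)%:C * e6).

Lemma real_sqr12D x : ((6 * x + 1) ^+ 2 / 12)%:C = (6 * x%:C + 1) ^+ 2 / 12 :> R[i].
Proof. by rewrite expr2 RealM RealV Realn RealM (RealD (6 * x)) RealM Realn. Qed.

Lemma real_sqr12B x : ((2 * x - 1) ^+ 2 / 12)%:C = (2 * x%:C - 1) ^+ 2 / 12 :> R[i].
Proof. by rewrite expr2 RealM RealV Realn RealM (RealB (2 * x)) RealM Realn. Qed.

Lemma eta_inversion_const tau : 0 < complex.Im tau ->
  ctends (fun l => inv_const l * eta (- tau^-1)) (sqrtc (- 'i%C * tau) * eta tau).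
Proof.
move=> t0.
have tn0 : tau != 0 by apply/eqP => h; move: t0; rewrite h ltxx.
set z := - tau^-1.
have tz : tau * z = -1 by rewrite /z mulrN mulfV.
have z0 : 0 < complex.Im z.
  rewrite /z; case: (tau) t0 => a b /= b0.
  rewrite ?mulNr opprK divr_gt0 // ltr_wpDl ?sqr_ge0 // exprn_gt0 //.
set s3 : R := Num.sqrt 3; have s30 : 0 < s3 by rewrite sqrtr_gt0.
have s32 : (s3%:C) ^+ 2 = 3 :> R[i].
  by rewrite -rmorphXn /= sqr_sqrtr // (rmorph_nat (real_complex R)).
set u := sqrtc (- 'i%C * tau).
have cu : cone u by apply: cone_sqrtc; rewrite ReM /=; lra.
have u2 : u ^+ 2 = - 'i%C * tau by apply: sqr_sqrtc.
(* Since V^2 = -3 i tau, the term -pi V^2 x^2 is the quadratic part i pi tau (6x)^2 / 12 of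
   [theta]. *)
pose V := s3%:C * u; have cV : cone V by apply: cone_scale.
have V0 := cone_neq0 cV.
have V2 : V ^+ 2 = - 3 * 'i%C * tau by rewrite /V exprMn s32 u2; ring.
(* Because tau z = -1, this shift yields the linear part i pi tau x of [theta] together with the i
   pi x of its sign. *)
pose w := V * (1 - z) / 6.
pose c1 := cexp (- ('i%C * (pi : R)%:C * z / 12)).
have c10 : c1 != 0 by apply: cexp_neq0.
have lhsE x : V * gs (V * x%:C + w) = c1 * (V * e6) * theta tau x.
  suff -> : gs (V * x%:C + w) = c1 * e6 * theta tau x by ring.
  rewrite /gs /e6 /theta /c1 -!cexpD; congr cexp.
  rewrite (_ : V * x%:C + w = V * (x%:C + (1 - z) / 6)); last by rewrite /w; field.
  rewrite exprMn V2 real_sqr12D.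
  apply/eqP; rewrite -subr_eq0; apply/eqP.
  set xx := x%:C; set p := (pi : R)%:C.
  transitivity (('i%C * p / 12) * (tau * z + 1) * (z - 12 * xx - 2)); last first.
    by rewrite tz addNr mulr0 mul0r.
  by field.
have rhsE m : gE V w m = c1 * rho z m.
  rewrite /gE /c1 /rho -!cexpD; congr cexp.
  rewrite (_ : _ * w / V = 2 * (pi : R)%:C * 'i%C * m%:C * ((1 - z) / 6)); last first.
    by rewrite /w; field.
  rewrite V2 real_sqr12B RealM RealV Realn.
  apply/eqP; rewrite -subr_eq0; apply/eqP.
  set mm := m%:C; set p := (pi : R)%:C.
  have in0 : 'i%C != 0 :> R[i] by apply/eqP => -[/eqP]; rewrite oner_eq0.
  transitivity (p * mm ^+ 2 / (3 * 'i%C * tau) * (1 - ('i%C * 'i%C) * (tau * z))); last first.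
    by rewrite ii tz mulrN1 opprK subrr mulr0.
  by field; rewrite tn0 in0.
have p0 := poisson_summation w cV.
(* Multiples of 3, for [rho_window], and positive. *)
pose f l := (3 * l.+1)%N.
have f1 l : (l <= f l)%N by rewrite /f mulnS; lia.
have f2 l : (l <= 2 * f l)%N by apply: (leq_trans (f1 l)); rewrite mul2n -addnn leq_addr.
have {}p0 : small (fun l => cmod (V * e6 * \sum_(0 <= k < 2 * (2 * f l)) theta tau (k%:R - (2 * f l)%:R)
    - hsum 1 0 (2 * f l) * \sum_(0 <= j < 2 * f l) rho z (j%:R - (f l)%:R))).
  have cc : 0 < cmod c1 by rewrite cmod_gt0.
  have ci : 0 <= (cmod c1)^-1 by rewrite invr_ge0 ltW.
  have p1 : small (fun l => (cmod c1)^-1 * cmod (\sum_(0 <= k < 2 * (2 * f l))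
     V * gs (V * (k%:R - (2 * f l)%:R)%:C + w)
    - hsum 1 0 (2 * f l) * \sum_(0 <= j < 2 * f l) gE V w (j%:R - (f l)%:R))).
    apply: smallZ ci _ => e /p0[K hK]; exists K => k Kk; apply: hK.
    exact: leq_trans Kk (f1 k).
  apply: small_le p1 => l.
  set A := \sum_(0 <= k < 2 * (2 * f l)) theta _ _; set B := \sum_(0 <= j < 2 * f l) rho _ _.
  have -> : \sum_(0 <= k < 2 * (2 * f l)) V * gs (V * (k%:R - (2 * f l)%:R)%:C + w) =
      c1 * (V * e6) * A by rewrite mulr_sumr; apply: eq_bigr => k _; rewrite lhsE.
  have -> : \sum_(0 <= j < 2 * f l) gE V w (j%:R - (f l)%:R) = c1 * B.
    by rewrite mulr_sumr; apply: eq_bigr => k _; rewrite rhsE.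
  rewrite (_ : c1 * (V * e6) * A - _ = c1 * (V * e6 * A - hsum 1 0 (2 * f l) * B)); last by ring.
  by rewrite [cmod (c1 * _)]cmodM [leRHS]mulrA mulVf ?mul1r // lt0r_neq0.
have th := ctends_sub f2 (theta_window t0).
have rh := ctends_sub (fun l => leqnSn l) (rho_window z0).
have [B B0 hB] := hsum_bounded 0 cone1.
have lim : ctends (fun l => hsum 1 0 (2 * f l) * ((1 + e3) * eta z)) (V * e6 * eta tau).
  apply: ctends_near (ctendsZ (V * e6) th) _ (smallD p0 (smallZ B0 rh)) => l /=.
  set T := \sum_(0 <= k < 2 * (2 * f l)) _.
  set Q := \sum_(0 <= k < 2 * f l) _.
  set H := hsum _ _ _.
  rewrite (_ : _ - _ = - (V * e6 * T - H * Q) + - (H * (Q - (1 + e3) * eta z))); last by ring.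
  apply: le_trans (cmodD _ _) _; rewrite !cmodN lerD2l cmodM ler_wpM2r ?cmod_ge0 //.
  exact: hB.
have s3n0 : s3%:C != 0 :> R[i] by rewrite -cmod_gt0 cmod_real normr_gt0 lt0r_neq0.
have e60 : e6 != 0 by apply: cexp_neq0.
have := ctendsZ (s3%:C * e6)^-1 lim.
rewrite (_ : _ * (V * e6 * eta tau) = u * eta tau); last first.
  by rewrite /V; field; rewrite s3n0 e60.
apply: ctends_ext => l; rewrite /inv_const -/s3.
by rewrite -/(f l); field; rewrite s3n0 e60.
Qed.

(** At the fixed point i the square root is 1, so the formula says that [inv_const l * eta 'i] tends
    to [eta 'i], which is nonzero. *)
Lemma inv_const_tends : ctends inv_const 1.
Proof.
have i0 : 0 < complex.Im ('i%C : R[i]) by rewrite /= ltr01.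
have := eta_inversion_const i0.
have ei : - ('i%C)^-1 = 'i%C :> R[i].
  apply/eqP; rewrite eqr_oppLR; apply/eqP; apply: (@mulfI _ 'i%C).
    by apply/eqP => -[/eqP]; rewrite oner_eq0.
  by rewrite mulfV ?mulrN ?ii ?opprK //; apply/eqP => -[/eqP]; rewrite oner_eq0.
rewrite ei mulNr ii opprK sqrtc1 mul1r => h.
have := ctendsZ (eta 'i%C)^-1 h; rewrite mulVf ?eta_neq0 //.
by apply: ctends_ext => l; rewrite mulrCA mulVf ?mulr1 ?eta_neq0.
Qed.

Lemma eta_inversion tau : 0 < complex.Im tau ->
  eta (- tau^-1) = sqrtc (- 'i%C * tau) * eta tau.
Proof.
move=> t0; apply: ctends_unique (eta_inversion_const t0).
have := ctendsM inv_const_tends (ctends_cst (eta (- tau^-1))).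
by rewrite mul1r.
Qed.

End EtaInversion.

(** * The multiplier of eta *)

Section Moebius.
Variable R : realType.
Implicit Types tau : R[i].

Lemma im_moebius (a b c d : R) tau : 0 < a * d - b * c -> 0 < complex.Im tau ->
  c%:C * tau + d%:C != 0 /\
  0 < complex.Im ((a%:C * tau + b%:C) / (c%:C * tau + d%:C)).
Proof.
case: tau => x y D y0; rewrite /= in y0.
have E (p q : R) : p%:C * (x +i* y) + q%:C = (p * x + q) +i* (p * y).
  by simpc.
have n0 : 0 < (c * x + d) ^+ 2 + (c * y) ^+ 2.
  have [c0|c0] := eqVneq c 0.
    have d0 : d != 0 by apply/eqP => d0; move: D; rewrite c0 d0; lra.
    by rewrite c0 mul0r add0r ltr_pwDl ?sqr_ge0 // exprn_even_gt0.
  by rewrite ltr_wpDl ?sqr_ge0 // exprn_even_gt0 //= mulf_neq0 // gt_eqF.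
split.
  rewrite E; apply/eqP => -[h1 h2]; move: n0; rewrite h1 h2 expr0n /= addr0; lra.
have -> : complex.Im ((a%:C * (x +i* y) + b%:C) / (c%:C * (x +i* y) + d%:C)) =
    (a * d - b * c) * y / ((c * x + d) ^+ 2 + (c * y) ^+ 2).
  by rewrite !E /=; field; rewrite gt_eqF.
by rewrite divr_gt0 // mulr_gt0.
Qed.

Lemma im_moebius_int (a b c d : int) tau : a * d - b * c = 1 -> 0 < complex.Im tau ->
  c%:~R * tau + d%:~R != 0 /\
  0 < complex.Im ((a%:~R * tau + b%:~R) / (c%:~R * tau + d%:~R)).
Proof.
move=> D t0.
have E (z : int) : z%:~R = (z%:~R : R)%:C by rewrite (rmorph_int (real_complex R)).
rewrite !E; apply: im_moebius => //.
by rewrite -!intrM -intrB D ltr01.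
Qed.

Definition zeta24 (k : int) : R[i] := cexp ('i%C * (2 * pi * (k%:~R / 24) : R)%:C).

Lemma zeta24D k l : zeta24 (k + l) = zeta24 k * zeta24 l.
Proof.
by rewrite /zeta24 -cexpD intrD; congr cexp; rewrite -mulrDr -RealD; congr (_ * _%:C); ring.
Qed.

Lemma zeta24_0 : zeta24 0 = 1.
Proof. by rewrite /zeta24 mul0r mulr0 mulr0 cexp0. Qed.

Lemma zeta24_neq0 k : zeta24 k != 0. Proof. exact: cexp_neq0. Qed.

Lemma cexp_2pii_int (n : int) : cexp ('i%C * (2 * pi * n%:~R : R)%:C) = 1.
Proof.
case: n => n; first exact: cexp_2pii_nat.
by rewrite NegzE mulrN RealN mulrN cexpN cexp_2pii_nat invr1.
Qed.

Lemma zeta24_mod k : (k %% 24)%Z = 0 -> zeta24 k = 1.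
Proof.
move=> h; have -> : k = ((k %/ 24)%Z * 24) by rewrite {1}(divz_eq k 24) h addr0.
by rewrite /zeta24 intrM mulfK // cexp_2pii_int.
Qed.

Lemma eta_translate tau (n : int) : eta (tau + n%:~R) = zeta24 n * eta tau.
Proof.
have nE : (n%:~R : R[i]) = (n%:~R : R)%:C by rewrite (rmorph_int (real_complex R)).
have -> : tau + n%:~R = (1 : R)%:C * tau + (n%:~R : R)%:C by rewrite mul1r nE.
rewrite [LHS]etaE [eta tau]etaE.
rewrite (qpow_affine tau 1 n%:~R 24^-1) (qpow_affine tau 1 n%:~R 1).
rewrite (mul1r (n%:~R : R)) cexp_2pii_int (mul1r (1 : R)) (mul1r (24^-1 : R)) (mul1r (qpow tau 1)).
by rewrite [LHS]/= [RHS]mulrA /zeta24 (mulrC 24^-1 (n%:~R : R)).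
Qed.

(* The branch of the weight one-half automorphy factor, for rows with [c > 0],
   or [c = 0] and [d = 1]. *)
Definition jfac (c d : int) tau : R[i] :=
  if c == 0 then 1 else sqrtc (- 'i%C * (c%:~R * tau + d%:~R)).

Lemma cone_jarg (c d : int) tau : 0 < c -> 0 < complex.Im tau ->
  cone (sqrtc (- 'i%C * (c%:~R * tau + d%:~R))).
Proof.
move=> c0 t0; apply: cone_sqrtc.
rewrite -!(rmorph_int (real_complex R)) /=; case: tau t0 => x y /= y0.
by simpc; rewrite mulr_gt0 // ltr0z.
Qed.

Lemma zeta24_3 : zeta24 3 ^+ 2 = 'i%C /\
  0 < complex.Re (zeta24 3) /\ complex.Im (zeta24 3) = complex.Re (zeta24 3).
Proof.
have h2 : zeta24 3 ^+ 2 = 'i%C.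
  rewrite /zeta24 -cexpMn (_ : _ * _ = 0 +i* (pi / 2)).
    by rewrite /cexp /= expR0 mul1r cos_pihalf sin_pihalf.
  by rewrite (imE (pi / 2)) mulrCA; congr (_ * _); rewrite -(Realn R 2) -RealM; congr _%:C; field.
have r0 : 0 < complex.Re (zeta24 3).
  rewrite /zeta24 -imE /cexp /= expR0 mul1r /= mul0r subr0; apply: cos_gt0_pihalf.
  by have := pi_gt0 R; move=> p0; apply/andP; split; lra.
split=> //; split=> //.
have : complex.Re (zeta24 3 ^+ 2) = 0 by rewrite h2.
have : complex.Im (zeta24 3 ^+ 2) = 1 by rewrite h2.
rewrite expr2 ReM ImM; move: (complex.Re _) (complex.Im _) r0 => x y x0 h3 h4.
have y0 : 0 < y by rewrite -(pmulr_rgt0 y x0); lra.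
have /eqP : (x - y) * (x + y) = 0 by lra.
rewrite mulf_eq0 => /orP[] /eqP; lra.
Qed.

(** The squares agree, so only a sign is in doubt. A product of two numbers in the sector |arg| <
    pi/4 has positive real part, and so has [zeta24 3] = e^(i pi/4) times one such number. *)
Lemma sqrtc_cocycle (z w v : R[i]) : cone (sqrtc z) -> cone (sqrtc w) -> cone (sqrtc v) ->
  z * w = 'i%C * v -> sqrtc z * sqrtc w = zeta24 3 * sqrtc v.
Proof.
have [z2 [r0 ir]] := zeta24_3.
move=> cz cw cv e.
have sq : (sqrtc z * sqrtc w) ^+ 2 = (zeta24 3 * sqrtc v) ^+ 2.
  by rewrite [LHS]exprMn [RHS]exprMn !sqr_sqrtc z2.
move/eqP: sq; rewrite eqf_sqr => /orP[/eqP //|/eqP h]; exfalso.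
have p1 : 0 < complex.Re (sqrtc z * sqrtc w).
  rewrite ReM; move: cz cw; rewrite /cone !ltr_norml.
  move: (complex.Re _) (complex.Im _) (complex.Re _) (complex.Im _).
  by move=> a b c d /andP[h1 h2] /andP[h3 h4]; nra.
have p2 : 0 < complex.Re (zeta24 3 * sqrtc v).
  rewrite ReM ir -mulrBr mulr_gt0 // subr_gt0.
  by move: cv; rewrite /cone ltr_norml => /andP[].
by move: p1; rewrite h ReN; lra.
Qed.

(** Euclid on the first column: as Moebius maps g = T^k S g', where g' has bottom row (a', b') with
    a' = a mod c. The value is the exponent of the 24th root of unity; a recursive step adds k for
    T^k and 3 for the phase of [sqrtc_cocycle]. *)
Fixpoint eta_mult (fuel : nat) (a b c d : int) : option int :=
  if fuel is n.+1 then
    if c == 0 then (if (a == 1) && (d == 1) then Some b else None)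
    else
      let k := (a %/ c)%Z in
      let a' := a - k * c in
      let b' := b - k * d in
      if a' == 0 then Some (k + d)
      else if eta_mult n (- c) (- d) a' b' is Some e then Some (k + e + 3) else None
  else None.

Lemma eta_mult_correct fuel (a b c d k : int) tau : 0 <= c -> a * d - b * c = 1 ->
  eta_mult fuel a b c d = Some k -> 0 < complex.Im tau ->
  eta ((a%:~R * tau + b%:~R) / (c%:~R * tau + d%:~R)) = zeta24 k * jfac c d tau * eta tau.
Proof.
elim: fuel a b c d k => [//|n IH] a b c d k c0 D /=.
case: eqP => [->|/eqP cn0].
  case: ifP => // /andP[/eqP -> /eqP ->] [<-] t0.
  by rewrite mul0r add0r divr1 mul1r eta_translate /jfac eqxx mulr1.
have cp : 0 < c by rewrite lt_neqAle eq_sym cn0.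
set q := (a %/ c)%Z; set a' := a - q * c; set b' := b - q * d.
have a'0 : 0 <= a' by rewrite /a' {1}(divz_eq a c) addrAC subrr add0r modz_ge0.
have D' : a' * d - b' * c = 1 by rewrite -D /a' /b'; ring.
move=> + t0; have [den0 _] := im_moebius_int D t0.
case: eqP => [a0 [<-]|/eqP an0].
  have bc : - b' * c = 1 by move: D'; rewrite a0; lia.
  have c1 : c = 1.
    have : (c %| 1)%Z by apply/dvdzP; exists (- b').
    by rewrite dvdz1 => /eqP h; rewrite -(gtz0_abs cp) h.
  have b1 : b' = -1 by move: bc; rewrite c1; lia.
  have aE : a = q by move: a0; rewrite /a' c1; lia.
  have bE : b = q * d - 1 by move: b1; rewrite /b'; lia.
  have -> : (a%:~R * tau + b%:~R) / (c%:~R * tau + d%:~R) = - (tau + d%:~R)^-1 + q%:~R.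
    rewrite aE bE c1 intrB intrM; move: den0; rewrite c1 mul1r => h.
    by field.
  have td : 0 < complex.Im (tau + d%:~R).
    by rewrite ImD -(rmorph_int (real_complex R)) /= addr0.
  rewrite eta_translate eta_inversion // eta_translate zeta24D /jfac (negbTE cn0).
  by rewrite c1 mul1r; ring.
case E : (eta_mult n (- c) (- d) a' b') => [e|] // [<-].
have ap : 0 < a' by rewrite lt_neqAle eq_sym an0.
have D2 : - c * b' - - d * a' = 1 by rewrite -D'; ring.
have [den1 im1] := im_moebius_int D2 t0.
set g := (_ / _) in im1.
have ih := IH _ _ _ _ _ a'0 D2 E t0; rewrite -/g in ih.
have g0 : g != 0 by apply/eqP => h; move: im1; rewrite h ltxx.
have num0 : (- c)%:~R * tau + (- d)%:~R != 0.
  by apply/eqP => h; move: g0; rewrite /g h mul0r eqxx.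
have -> : (a%:~R * tau + b%:~R) / (c%:~R * tau + d%:~R) = - g^-1 + q%:~R.
  have -> : (a%:~R : R[i]) = a'%:~R + q%:~R * c%:~R
    by rewrite -intrM -intrD; congr _%:~R; rewrite /a'; ring.
  have -> : (b%:~R : R[i]) = b'%:~R + q%:~R * d%:~R
    by rewrite -intrM -intrD; congr _%:~R; rewrite /b'; ring.
  rewrite /g !intrN; field.
  by rewrite den0 den1 -!intrN num0.
rewrite eta_translate eta_inversion // ih /jfac (negbTE cn0) gt_eqF //.
have coc := @sqrtc_cocycle (- 'i%C * g) (- 'i%C * (a'%:~R * tau + b'%:~R))
  (- 'i%C * (c%:~R * tau + d%:~R)).
rewrite (_ : zeta24 q * _ =
  zeta24 q * zeta24 e * (sqrtc (- 'i%C * g) * sqrtc (- 'i%C * (a'%:~R * tau + b'%:~R))) * eta tau); last by ring.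
rewrite coc; first by rewrite !zeta24D; ring.
- by apply: cone_sqrtc; rewrite ReM /=; lra.
- exact: cone_jarg.
- exact: cone_jarg.
rewrite /g !intrN.
transitivity (('i%C * 'i%C) * (- (c%:~R * tau + d%:~R))).
  by field.
by rewrite ii; transitivity (- ('i%C * 'i%C) * (c%:~R * tau + d%:~R)); [rewrite ii; ring | ring].
Qed.

End Moebius.

(** * Invariance of the Hauptmoduls under Gamma_0(M) *)

Section Matrices.

(** Nested pairs rather than matrices, so that the certificates below run under [vm_compute]. *)
Definition mat2 := ((int * int) * (int * int))%type.

Definition mmul (g h : mat2) : mat2 :=
  let: ((a, b), (c, d)) := g in let: ((x, y), (z, w)) := h in
  ((a * x + b * z, a * y + b * w), (c * x + d * z, c * y + d * w)).

Definition mdet (g : mat2) : int := let: ((a, b), (c, d)) := g in a * d - b * c.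
Definition madj (g : mat2) : mat2 := let: ((a, b), (c, d)) := g in ((d, - b), (- c, a)).
Definition mI : mat2 := ((1, 0), (0, 1)).
Definition mS : mat2 := ((0, -1), (1, 0)).
Definition mT (n : int) : mat2 := ((1, n), (0, 1)).

Lemma mmulA g h k : mmul g (mmul h k) = mmul (mmul g h) k.
Proof.
case: g h k => [[a b] [c d]] [[x y] [z w]] [[p q] [r s]] /=.
by congr ((_, _), (_, _)); ring.
Qed.

Lemma mdetM g h : mdet (mmul g h) = mdet g * mdet h.
Proof. by case: g h => [[a b] [c d]] [[x y] [z w]] /=; ring. Qed.

Lemma mmul1 g : mmul mI g = g.
Proof. by case: g => [[a b] [c d]] /=; congr ((_, _), (_, _)); ring. Qed.

Lemma mmulI g : mmul g mI = g.
Proof. by case: g => [[a b] [c d]] /=; congr ((_, _), (_, _)); ring. Qed.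

Lemma mmul_adj g : mdet g = 1 -> mmul (madj g) g = mI /\ mmul g (madj g) = mI.
Proof.
case: g => [[a b] [c d]] /= h; rewrite /mI.
by split; congr ((_, _), (_, _)); rewrite ?[RHS]h -?h; ring.
Qed.

Lemma mdet_adj g : mdet (madj g) = mdet g.
Proof. by case: g => [[a b] [c d]] /=; ring. Qed.

(** Euclid on the first column strips [mT q] and [mS] until the lower left entry is 0; the square of
    [mS] is minus the identity and settles the signs. *)
Lemma sl2_ind (P : mat2 -> Prop) : P mI ->
  (forall g h, P g -> P h -> P (mmul g h)) -> P mS -> P (mT 1) -> P (mT (-1)) ->
  forall g, mdet g = 1 -> P g.
Proof.
move=> PI PM PS PT PT'.
have PTn n : P (mT n).
  have h m : P (mT (m%:Z)) /\ P (mT (- m%:Z)).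
    elim: m => [|m [h1 h2]]; first by rewrite oppr0.
    split.
      have -> : mT m.+1 = mmul (mT 1) (mT m) by rewrite /mT /=; congr ((_, _), (_, _)); lia.
      exact: PM.
    have -> : mT (- m.+1%:Z) = mmul (mT (-1)) (mT (- m%:Z)).
      by rewrite /mT /=; congr ((_, _), (_, _)); lia.
    exact: PM.
  by case: n => n; [case: (h n) | rewrite NegzE; case: (h n.+1)].
have PN : P ((-1, 0), (0, -1)).
  have -> : ((-1, 0), (0, -1)) = mmul mS mS by [].
  exact: PM.
have main n a b c d : (`|c| < n)%N -> a * d - b * c = 1 -> P ((a, b), (c, d)).
  elim: n a b c d => [//|n IH] a b c d cn D.
  have [c0|c0] := eqVneq c 0.
    have ad : a * d = 1 by rewrite -D c0; ring.
    have : (a %| 1)%Z by apply/dvdzP; exists d; rewrite mulrC.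
    rewrite dvdz1 => /eqP a1.
    have [aE|aE] : a = 1 \/ a = -1 by move: a1; lia.
      have -> : ((a, b), (c, d)) = mT b.
        by rewrite /mT c0 aE; congr ((_, _), (_, _)); move: ad; rewrite aE; lia.
      exact: PTn.
    have -> : ((a, b), (c, d)) = mmul ((-1, 0), (0, -1)) (mT (- b)).
      by rewrite /mT /= c0 aE; congr ((_, _), (_, _)); move: ad; rewrite aE; lia.
    exact: PM.
  set q := (a %/ c)%Z; set r := a - q * c.
  have rE : r = (a %% c)%Z by rewrite /r {1}(divz_eq a c) addrAC subrr add0r.
  have r0 : 0 <= r by rewrite rE modz_ge0.
  have rc : (r < `|c|)%R by rewrite rE ltz_mod.
  have -> : ((a, b), (c, d)) = mmul (mT q) (mmul mS ((c, d), (- r, - (b - q * d)))).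
    by rewrite /= /r; congr ((_, _), (_, _)); ring.
  apply: (PM); first exact: PTn.
  apply: (PM); first exact: PS.
  apply: IH; first by lia.
  by rewrite -D /r; ring.
by case=> [[a b] [c d]] /= D; apply: (main `|c|.+1%N).
Qed.

End Matrices.

Definition levels := [:: 2; 3; 4; 5; 6; 7; 8; 9; 10; 12; 13; 16; 18; 25]%N.

(** * Eta quotients and the certificate on Schreier generators *)

Section EtaQuotients.
Variable R : realType.
Implicit Types tau : R[i].

Definition mact (g : mat2) tau : R[i] :=
  let: ((a, b), (c, d)) := g in (a%:~R * tau + b%:~R) / (c%:~R * tau + d%:~R).

Lemma mact_im g tau : mdet g = 1 -> 0 < complex.Im tau -> 0 < complex.Im (mact g tau).
Proof. by case: g => [[a b] [c d]] /= D t0; case: (im_moebius_int D t0). Qed.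

Lemma mactM g h tau : mdet g = 1 -> mdet h = 1 -> 0 < complex.Im tau ->
  mact (mmul g h) tau = mact g (mact h tau).
Proof.
case: g h => [[a b] [c d]] [[x y] [z w]] D D' t0.
have [n1 i1] := im_moebius_int D' t0.
have [n2 i2] := im_moebius_int D i1.
rewrite /= -/(mact _ _) !intrD !intrM.
have e : c%:~R * ((x%:~R * tau + y%:~R) / (z%:~R * tau + w%:~R)) + d%:~R =
  ((c%:~R * x%:~R + d%:~R * z%:~R) * tau + (c%:~R * y%:~R + d%:~R * w%:~R)) /
    (z%:~R * tau + w%:~R) by field.
move: n2; rewrite e mulf_eq0 negb_or => /andP[n2 _].
by field; rewrite n1 n2 -?e.
Qed.

Definition etaq (rs : seq (nat * int)) tau : R[i] :=
  \prod_(p <- rs) eta (p.1%:R * tau) ^ p.2.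

Lemma etaq_nil tau : etaq [::] tau = 1.
Proof. exact: big_nil. Qed.

Lemma etaq_cons p rs tau : etaq (p :: rs) tau = eta (p.1%:R * tau) ^ p.2 * etaq rs tau.
Proof. exact: big_cons. Qed.

(** For g = (a, b; c, d) and m dividing c, m (g tau) = g' (m tau) with g' = (a, m b; c/m, d), so
    each factor contributes the multiplier of its own g'. The 30 is fuel. *)
Definition quot_mult (rs : seq (nat * int)) (g : mat2) : option int :=
  let: ((a, b), (c, d)) := g in
  foldr (fun p acc =>
    if acc is Some s then
      if (p.1%:Z %| c)%Z then
        if eta_mult 30 a (p.1%:Z * b) (c %/ p.1%:Z)%Z d is Some e then Some (p.2 * e + s)
        else None
      else None
    else None) (Some 0) rs.

(** Of the matrices g and -g, which act alike, this picks the one on the branch of [jfac]. *)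
Definition mnorm (g : mat2) : mat2 :=
  let: ((a, b), (c, d)) := g in
  if (c < 0) || ((c == 0) && (a < 0)) then ((- a, - b), (- c, - d)) else g.

Definition inv_check (M : nat) rs (g : mat2) : bool :=
  (M%:Z %| g.2.1)%Z &&
  (if quot_mult rs (mnorm g) is Some s then (s %% 24)%Z == 0 else false).

(** An uncertified search for representatives r of the cosets Gamma_0(M) r; [schreier_check]
    validates its output. The fuel 100 of [coset_reps] exceeds the largest index, 36 at level 18. *)
Fixpoint coset_bfs (M : nat) (fuel : nat) (seen queue : seq mat2) : seq mat2 :=
  if fuel is n.+1 then
    if queue is r :: queue' then
      let add s (p : seq mat2 * seq mat2) :=
        let g := mmul r s in
        if has (fun r' => (M%:Z %| (mmul g (madj r')).2.1)%Z) p.1 then p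
        else (rcons p.1 g, rcons p.2 g) in
      let p := add (mT (-1)) (add (mT 1) (add mS (seen, queue'))) in
      coset_bfs M n p.1 p.2
    else seen
  else seen.

Definition coset_reps M := coset_bfs M 100 [:: mI] [:: mI].

(** The Schreier generators are the products r s r'^-1, with r' the representative of the coset of r
    s; [inv_check] tests both membership in Gamma_0(M) and the multiplier. *)
Definition schreier_check (M : nat) rs (reps : seq mat2) : bool :=
  [&& mI \in reps,
      all (fun r => mdet r == 1) reps,
      all (fun r => (M%:Z %| r.2.1)%Z ==> (r == mI)) reps &
      all (fun r => all (fun s => has (fun r' => inv_check M rs (mmul (mmul r s) (madj r'))) reps)
        [:: mS; mT 1; mT (-1)]) reps].

Definition eta_exponents (M : nat) : seq (nat * int) :=
  match M with
  | 2  => [:: (1%N, 24); (2%N, -24)]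
  | 3  => [:: (1%N, 12); (3%N, -12)]
  | 4  => [:: (1%N, 8); (4%N, -8)]
  | 5  => [:: (1%N, 6); (5%N, -6)]
  | 6  => [:: (1%N, 5); (3%N, 1); (2%N, -1); (6%N, -5)]
  | 7  => [:: (1%N, 4); (7%N, -4)]
  | 8  => [:: (1%N, 4); (4%N, 2); (2%N, -2); (8%N, -4)]
  | 9  => [:: (1%N, 3); (9%N, -3)]
  | 10 => [:: (1%N, 3); (5%N, 1); (2%N, -1); (10%N, -3)]
  | 12 => [:: (1%N, 3); (4%N, 1); (6%N, 2); (2%N, -2); (3%N, -1); (12%N, -3)]
  | 13 => [:: (1%N, 2); (13%N, -2)]
  | 16 => [:: (1%N, 2); (8%N, 1); (2%N, -1); (16%N, -2)]
  | 18 => [:: (1%N, 2); (6%N, 1); (9%N, 1); (2%N, -1); (3%N, -1); (18%N, -2)]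
  | 25 => [:: (1%N, 1); (25%N, -1)]
  | _  => [::]
  end.

Lemma zeta24X k (n : int) : zeta24 R k ^ n = zeta24 R (n * k).
Proof.
have nat_case m : zeta24 R k ^+ m = zeta24 R (m%:Z * k).
  elim: m => [|m IH]; first by rewrite mul0r zeta24_0.
  by rewrite exprS IH -zeta24D; congr zeta24; lia.
case: n => n; first exact: nat_case.
rewrite NegzE -exprnN nat_case; apply: (mulIf (zeta24_neq0 R (n.+1%:Z * k))).
by rewrite mulVf ?zeta24_neq0 // -zeta24D -mulrDl addNr mul0r zeta24_0.
Qed.

Lemma quot_mult_cons m r rs (a b c d : int) :
  quot_mult ((m, r) :: rs) ((a, b), (c, d)) =
  if quot_mult rs ((a, b), (c, d)) is Some s then
    if (m%:Z %| c)%Z then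
      if eta_mult 30 a (m%:Z * b) (c %/ m%:Z)%Z d is Some e then Some (r * e + s) else None
    else None
  else None.
Proof. by []. Qed.

(** Since (c/m)(m tau) + d = c tau + d, all factors share one automorphy factor, which carries the
    sum of the exponents. *)
Lemma quot_mult_correct rs (a b c d s : int) tau : 0 <= c -> a * d - b * c = 1 ->
  all (fun p => (0 < p.1)%N) rs -> quot_mult rs ((a, b), (c, d)) = Some s ->
  0 < complex.Im tau ->
  etaq rs (mact ((a, b), (c, d)) tau) =
  zeta24 R s * jfac c d tau ^ (\sum_(p <- rs) p.2) * etaq rs tau.
Proof.
move=> c0 D + + t0; elim: rs s => [|[m r] rs IH] s.
  by move=> _ [<-]; rewrite !etaq_nil zeta24_0 big_nil expr0z !mulr1.
case/andP=> m0 rs0; rewrite quot_mult_cons.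
case E : (quot_mult rs ((a, b), (c, d))) => [s'|]; last by [].
case: ifP => mc; last by [].
case F : (eta_mult _ _ _ _ _) => [e|]; last by [].
move=> [<-].
rewrite /= in m0.
have mz : (0 : int) < m%:Z by rewrite ltz_nat.
have cE : c = (c %/ m)%Z * m%:Z by rewrite divzK.
have c'0 : 0 <= (c %/ m)%Z by rewrite divz_ge0.
have D' : a * d - m%:Z * b * (c %/ m)%Z = 1 by rewrite -D {2}cE; ring.
have mi : (m%:R : R[i]) = m%:Z%:~R by [].
have tm : 0 < complex.Im (m%:R * tau).
  by rewrite -(Realn R m) ImM /= mul0r addr0 mulr_gt0 ?ltr0n.
have jE : jfac (c %/ m)%Z d (m%:R * tau) = jfac c d tau.
  rewrite /jfac; have -> : ((c %/ m)%Z == 0) = (c == 0).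
    by rewrite [in RHS]cE mulf_eq0 (gt_eqF mz) orbF.
  by rewrite mulrA mi -intrM -cE.
have := eta_mult_correct c'0 D' F tm; rewrite jE.
have -> : (a%:~R * (m%:R * tau) + (m%:Z * b)%:~R) / ((c %/ m)%Z%:~R * (m%:R * tau) + d%:~R)
   = m%:R * mact ((a, b), (c, d)) tau.
  have -> : (c %/ m)%Z%:~R * (m%:R * tau) = c%:~R * tau by rewrite mulrA mi -intrM -cE.
  by rewrite /mact intrM -mi mulrCA -mulrDr mulrA.
have [den _] := im_moebius_int D t0.
have J0 : jfac c d tau != 0.
  rewrite /jfac; case: ifP => _; first by rewrite oner_eq0.
  rewrite sqrtc_eq0 mulf_neq0 // oppr_eq0; apply/eqP => -[/eqP]; by rewrite oner_eq0.
rewrite !etaq_cons big_cons [(m, r).1]/= [(m, r).2]/= => ->; rewrite (IH _ rs0 E).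
rewrite (expfzMl (zeta24 R e * _)) (expfzMl (zeta24 R e)) zeta24X zeta24D expfzDr //.
by ring.
Qed.

Lemma mnormP g : mdet g = 1 -> exists a b c d : int, [/\ mnorm g = ((a, b), (c, d)),
  0 <= c, a * d - b * c = 1, (forall M : nat, (M%:Z %| c)%Z = (M%:Z %| g.2.1)%Z) &
  forall tau, mact (mnorm g) tau = mact g tau].
Proof.
case: g => [[a b] [c d]] /= D; case: ifP => h; last first.
  by exists a, b, c, d; split => //; move: h; lia.
exists (- a), (- b), (- c), (- d); split => //.
- by move: h; lia.
- by rewrite -D; ring.
- by move=> M; rewrite rpredN.
by move=> tau; rewrite /mact !intrN !mulNr -!opprD invrN mulrNN.
Qed.

Lemma inv_checkP M rs g : inv_check M rs g ->
  exists2 s, quot_mult rs (mnorm g) = Some s & (s %% 24)%Z = 0.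
Proof.
rewrite /inv_check => /andP[_]; move: (quot_mult rs (mnorm g)) => [s /eqP h|//].
by exists s.
Qed.

Lemma inv_check_correct M rs g : all (fun p => (0 < p.1)%N) rs ->
  \sum_(p <- rs) p.2 = 0 -> mdet g = 1 -> inv_check M rs g ->
  forall tau, 0 < complex.Im tau -> etaq rs (mact g tau) = etaq rs tau.
Proof.
move=> rs0 w0 D /inv_checkP[s E s24]; have [a [b [c [d [gE c0 D' _ gact]]]]] := mnormP D.
move=> tau t0; rewrite -gact gE; rewrite gE in E.
by rewrite (quot_mult_correct c0 D' rs0 E t0) w0 expr0z mulr1 (zeta24_mod R s24) mul1r.
Qed.

Lemma schreier_invariance M rs reps : all (fun p => (0 < p.1)%N) rs ->
  \sum_(p <- rs) p.2 = 0 -> schreier_check M rs reps ->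
  forall g, mdet g = 1 -> (M%:Z %| g.2.1)%Z ->
  forall tau, 0 < complex.Im tau -> etaq rs (mact g tau) = etaq rs tau.
Proof.
move=> rs0 w0 /and4P[rI /allP rdet /allP rM /allP rgen].
pose inv g := [/\ mdet g = 1, (M%:Z %| g.2.1)%Z &
  forall tau, 0 < complex.Im tau -> etaq rs (mact g tau) = etaq rs tau].
have invM g h : inv g -> inv h -> inv (mmul g h).
  move=> [dg mg ig] [dh mh ih]; split; first by rewrite mdetM dg dh.
    move: mg mh; case: (g) (h) => [[a b] [c d]] [[x y] [z w]] /= mg mh.
    by apply: rpredD; [apply: dvdz_mulr | apply: dvdz_mull].
  by move=> tau t0; rewrite (mactM dg dh t0) (ig _ (mact_im dh t0)) (ih _ t0).
(* Right multiplication by g carries each representative to another, up to an element leaving the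
   quotient invariant; this form is closed under products, as [sl2_ind] requires. *)
pose P g := mdet g = 1 /\ forall r, r \in reps -> exists2 r', r' \in reps &
  exists2 h, inv h & mmul r g = mmul h r'.
have Pgen s : mdet s = 1 -> s \in [:: mS; mT 1; mT (-1)] -> P s.
  move=> ds sg; split => // r rr; have /allP/(_ s sg)/hasP[r' rr' chk] := rgen r rr.
  have d' : mdet r' = 1 by apply/eqP/rdet.
  have dr : mdet r = 1 by apply/eqP/rdet.
  have dh : mdet (mmul (mmul r s) (madj r')) = 1 by rewrite !mdetM mdet_adj dr ds d'.
  exists r' => //; exists (mmul (mmul r s) (madj r')).
    split; [exact: dh | by case/andP: chk |].
    exact: (inv_check_correct rs0 w0 dh chk).
  by rewrite -mmulA (mmul_adj d').1 mmulI.
have Pall g : mdet g = 1 -> P g.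
  apply: sl2_ind; last 3 first.
  - exact: Pgen.
  - by apply: Pgen => //; rewrite !inE eqxx orbT.
  - by apply: Pgen => //; rewrite !inE eqxx !orbT.
  - split => // r rr; exists r => //; exists mI; last by rewrite mmulI mmul1.
    split; [by [] | exact: dvdz0 |].
    by move=> tau _; rewrite /= mul1r addr0 mul0r add0r divr1.
  move=> g1 g2 [d1 h1] [d2 h2]; split; first by rewrite mdetM d1 d2.
  move=> r rr; have [r' rr' [k1 ik1 e1]] := h1 r rr.
  have [r'' rr'' [k2 ik2 e2]] := h2 r' rr'.
  exists r'' => //; exists (mmul k1 k2); first exact: invM.
  by rewrite mmulA e1 -mmulA e2 mmulA.
(* Starting from the identity gives g = h r; here r lies in Gamma_0(M), hence is the identity. *)
move=> g dg Mg; have [_ /(_ mI rI)[r rr [h [dh mh ih] e]]] := Pall g dg.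
have rE : r = mmul (madj h) g by rewrite mmul1 in e; rewrite e mmulA (mmul_adj dh).1 mmul1.
have Mr : (M%:Z %| r.2.1)%Z.
  rewrite rE; move: mh Mg; case: (h) (g) => [[a b] [c d]] [[x y] [z w]] /= mh Mg.
  by apply: rpredD; [apply: dvdz_mulr; rewrite rpredN | apply: dvdz_mull].
have rI' : r = mI by apply/eqP; move/implyP: (rM r rr); apply.
by move: e; rewrite mmul1 rI' mmulI => ->.
Qed.

Lemma hauptmodul_etaq M tau : M \in levels ->
  hauptmodul M tau = etaq (eta_exponents M) tau.
Proof.
have E (x : R[i]) n : x ^ (n%:R : int) = x ^+ n by rewrite natz.
have EN (x : R[i]) n : x ^ (- (n%:R : int)) = x ^- n by rewrite natz -exprnN.
have EN1 (x : R[i]) : x ^ (-1) = x^-1 by have := EN x 1%N; rewrite expr1.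
rewrite /levels !inE.
do ![case/orP => [/eqP -> |]]; try move/eqP->.
all: rewrite /hauptmodul /eta_exponents !etaq_cons etaq_nil mulr1 /= mul1r.
all: do ?[move: (eta _) => ?].
all: by rewrite ?(expr1z, EN1, E, EN) ?invfM; ring.
Qed.

(** The second check is weight 0; the third makes the leading power of q at the cusp equal to -24/24
    = -1. *)
Lemma eta_exponents_check : all (fun M =>
  [&& all (fun p => (0 < p.1)%N) (eta_exponents M),
      foldr (fun p s => p.2 + s) 0 (eta_exponents M) == 0,
      foldr (fun p s => p.1%:Z * p.2 + s) 0 (eta_exponents M) == - 24%:Z &
      schreier_check M (eta_exponents M) (coset_reps M)]) levels.
Proof. by vm_compute. Qed.

Lemma hauptmodul_invariant M g tau : M \in levels -> mdet g = 1 ->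
  (M%:Z %| g.2.1)%Z -> 0 < complex.Im tau ->
  hauptmodul M (mact g tau) = hauptmodul M tau.
Proof.
move=> hM dg Mg t0; have /and4P[h1 /eqP h2 _ h4] := allP eta_exponents_check M hM.
have w0 : \sum_(p <- eta_exponents M) p.2 = 0.
  apply: etrans h2; elim: (eta_exponents M) => [|p rs IH]; first by rewrite big_nil.
  by rewrite big_cons IH.
rewrite !(hauptmodul_etaq _ hM).
exact: (schreier_invariance h1 w0 h4 dg Mg t0).
Qed.

End EtaQuotients.

(** * The conjugates of a Hauptmodul *)

Section Conjugates.
Variable R : realType.
Implicit Types tau : R[i].

Definition alpha (a b d : nat) tau : R[i] := (a%:R * tau + b%:R) / d%:R.

Lemma alphaE (a b d : nat) tau :
  alpha a b d tau = (a%:R / d%:R : R)%:C * tau + (b%:R / d%:R : R)%:C.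
Proof. by rewrite /alpha mulrDl !RealM !RealV !Realn mulrAC. Qed.

Lemma alpha_im a b d tau : (0 < a)%N -> (0 < d)%N -> 0 < complex.Im tau ->
  0 < complex.Im (alpha a b d tau).
Proof.
move=> a0 d0 t0; rewrite alphaE ImD ImM !ImC !ReC mul0r !addr0.
by rewrite mulr_gt0 // divr_gt0 // ltr0n.
Qed.

Section Meromorphy.
Variables (N a b d : nat).
Hypotheses (N0 : (0 < N)%N) (a0 : (0 < a)%N) (d0 : (0 < d)%N) (dN : (d %| a * N)%N).

Let D0 : (0 < 24 * N)%N. Proof. by rewrite muln_gt0. Qed.

(** As d divides a N, the number m a/d is a multiple of 1/N, so 24 N serves as a common denominator
    for all conjugates. *)
Lemma eta_alpha_holo m : (0 < m)%N ->
  holo (24 * N) (fun tau => eta (m%:R * alpha a b d tau)).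
Proof.
move=> m0; have := @eta_holo R (24 * N) D0 (m * (a * N %/ d))
  (m%:R * (a%:R / d%:R)) (m%:R * (b%:R / d%:R)).
have dn0 : d%:R != 0 :> R by rewrite pnatr_eq0 -lt0n.
rewrite muln_gt0 m0 divn_gt0 // dvdn_leq ?muln_gt0 ?a0 //= => h.
apply: holo_ext (h isT _) => [tau _|].
  apply: congr1; rewrite alphaE (RealM m%:R (a%:R / d%:R)) (RealM m%:R (b%:R / d%:R)) Realn.
  by ring.
have e : (a * N)%:R = (a * N %/ d)%:R * d%:R :> R by rewrite -natrM divnK.
rewrite natrM in e; rewrite !natrM.
rewrite (_ : m%:R * (a%:R / d%:R) * (24 * N%:R) = 24 * m%:R * (a%:R * N%:R) / d%:R); last by ring.
by rewrite e; field.
Qed.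

Lemma etaq_alpha_mero rs : all (fun p => (0 < p.1)%N) rs ->
  mero (24 * N) (fun tau => etaq rs (alpha a b d tau)).
Proof.
elim: rs => [_|[m r] rs IH /= /andP[m0 rs0]].
  by apply: mero_ext (mero_cst _ 1) => tau _; rewrite etaq_nil.
have h := holo_mero (eta_alpha_holo m0).
have h0 tau : 0 < complex.Im tau -> eta (m%:R * alpha a b d tau) != 0.
  move=> t0; apply: eta_neq0; rewrite -(Realn R m) ImM ReC ImC mul0r addr0.
  by rewrite mulr_gt0 ?ltr0n // alpha_im.
have hr : mero (24 * N) (fun tau => eta (m%:R * alpha a b d tau) ^ r).
  case: r => n; first exact: meroX.
  rewrite NegzE; apply: mero_ext (meroX n.+1 (meroV h0 h)) => tau _.
  by rewrite -exprnN exprVn.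
apply: mero_ext (meroM hr (IH rs0)) => tau _.
by rewrite etaq_cons.
Qed.

End Meromorphy.

(** Convergence to 1 at the cusp, uniform in Re tau. *)
Definition lim1 (F : R[i] -> R[i]) := forall e : R, 0 < e ->
  exists2 Y : R, 0 < Y & forall tau, Y < complex.Im tau -> cmod (F tau - 1) < e.

Lemma lim1_ext F G : (forall tau, 0 < complex.Im tau -> F tau = G tau) -> lim1 F -> lim1 G.
Proof.
move=> h hF e /hF[Y Y0 hY]; exists Y => // tau tY.
by rewrite -h ?(lt_trans Y0) // hY.
Qed.

Lemma lim1_1 : lim1 (fun=> 1).
Proof. by move=> e e0; exists 1 => // tau _; rewrite subrr cmod0. Qed.

Lemma lim1M F G : lim1 F -> lim1 G -> lim1 (fun tau => F tau * G tau).
Proof.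
move=> hF hG e e0.
have e3 : 0 < Num.min 1 (e / 3) by rewrite lt_min ltr01 divr_gt0.
have [Y1 Y10 h1] := hF _ e3; have [Y2 Y20 h2] := hG _ e3.
exists (Num.max Y1 Y2); first by rewrite lt_max Y10.
move=> tau; rewrite gt_max => /andP[/h1 + /h2]; rewrite !lt_min => /andP[f1 f2] /andP[g1 g2].
rewrite (_ : _ - 1 = (F tau - 1) * (G tau - 1) + (F tau - 1) + (G tau - 1)); last by ring.
apply: le_lt_trans (cmodD _ _) _.
have := cmodD ((F tau - 1) * (G tau - 1)) (F tau - 1); rewrite cmodM.
have := cmod_ge0 (F tau - 1); have := cmod_ge0 (G tau - 1).
move: (cmod (F tau - 1)) (cmod (G tau - 1)) f1 f2 g1 g2 => x y f1 f2 g1 g2 y0 x0.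
have : x * y <= x by rewrite ler_piMr // ltW.
lra.
Qed.

Lemma lim1V F : lim1 F -> lim1 (fun tau => (F tau)^-1).
Proof.
move=> hF e e0.
have e3 : 0 < Num.min (1 / 2) (e / 2) by rewrite lt_min !divr_gt0.
have [Y Y0 h] := hF _ e3; exists Y => // tau /h; rewrite lt_min => /andP[f1 f2].
have F2 : 1 / 2 <= cmod (F tau).
  by have := cmod_sub 1 (F tau); rewrite cmod1 cmodB; lra.
have Fn0 : F tau != 0 by rewrite -cmod_gt0; lra.
rewrite (_ : _ - 1 = - (F tau - 1) / F tau); last by field.
rewrite cmodM cmodN cmodV ltr_pdivrMr; last by lra.
by nra.
Qed.

Lemma lim1X F n : lim1 F -> lim1 (fun tau => F tau ^+ n).
Proof.
move=> hF; elim: n => [|n IH]; first exact: lim1_ext lim1_1.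
by apply: lim1_ext (lim1M hF IH) => tau _; rewrite exprS.
Qed.

Lemma lim1_exprz F (n : int) : lim1 F -> lim1 (fun tau => F tau ^ n).
Proof.
move=> hF; case: n => n; first exact: lim1X.
by rewrite NegzE; apply: lim1_ext (lim1X n.+1 (lim1V hF)) => tau _; rewrite -exprnN exprVn.
Qed.

Lemma euler_phi_lim1 m : (0 < m)%N -> lim1 (fun tau => euler_phi (qpow tau m%:R)).
Proof.
move=> m0 e e0; have c0 : 0 < 2 * expR 2 :> R by rewrite mulr_gt0 ?expR_gt0.
have d0 : 0 < Num.min (1 / 2) (e / (2 * expR 2)) by rewrite lt_min !divr_gt0.
have mr : 0 < (m%:R : R) by rewrite ltr0n.
have [Y Y0 hY] := cmod_qpow_small mr d0; exists Y => // tau /hY.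
rewrite lt_min => /andP[/ltW h1]; rewrite ltr_pdivlMr // => h2.
apply: le_lt_trans (euler_phi_near1 h1) _.
by rewrite mulrC.
Qed.

Definition etaq_phi rs tau : R[i] := \prod_(p <- rs) euler_phi (qpow tau p.1%:R) ^ p.2.

Lemma etaq_phi_cons p rs tau :
  etaq_phi (p :: rs) tau = euler_phi (qpow tau p.1%:R) ^ p.2 * etaq_phi rs tau.
Proof. exact: big_cons. Qed.

Lemma etaq_phi_lim1 rs : all (fun p => (0 < p.1)%N) rs -> lim1 (etaq_phi rs).
Proof.
elim: rs => [_|p rs IH /= /andP[p0 rs0]].
  by apply: lim1_ext lim1_1 => tau _; rewrite /etaq_phi big_nil.
apply: lim1_ext (lim1M (lim1_exprz p.2 (euler_phi_lim1 p0)) (IH rs0)) => tau _.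
by rewrite etaq_phi_cons.
Qed.

Lemma qpowXz tau r (n : int) : qpow tau r ^ n = qpow tau (r * n%:~R).
Proof.
case: n => n; first exact: qpowX.
rewrite NegzE -exprnN qpowX; apply: (mulIf (qpow_neq0 tau (r * n.+1%:R))).
rewrite mulVf ?qpow_neq0 // qpowM -mulrDr intrN addNr mulr0.
by rewrite qpowE mulr0 mulr0 mul0r cexp0.
Qed.

Lemma etaq_lead rs tau :
  etaq rs tau = qpow tau ((foldr (fun p s => p.1%:Z * p.2 + s) 0 rs)%:~R / 24) * etaq_phi rs tau.
Proof.
elim: rs => [|[m r] rs IH].
  rewrite etaq_nil /etaq_phi big_nil [foldr _ _ _]/= mul0r mulr1.
  by rewrite qpowE mulr0 mulr0 mul0r cexp0.
rewrite etaq_cons etaq_phi_cons IH [foldr _ _ _]/=; cbn [fst snd].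
set s := foldr _ _ _.
have E : eta (m%:R * tau) = qpow tau (m%:R / 24) * euler_phi (qpow tau m%:R).
  have -> : m%:R * tau = (m%:R : R)%:C * tau + (0 : R)%:C by rewrite Realn addr0.
  by rewrite etaE !qpow_affine !mulr0 !mulr1 cexp0 !mul1r.
rewrite E (expfzMl (qpow tau _)) (qpowXz tau (m%:R / 24) r).
have -> : (m%:Z * r + s)%:~R / 24 = m%:R / 24 * r%:~R + s%:~R / 24 :> R.
  by rewrite intrD intrM; field.
by rewrite -(qpowM tau (m%:R / 24 * r%:~R) (s%:~R / 24)); ring.
Qed.

Lemma hauptmodul_lead M tau : M \in levels ->
  hauptmodul M tau = (qpow tau 1)^-1 * etaq_phi (eta_exponents M) tau.
Proof.
move=> hM; have /and4P[_ _ /eqP h _] := allP eta_exponents_check M hM.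
rewrite hauptmodul_etaq // etaq_lead h; congr (_ * _).
rewrite (_ : (- 24%:Z)%:~R / 24 = -1 :> R); last by rewrite intrN -pmulrn; field.
apply: (mulIf (qpow_neq0 tau 1)); rewrite mulVf ?qpow_neq0 // qpowM addNr.
by rewrite qpowE mulr0 mulr0 mul0r cexp0.
Qed.

End Conjugates.

(** * Distinctness of the conjugates and transcendence of the Hauptmodul *)

Section Separation.
Variable R : realType.
Implicit Types tau : R[i].

Lemma etaq_phi_neq0 rs tau : all (fun p => (0 < p.1)%N) rs -> 0 < complex.Im tau ->
  etaq_phi rs tau != 0.
Proof.
move=> + t0; elim: rs => [_|p rs IH /= /andP[p0 rs0]].
  by rewrite /etaq_phi big_nil oner_eq0.
rewrite etaq_phi_cons mulf_neq0 ?IH // expfz_neq0 // euler_phi_neq0 //.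
by rewrite cmod_qpow_lt1 // ltr0n.
Qed.

Lemma im_alpha a b d tau : complex.Im (alpha a b d tau) = a%:R / d%:R * complex.Im tau.
Proof. by rewrite alphaE ImD ImM !ImC !ReC mul0r !addr0. Qed.

Lemma lim1_alpha F a b d : (0 < a)%N -> (0 < d)%N -> @lim1 R F ->
  lim1 (fun tau => F (alpha a b d tau)).
Proof.
move=> a0 d0 hF e /hF[Y Y0 hY].
have ad : 0 < a%:R / d%:R :> R by rewrite divr_gt0 // ltr0n.
exists (Y / (a%:R / d%:R)); first by rewrite divr_gt0.
by move=> tau h; apply: hY; rewrite im_alpha mulrC -ltr_pdivrMr.
Qed.

Lemma lim1_modulus F (c : R) : lim1 F ->
  (forall tau, 0 < complex.Im tau -> cmod (F tau) = expR (c * complex.Im tau)) -> c <= 0.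
Proof.
move=> hF h; rewrite leNgt; apply/negP => c0.
have [Y Y0 hY] := hF 1 ltr01.
(* At this height the modulus is at least 1 + c Y + 2 > 2, although it lies within 1 of 1. *)
pose y := Y + 2 / c; have c2 : 0 < 2 / c by rewrite divr_gt0.
have yY : Y < complex.Im (0 +i* y) by rewrite /= /y; lra.
have := hY _ yY; have := cmod_sub (F (0 +i* y)) 1; rewrite cmod1 h /=; last first.
  by rewrite (lt_trans Y0).
have := expR_ge1Dx (c * y); have -> : c * y = c * Y + 2 by rewrite /y; field; rewrite gt_eqF.
have : 0 <= c * Y by rewrite mulr_ge0 ?ltW.
lra.
Qed.

Lemma lim1_modulus_eq0 F (c : R) : lim1 F ->
  (forall tau, 0 < complex.Im tau -> cmod (F tau) = expR (c * complex.Im tau)) -> c = 0.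
Proof.
move=> hF h; apply/eqP; rewrite eq_le (lim1_modulus hF h) /= -oppr_le0.
apply: (lim1_modulus (lim1V hF)) => tau t0.
by rewrite cmodV h // -expRN mulNr.
Qed.

Lemma lim1_cst (c : R[i]) : lim1 (fun=> c) -> c = 1.
Proof.
move=> h; apply/eqP; rewrite -subr_eq0 -cmod_eq0 eq_le cmod_ge0 andbT leNgt.
apply/negP => e0; have [Y Y0 /(_ (0 +i* (Y + 1)))] := h _ e0.
by rewrite /= ltrDl ltr01 ltxx => /(_ isT).
Qed.

Lemma hauptmodul_alpha_inj M N (a b d a' b' d' : nat) : M \in levels -> (0 < N)%N ->
  (a * d = N)%N -> (a' * d' = N)%N -> (b < d)%N -> (b' < d')%N ->
  (forall tau, 0 < complex.Im tau ->
     hauptmodul M (alpha a b d tau) = hauptmodul M (alpha a' b' d' tau)) ->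
  [/\ a = a', b = b' & d = d'].
Proof.
move=> hM N0 ad ad' bd bd' h.
have [a0 d0] : (0 < a)%N /\ (0 < d)%N by apply/andP; rewrite -muln_gt0 ad.
have [a'0 d'0] : (0 < a')%N /\ (0 < d')%N by apply/andP; rewrite -muln_gt0 ad'.
have /and4P[pos _ _ _] := allP eta_exponents_check M hM.
have ph := @etaq_phi_lim1 R _ pos.
pose Q a b d tau := qpow (alpha a b d tau) 1 : R[i].
(* Each value is the inverse of a power of q times a factor tending to 1, so equal values force the
   quotient of the powers to tend to 1. *)
have ratio : lim1 (fun tau => Q a b d tau / Q a' b' d' tau).
  apply: lim1_ext (lim1M (lim1_alpha b a0 d0 ph) (lim1V (lim1_alpha b' a'0 d'0 ph))) => tau t0.
  have := h tau t0; rewrite !hauptmodul_lead //.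
  have i1 := @alpha_im R a b d tau a0 d0 t0.
  have i2 := @alpha_im R a' b' d' tau a'0 d'0 t0.
  have n1 := qpow_neq0 (alpha a b d tau) 1; have n2 := qpow_neq0 (alpha a' b' d' tau) 1.
  have n3 := etaq_phi_neq0 pos i2.
  rewrite -/(Q a b d tau) -/(Q a' b' d' tau) in n1 n2 *.
  move: (Q a b d tau) (Q a' b' d' tau) n1 n2 n3 (etaq_phi _ (alpha a b d tau)).
  move: (etaq_phi _ _) => f' q q' n1 n2 n3 f e.
  have -> : f = q * (q'^-1 * f') by rewrite -e mulrA mulfV // mul1r.
  by field; rewrite n2 n3.
have dn : d%:R != 0 :> R by rewrite pnatr_eq0 -lt0n.
have dn' : d'%:R != 0 :> R by rewrite pnatr_eq0 -lt0n.
have c0 := lim1_modulus_eq0 (c := 2 * pi * (a'%:R / d'%:R - a%:R / d%:R)) ratio.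
have {}c0 : 2 * pi * (a'%:R / d'%:R - a%:R / d%:R) = 0 :> R.
  apply: c0 => tau t0; rewrite /Q cmodM cmodV !cmod_qpow -expRN -expRD !im_alpha.
  by congr expR; ring.
have {}c0 : a'%:R / d'%:R = a%:R / d%:R :> R.
  move/eqP: c0; rewrite mulf_eq0 mulf_eq0 pnatr_eq0 /= gt_eqF ?pi_gt0 //= subr_eq0.
  by move/eqP.
have cr : (a' * d = a * d')%N.
  apply/eqP; rewrite -(eqr_nat R) !natrM; apply/eqP.
  have -> : a'%:R = a'%:R / d'%:R * d'%:R :> R by rewrite divfK.
  by rewrite c0; field.
have aa : a = a'.
  have e : (a ^ 2 = a' ^ 2)%N.
    apply/eqP; rewrite -(eqn_pmul2r d0) -!mulnn -!mulnA ad -{1}ad' cr.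
    by rewrite mulnCA.
  by apply/eqP; rewrite -(eqn_sqr a a'); apply/eqP.
have dd : d = d' by apply/eqP; rewrite -(eqn_pmul2l a0) ad aa ad'.
split => //; subst a' d'.
(* Once a = a' and d = d', the quotient is this constant phase, which must therefore be 1. *)
have cst : lim1 (fun=> cexp ('i%C * (2 * pi * ((b%:R - b'%:R) / d%:R) : R)%:C)).
  apply: lim1_ext ratio => tau t0.
  rewrite /Q !alphaE !qpow_affine.
  have X0 := qpow_neq0 tau (a%:R / d%:R * 1).
  rewrite invfM mulrACA mulfV // mulr1 -cexpN -cexpD; congr cexp.
  rewrite -mulrBr -RealB; congr (_ * _%:C).
  by field.
have /cexp_2pii_eq1 := lim1_cst cst.
have dp : 0 < d%:R :> R by rewrite ltr0n.
have p1 : (b%:R : R) < d%:R by rewrite ltr_nat.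
have p2 : (b'%:R : R) < d%:R by rewrite ltr_nat.
have p3 := ler0n R b; have p4 := ler0n R b'.
have small1 : `|(b%:R - b'%:R) / d%:R| < 1 :> R.
  rewrite normrM normfV (gtr0_norm dp) ltr_pdivrMr // mul1r ltr_norml.
  by apply/andP; split; lra.
move=> /(_ small1)/eqP; rewrite mulf_eq0 invr_eq0 (negbTE dn) orbF subr_eq0 eqr_nat.
by move/eqP.
Qed.

Lemma hauptmodul_unbounded M (B : R) : M \in levels ->
  exists2 tau, 0 < complex.Im tau & B < cmod (hauptmodul M tau : R[i]).
Proof.
move=> hM; have /and4P[pos _ _ _] := allP eta_exponents_check M hM.
have p0 := pi_gt0 R; have p2 := pi_ge2 R.
have h2 : 0 < 1 / 2 :> R by lra.
have [Y Y0 hY] := @etaq_phi_lim1 R _ pos (1 / 2) h2.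
pose y := Y + `|B| + 1; have B0 := normr_ge0 B.
have y0 : 0 < y by rewrite /y; lra.
exists (0 +i* y) => //; rewrite hauptmodul_lead // cmodM cmodV cmod_qpow -expRN opprK.
have h : cmod (etaq_phi (eta_exponents M) (0 +i* y) - 1) < 1 / 2.
  by apply: hY; rewrite /= /y; lra.
have f2 : 1 / 2 <= cmod (etaq_phi (eta_exponents M) (0 +i* y)).
  by have := cmod_sub 1 (etaq_phi (eta_exponents M) (0 +i* y)); rewrite cmod1 cmodB; lra.
have e1 := expR_ge1Dx (2 * pi * 1 * y).
have e2 : 4 * y <= 2 * pi * 1 * y by rewrite ler_wpM2r ?(ltW y0) //; lra.
have e3 : 4 * y <= expR (2 * pi * 1 * y) by lra.
have y4 : 0 <= 4 * y by rewrite mulr_ge0 // ltW.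
have := ler_pM y4 (ltW h2) e3 f2.
by have := ler_norm B; rewrite /y /=; lra.
Qed.

(** Unboundedness supplies arbitrarily many roots: a value exceeding in modulus the sum of the
    earlier moduli is new. *)
Lemma hauptmodul_transcendental M (e : {poly R[i]}) : M \in levels ->
  (forall tau, 0 < complex.Im tau -> e.[hauptmodul M tau] = 0) -> e = 0.
Proof.
move=> hM h.
have pts n : exists s : seq R[i], [/\ size s = n, uniq s & all (root e) s].
  elim: n => [|n [s [sn us rs]]]; first by exists [::].
  have [tau t0 ht] := hauptmodul_unbounded (\sum_(z <- s) cmod z) hM.
  exists (hauptmodul M tau :: s); split; [by rewrite /= sn | | ].
    rewrite cons_uniq us andbT; apply/negP => zs; move: ht; rewrite (big_rem _ zs) /=.
    by rewrite ltNge lerDl sumr_ge0 // => z _; exact: cmod_ge0.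
  by apply/andP; split; [apply/rootP/h | exact: rs].
apply/eqP; apply/negPn/negP => e0.
have [s [sn us rs]] := pts (size e).
by have := max_poly_roots e0 rs us; rewrite sn ltnn.
Qed.

End Separation.

(** * Transitivity of Gamma_0(M) on the conjugates *)

Section Transitivity.
Variable R : realType.
Implicit Types tau : R[i].

(** Take k to be the part of n prime to c. A prime p of n dividing c divides neither k nor, by
    hypothesis, d; a prime p of n not dividing c divides k. In both cases p does not divide d k -
    c. *)
Lemma coprime_shift (d c n : nat) : (0 < n)%N -> coprime (gcdn d c) n ->
  exists k : nat, coprimez (d%:Z * k%:Z - c%:Z) n%:Z.
Proof.
move=> n0 cop; pose pi := [pred p | ~~ (p %| c)%N] : nat_pred.
exists (n`_pi)%N; rewrite /coprimez; apply: contraT => ne1.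
set g := gcdz _ _ in ne1.
have gn : (g %| n%:Z)%Z by rewrite dvdz_gcdr.
have gd : (g %| d%:Z * (n`_pi)%N%:Z - c%:Z)%Z by rewrite dvdz_gcdl.
have gN : g = `|g|%N by rewrite gez0_abs // /g.
have g0 : (0 < `|g|)%N.
  rewrite absz_gt0; apply/eqP => h; move: gn; rewrite h dvd0z => /eqP [] h'.
  by move: n0; rewrite h'.
have g1 : (1 < `|g|)%N.
  by move: ne1 g0; rewrite gN; case: (`|g|%N) => [|[|]].
have pp := pdiv_prime g1; set p := pdiv `|g| in pp.
have pg : (p%:Z %| g)%Z by rewrite gN; exact: pdiv_dvd.
have pn : (p %| n)%N by have := dvdz_trans pg gn.
have pd : (p%:Z %| d%:Z * (n`_pi)%N%:Z - c%:Z)%Z by apply: dvdz_trans pg gd.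
have [pc|npc] := boolP (p %| c)%N.
  have : (p%:Z %| d%:Z * (n`_pi)%N%:Z)%Z by rewrite -[_ * _](subrK c%:Z) rpredD.
  rewrite -PoszM => pdk; have {pdk} : (p %| d * n`_pi)%N by [].
  rewrite Euclid_dvdM // => /orP[pdd|pnp].
    have : (p %| gcdn (gcdn d c) n)%N by rewrite !dvdn_gcd pdd pc.
    by rewrite (eqP cop) dvdn1 => /eqP p1; move: pp; rewrite p1.
  have := pnatPpi (part_pnat pi n) (p := p).
  rewrite mem_primes part_gt0 pp pnp => /(_ isT).
  by rewrite inE /= pc.
have pk : (p %| n`_pi)%N.
  have pnn : pi.-nat p by rewrite pnatE // inE.
  by rewrite -(part_pnat_id pnn) partn_dvd.
have : (p%:Z %| c%:Z)%Z.
  by rewrite -[c%:Z](subKr (d%:Z * (n`_pi)%N%:Z)) rpredB // dvdz_mull.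
by move=> h; move: npc; have -> : (p %| c)%N by [].
Qed.

(* Every primitive matrix of determinant N is Gamma_0(M)-equivalent, on both
   sides, to diag(N, 1). *)
Lemma alpha_transitive M N (a b d : nat) : M \in levels -> (0 < N)%N -> coprime M N ->
  (a * d = N)%N -> gcdn (gcdn a b) d = 1%N ->
  exists g, [/\ mdet g = 1, (M%:Z %| g.2.1)%Z &
    forall tau, 0 < complex.Im tau ->
      hauptmodul M (alpha a b d (mact g tau)) = hauptmodul M (N%:R * tau)].
Proof.
move=> hM N0 MN ad abd.
have M0 : (0 < M)%N by move: hM; rewrite /levels !inE; lia.
have [a0 d0] : (0 < a)%N /\ (0 < d)%N by apply/andP; rewrite -muln_gt0 ad.
(* As d is prime to M, gcd(d, b M) = gcd(d, b), which is prime to M and to a. *)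
have [||k /coprimezP[[u v] uv]] := @coprime_shift d (b * M) (M * a).
- by rewrite muln_gt0 M0.
- have dM : coprime d M by rewrite coprime_sym; apply: coprime_dvdr MN; rewrite -ad dvdn_mull.
  have e : gcdn d (b * M) = gcdn d b by rewrite mulnC Gauss_gcdr.
  rewrite e coprimeMr (coprime_dvdl (dvdn_gcdl d b) dM) /=.
  by rewrite /coprime gcdnC (gcdnC d b) gcdnA abd.
rewrite [(u, v).1]/= [(u, v).2]/= in uv.
(* Chosen so that (a, b; 0, d) g = g1 diag(N, 1); both determinants are the Bezout relation [uv],
   and both lower left entries are multiples of M. *)
pose g : mat2 := ((d%:Z * k%:Z - (b * M)%N%:Z, - v), ((M * a)%N%:Z, u)).
pose g1 : mat2 := ((k%:Z, b%:Z * u - a%:Z * v), (M%:Z, d%:Z * u)).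
have dg : mdet g = 1 by rewrite /mdet /g -uv; ring.
have dg1 : mdet g1 = 1 by rewrite /mdet /g1 -uv !PoszM; ring.
exists g; split; [exact: dg | by rewrite /= PoszM dvdz_mulr |].
move=> tau t0.
have Nt : 0 < complex.Im (N%:R * tau).
  by rewrite -(Realn R N) ImM ReC ImC mul0r addr0 mulr_gt0 // ltr0n.
have Mg1 : (M%:Z %| g1.2.1)%Z by exact: dvdzz.
rewrite -(hauptmodul_invariant hM dg1 Mg1 Nt); apply: congr1.
have [n1 _] := im_moebius_int (dg1 : _ * _ - _ * _ = 1) Nt.
have [n2 _] := im_moebius_int (dg : _ * _ - _ * _ = 1) t0.
have dn : d%:R != 0 :> R[i] by rewrite pnatr_eq0 -lt0n.
rewrite /alpha /mact /g /g1 -ad natrM in n1 n2 *.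
move: n1 n2; rewrite !(intrM, intrB, intrD, intrN, PoszM) -!pmulrn => n1 n2.
by field; rewrite dn n1 n2.
Qed.

End Transitivity.

(** * Irreducibility *)

Section Eventually.
Variable R : realType.
Implicit Types (A B : R[i] -> Prop) (tau : R[i]).

Definition evt A := exists2 Y : R, 0 < Y & forall tau, Y < complex.Im tau -> A tau.

Lemma evtI A B : evt A -> evt B -> evt (fun tau => A tau /\ B tau).
Proof.
move=> [Y Y0 hA] [Z Z0 hB]; exists (Num.max Y Z); first by rewrite lt_max Y0.
by move=> tau; rewrite gt_max => /andP[/hA ? /hB ?].
Qed.

Lemma evt_all (T : eqType) (s : seq T) (P : T -> R[i] -> Prop) :
  (forall x, x \in s -> evt (P x)) -> evt (fun tau => forall x, x \in s -> P x tau).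
Proof.
elim: s => [_|x s IH h]; first by exists 1.
have h1 := h x (mem_head x s).
have h2 : evt (fun tau => forall y, y \in s -> P y tau).
  by apply: IH => y ys; apply: h; rewrite inE ys orbT.
have [Y Y0 hY] := evtI h1 h2; exists Y => // tau /hY[hx hs] y.
by rewrite inE => /orP[/eqP->|/hs].
Qed.

Lemma evt_ex A : evt A -> exists2 tau, 0 < complex.Im tau & A tau.
Proof.
move=> [Y Y0 hA]; exists (0 +i* (Y + 1)); first by rewrite /= addr_gt0.
by apply: hA; rewrite /= ltrDl.
Qed.

End Eventually.

(** * Denominators of polynomials over a fraction field *)

Section ClearDenominators.
Variable A : idomainType.

Local Notation "x %:F" := (@tofrac _ x).

Lemma fraction_mul_denom (c : {fraction A}) :
  exists n d : A, d != 0 /\ c * d%:F = n%:F.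
Proof.
have [x ->] : exists x : ratio A, c = (\pi_{fraction A} x)%qT.
  by exists (repr c); rewrite reprK.
exists (frac x).1, (frac x).2; split; first exact: denom_ratioP.
rewrite -[LHS]/(FracField.mul (\pi_(FracField.type A) x)%qT (FracField.tofrac (frac x).2)).
rewrite -[RHS]/(FracField.tofrac (frac x).1) !piE; apply/eqP.
rewrite FracField.equivf_def /FracField.mulf.
by rewrite !numden_Ratio ?mulf_neq0 ?oner_eq0 ?denom_ratioP // !mulr1 mulrC.
Qed.

Lemma clear_denominators (q : {poly {fraction A}}) : exists (e : A) (Q : {poly A}),
  e != 0 /\ e%:F *: q = map_poly (@tofrac A) Q.
Proof.
elim/poly_ind: q => [|q c [e [Q [e0 eQ]]]].
  by exists 1, 0; rewrite oner_neq0 scaler0 rmorph0.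
have [n [d [d0 cd]]] := fraction_mul_denom c.
exists (e * d), (d *: Q * 'X + (e * n)%:P); split; first by rewrite mulf_neq0.
rewrite rmorphD /= [map_poly _ (_ * 'X)]rmorphM /= map_polyX map_polyC /= map_polyZ.
rewrite -eQ !rmorphM /= -cd.
rewrite scalerDr -!scalerAl !scalerA; congr (_ + _); first by rewrite mulrC.
by rewrite -mul_polyC -[LHS]polyCM -(mulrA e%:F) (mulrC d%:F) [LHS]polyCM.
Qed.

End ClearDenominators.

(** * Factors of the modular polynomial *)

Section Irreducibility.
Variable R : realType.
Variables M N : nat.
Hypotheses (hM : M \in levels) (N0 : (0 < N)%N) (MN : coprime M N).
Implicit Types tau : R[i].

Let t tau : R[i] := hauptmodul M tau.

(** A triple is read as ((a, d), b), in the order of the nested products; b gets the bound of d so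
    that the index type is not dependent. *)
Let T := ('I_N.+1 * 'I_N.+1 * 'I_N.+1)%type.

Let adm (p : T) : bool :=
  [&& 0 < p.1.1, 0 < p.1.2, p.1.1 * p.1.2 == N, p.2 < p.1.2 &
      gcdn (gcdn p.1.1 p.2) p.1.2 == 1]%N.

Let idx : seq T := [seq p <- index_enum T | adm p].

Let f (p : T) tau : R[i] := t (alpha p.1.1 p.2 p.1.2 tau).

Lemma idxP (p : T) : p \in idx -> [/\ (p.1.1 * p.1.2 = N)%N, (p.2 < p.1.2)%N &
  gcdn (gcdn p.1.1 p.2) p.1.2 = 1%N].
Proof. by rewrite mem_filter => /andP[/and5P[_ _ /eqP ? ? /eqP ?] _]. Qed.

Lemma modular_product tau :
  \prod_(a < N.+1) \prod_(d < N.+1 | [&& 0 < a, 0 < d & a * d == N]%N)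
      \prod_(b < d | gcdn (gcdn a b) d == 1%N)
        ('X - (hauptmodul M ((a%:R * tau + b%:R) / d%:R))%:P) =
  \prod_(p <- idx) ('X - (f p tau)%:P).
Proof.
rewrite /idx big_filter.
transitivity (\prod_(a < N.+1) \prod_(d < N.+1 | [&& 0 < a, 0 < d & a * d == N]%N)
    \prod_(b < N.+1 | (gcdn (gcdn a b) d == 1%N) && (b < d)%N) ('X - (f (a, d, b) tau)%:P)).
  apply: eq_bigr => a _; apply: eq_bigr => d _.
  have dN : (d <= N.+1)%N by apply: ltnW.
  exact: (big_ord_widen_cond _ (fun b => gcdn (gcdn a b) d == 1%N)
    (fun b => 'X - (hauptmodul M ((a%:R * tau + b%:R) / d%:R))%:P) dN).
rewrite pair_big_dep /= pair_big_dep /=.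
apply: eq_big => [[[a d] b]|[[a d] b] _]; last by [].
by rewrite /adm /= -!andbA; congr [&& _, _, _ & _]; rewrite andbC.
Qed.

Lemma f_mero p : p \in idx -> mero (24 * N) (f p).
Proof.
move=> /idxP[ad bd _].
have [a0 d0] : (0 < p.1.1)%N /\ (0 < p.1.2)%N by apply/andP; rewrite -muln_gt0 ad.
have /and4P[pos _ _ _] := allP eta_exponents_check M hM.
have dN : (p.1.2 %| p.1.1 * N)%N by apply: dvdn_mull;
  move: (dvdn_mull p.1.1 (dvdnn p.1.2)); rewrite ad.
apply: mero_ext (@etaq_alpha_mero R N p.1.1 p.2 p.1.2 N0 a0 d0 dN _ pos) => tau _.
by rewrite /f /t hauptmodul_etaq.
Qed.

Lemma t_mero : mero (24 * N) t.
Proof.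
have /and4P[pos _ _ _] := allP eta_exponents_check M hM.
have h := @etaq_alpha_mero R N 1 0 1 N0 isT isT (dvd1n _) _ pos.
apply: mero_ext h => tau _.
have -> : alpha 1 0 1 tau = tau by rewrite /alpha mul1r addr0 divr1.
by rewrite /t (hauptmodul_etaq tau hM).
Qed.

Let N24 : (0 < 24 * N)%N. Proof. by rewrite muln_gt0. Qed.

Lemma evt_nonroot (e : {poly R[i]}) : e != 0 -> evt (fun tau => e.[t tau] != 0).
Proof.
move=> e0; have [h|h] := mero_dichotomy N24 (mero_poly e t_mero); last exact: h.
by move: e0; rewrite (hauptmodul_transcendental hM h) eqxx.
Qed.

Lemma evt_distinct : evt (fun tau => uniq [seq f p tau | p <- idx]).
Proof.
have pairs : evt (fun tau => forall p, p \in idx -> forall q, q \in idx -> p != q ->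
    f p tau != f q tau).
  apply: evt_all => p pi; apply: evt_all => q qi.
  have [->|pq] := eqVneq p q; first by exists 1.
  have hD : mero (24 * N) (fun tau => f p tau + (-1) * f q tau).
    by apply: meroD; [exact: f_mero | apply: meroM; [exact: mero_cst | exact: f_mero]].
  have [h|[Y Y0 hY]] := mero_dichotomy N24 hD; last first.
    by exists Y => // tau /hY; rewrite mulN1r subr_eq0.
  have [ad bd _] := idxP pi; have [ad' bd' _] := idxP qi.
  have [|e1 e2 e3] := hauptmodul_alpha_inj (R := R) hM N0 ad ad' bd bd'.
    by move=> tau t0; apply/eqP; rewrite -subr_eq0 -mulN1r; apply/eqP/h.
  move: pq e1 e2 e3; case: (p) => [[a d] b]; case: (q) => [[a' d'] b'] /= /eqP ne.
  by move=> /val_inj e1 /val_inj e2 /val_inj e3; case: ne; rewrite e1 e2 e3.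
have [Y Y0 hY] := pairs; exists Y => // tau /hY h.
have inj : {in idx &, injective (f^~ tau)}.
  move=> p q pi qi e; apply/eqP; apply: contraT => pq.
  exfalso; exact: (elimN eqP (h p pi q qi pq) e).
by rewrite (map_inj_in_uniq inj); apply: filter_uniq; apply: index_enum_uniq.
Qed.

Let ev tau (Q : {poly {poly R[i]}}) := map_poly (horner_eval (t tau)) Q.

Let vanish (Q : {poly {poly R[i]}}) p :=
  forall tau, 0 < complex.Im tau -> (ev tau Q).[f p tau] = 0.

Lemma vanish_transitive Q p : p \in idx ->
  vanish Q p <-> (forall tau, 0 < complex.Im tau -> (ev tau Q).[t (N%:R * tau)] = 0).
Proof.
move=> /idxP[ad bd cop]; have [g [dg Mg hg]] := alpha_transitive R hM N0 MN ad cop.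
have inv tau : 0 < complex.Im tau -> t (mact g tau) = t tau by apply: hauptmodul_invariant.
have key tau : 0 < complex.Im tau ->
    (ev (mact g tau) Q).[f p (mact g tau)] = (ev tau Q).[t (N%:R * tau)].
  move=> t0; rewrite /ev (inv tau t0).
  exact: (congr1 (horner (map_poly (horner_eval (t tau)) Q)) (hg tau t0)).
split=> h tau t0; first by rewrite -(key tau t0); exact: h (mact_im dg t0).
have d' : mdet (madj g) = 1 by rewrite mdet_adj.
have t1 := mact_im d' t0.
have gg : mact g (mact (madj g) tau) = tau.
  rewrite -(mactM dg d' t0) (mmul_adj dg).2 /= mul1r addr0 mul0r add0r.
  exact: divr1.
by rewrite -gg (key _ t1); exact: h t1.
Qed.

Lemma vanish_size Q : Q != 0 -> (forall p, p \in idx -> vanish Q p) ->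
  (size idx < size Q)%N.
Proof.
move=> Q0 h; have lc0 : lead_coef Q != 0 by rewrite lead_coef_eq0.
have [tau t0 [un lc]] := evt_ex (evtI evt_distinct (evt_nonroot lc0)).
have sQ : size (ev tau Q) = size Q by apply: size_map_poly_id0.
have evQ0 : ev tau Q != 0 by rewrite -size_poly_eq0 sQ size_poly_eq0.
have rs : all (root (ev tau Q)) [seq f p tau | p <- idx].
  by apply/allP => _ /mapP[p pi ->]; apply/rootP/h.
by have := max_poly_roots evQ0 rs un; rewrite size_map sQ.
Qed.

Variable Psi : {poly {poly int}}.
Hypothesis hPsi : is_modular_polynomial R M N Psi.

Let P : {poly {poly R[i]}} := map_poly (map_poly intr) Psi.

Lemma evP tau : 0 < complex.Im tau -> ev tau P = \prod_(p <- idx) ('X - (f p tau)%:P).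
Proof.
move=> t0; rewrite -modular_product -hPsi // /ev /P -map_poly_comp.
by apply: eq_map_poly.
Qed.

Lemma P_neq0 : P != 0.
Proof.
apply/eqP => P0; have [tau t0 _] := evt_ex evt_distinct.
have /eqP := evP t0; rewrite P0 /ev rmorph0 eq_sym.
by rewrite prodf_seq_eq0 => /hasP[p _] /=; rewrite polyXsubC_eq0.
Qed.

Lemma size_P : size P = (size idx).+1.
Proof.
have lc0 : lead_coef P != 0 by rewrite lead_coef_eq0 P_neq0.
have [tau t0 lc] := evt_ex (evt_nonroot lc0).
rewrite -(size_map_poly_id0 (f := horner_eval (t tau)) lc) -/(ev tau P) evP //.
by rewrite size_prod_XsubC.
Qed.

Lemma idx_gt0 : (0 < size idx)%N.
Proof.
have h1 : (1 < N.+1)%N by [].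
have hN : (N < N.+1)%N by [].
have h0 : (0 < N.+1)%N by [].
have : (Ordinal hN, Ordinal h1, Ordinal h0) \in idx.
  by rewrite mem_filter /adm /= N0 muln1 eqxx gcdn1 eqxx mem_index_enum.
by case: idx.
Qed.

Lemma factor_vanish (e : {poly R[i]}) (A B : {poly {poly R[i]}}) p : p \in idx ->
  e *: P = A * B -> vanish A p \/ vanish B p.
Proof.
move=> pi eAB.
have mA := mero_poly2 A (f_mero pi) t_mero.
have mB := mero_poly2 B (f_mero pi) t_mero.
have [hA|hA] := mero_dichotomy N24 mA; first by left.
have [hB|hB] := mero_dichotomy N24 mB; first by right.
have [tau t0 [a0 b0]] := evt_ex (evtI hA hB); exfalso.
have := congr1 (fun Q => (ev tau Q).[f p tau]) eAB.
rewrite /ev rmorphM /= hornerM map_polyZ hornerZ -/(ev tau P) evP //.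
rewrite (big_rem _ pi) /= hornerM hornerXsubC subrr mul0r mulr0 => /esym/eqP.
by rewrite mulf_eq0 (negbTE a0) (negbTE b0).
Qed.

Lemma poly_over_CY_irreducible : irreducible_poly (poly_over_CY R Psi).
Proof.
have pE : poly_over_CY R Psi = map_poly (@tofrac _) P.
  by rewrite /P -map_poly_comp.
have inj : injective (@tofrac {poly R[i]}).
  by move=> x y /eqP; rewrite tofrac_eq => /eqP.
have szF (Q : {poly {poly R[i]}}) : size (map_poly (@tofrac _) Q) = size Q.
  by apply: size_map_inj_poly; rewrite ?rmorph0.
have [p0 p0i] : exists p0, p0 \in idx.
  by have := idx_gt0; case: idx => // p s _; exists p; rewrite mem_head.
have all_van Q : vanish Q p0 -> forall p, p \in idx -> vanish Q p.
  by move=> /(vanish_transitive _ p0i) h p pi; apply/(vanish_transitive _ pi).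
have szp : size (poly_over_CY R Psi) = (size idx).+1 by rewrite pE szF size_P.
have p_neq0 : poly_over_CY R Psi != 0 by rewrite -size_poly_eq0 szp.
split=> [|q q1 qp]; first by rewrite szp ltnS idx_gt0.
rewrite -(dvdp_size_eqp qp).
have /dvdpP[r pq] := qp.
have [e1 [Q [e10 eQ]]] := clear_denominators q.
have [e2 [S [e20 eS]]] := clear_denominators r.
have eF (e : {poly R[i]}) : e != 0 -> tofrac e != 0 by rewrite tofrac_eq0.
have szq : size q = size Q by rewrite -szF -eQ size_scale ?eF.
have szr : size r = size S by rewrite -szF -eS size_scale ?eF.
have [r0 q0] : r != 0 /\ q != 0 by apply/andP; rewrite -negb_or -mulf_eq0 -pq.
have Q0 : Q != 0 by rewrite -size_poly_eq0 -szq size_poly_eq0.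
have S0 : S != 0 by rewrite -size_poly_eq0 -szr size_poly_eq0.
have eSQ : (e2 * e1) *: P = S * Q.
  apply: (map_inj_poly inj (rmorph0 _)).
  rewrite rmorphM /= -eS -eQ map_polyZ -pE pq rmorphM /=.
  by rewrite -scalerAl -scalerAr scalerA.
have szpq : size (poly_over_CY R Psi) = (size r + size q).-1 by rewrite pq size_mul.
have r_gt0 : (0 < size r)%N by rewrite lt0n size_poly_eq0.
have q_gt0 : (0 < size q)%N by rewrite lt0n size_poly_eq0.
have [vS|vQ] := factor_vanish p0i eSQ.
  have := vanish_size S0 (all_van _ vS); rewrite -szr => h.
  exfalso; move: szpq q1 h r_gt0 q_gt0; rewrite szp; clear; lia.
have := vanish_size Q0 (all_van _ vQ); rewrite -szq => h.
apply/eqP; move: szpq h r_gt0 q_gt0; rewrite szp; clear; lia.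
Qed.

End Irreducibility.

Theorem theorem2p10 (R : realType) (M N : nat)
  (hM : M \in [:: 2; 3; 4; 5; 6; 7; 8; 9; 10; 12; 13; 16; 18; 25]%N)
  (hN : (0 < N)%N) (hMN : coprime M N)
  (Psi : {poly {poly int}}) (hPsi : is_modular_polynomial R M N Psi) :
  irreducible_poly (poly_over_CY R Psi).
Proof. exact: (poly_over_CY_irreducible hM hN hMN hPsi). Qed.
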